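(* Let $M=\mathbb{R}^8/\Lambda$ be a real $8$-torus with the flat metric and the standard $\mathrm{Spin}(7)$-structure $\Omega$, let $\mathcal{U}'$ be the family of $\mathrm{SU}(4)$-structures on $M$ compatible with $\Omega$, and let $I\in\mathcal{U}'$ be such that the complex $4$-torus $(M,I)$ is algebraic. Let $E\to M$ be a hermitian complex vector bundle with a hermitian connection $A$ which is Hermitian-Yang-Mills (HYM) with respect to $I$, and assume that $c_1(E)=0$. Then for every $L\in\mathcal{U}'$ $$c_2(E)\cup[\omega_L]^2\le c_2(E)\cup[\omega_I]^2,$$ with equality if and only if $E$ (i.e. the connection $A$) is HYM with respect to $L$.
   Context: $\Lambda\subset\mathbb{R}^8$ is a lattice and $\mathbb{R}^8$ has its standard flat metric and orientation. The $\mathrm{Spin}(7)$-structure is given by the $4$-form $$\Omega=dx_{1234}+dx_{1256}+dx_{1278}+dx_{1357}-dx_{1368}-dx_{1458}-dx_{1467}-dx_{2358}-dx_{2367}-dx_{2457}+dx_{2468}+dx_{3456}+dx_{3478}+dx_{5678},$$ where $dx_{ijkl}=dx_i\wedge dx_j\wedge dx_k\wedge dx_l$; $\mathrm{Spin}(7)<\mathrm{SO}(8)$ is its isotropy subgroup. An $\mathrm{SU}(4)$-structure is a parallel (constant) complex structure $I$ on $M$ compatible with the metric, with Kähler form $\omega_I$, together with a parallel $(4,0)$-form $\theta$ with $|\theta|=4$. It is compatible with the $\mathrm{Spin}(7)$-structure if $\frac12\omega_I^2+\mathrm{Re}(\theta)=\Omega$. The compatible $\mathrm{SU}(4)$-structures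 form the family $\mathcal{U}'=\mathrm{Spin}(7)/\mathrm{SU}(4)\cong S^6$; we denote an element by its complex structure. The map $L\mapsto\omega_L$ identifies $\mathcal{U}'$ with the sphere of elements of norm $2$ in the $7$-dimensional space $\bigwedge^2_7=\{\alpha\in\bigwedge^2(\mathbb{R}^8)^*:\Omega\wedge\alpha=3*\alpha\}$. A hermitian connection $A$ with curvature $F_A$ is HYM with respect to $L$ if $F_A$ is of type $(1,1)$ with respect to $L$ and $\Lambda_L F_A=\lambda\,\mathrm{Id}$ for some constant $\lambda$, where $\Lambda_L$ is contraction with $\omega_L$. Classes in $H^8(M,\mathbb{R})$ are identified with real numbers by integration over $M$. *)

(* Defs.v *)
From HB Require Import structures.
From mathcomp Require Import all_boot all_order all_algebra.
From mathcomp Require Import all_classical all_reals all_analysis.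
From mathcomp Require Import complex.

Set Implicit Arguments.
Unset Strict Implicit.
Unset Printing Implicit Defensive.
Import Order.TTheory GRing.Theory Num.Theory.
Import numFieldNormedType.Exports.
Local Open Scope ring_scope.
Local Open Scope complex_scope.

(* A form with coefficients in K is given by its coordinates in the basis
   dx_S = dx_{i_1} /\ ... /\ dx_{i_k}, for S = {i_1 < ... < i_k}.  The
   coordinates of R^8 are numbered from 0, so dx_1 is the form dx_S with
   S = [set ord0]. *)
Definition form (K : Type) := {ffun {set 'I_8} -> K}.

Definition homogeneous (K : nmodType) (k : nat) (a : form K) : Prop :=
  forall S : {set 'I_8}, #|S| != k -> a S = 0.

(* dx_T /\ dx_U = (-1) ^ inversions T U * dx_(T :|: U) for T, U disjoint. *)
Definition inversions (T U : {set 'I_8}) : nat :=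
  #|[set p : 'I_8 * 'I_8 | [&& p.1 \in T, p.2 \in U & (p.2 < p.1)%N]]|.

(* K need not be commutative: K = 'M_r gives the product of End(E)-valued
   forms. *)
Definition wedge (K : pzRingType) (a b : form K) : form K :=
  [ffun S : {set 'I_8} => \sum_(T : {set 'I_8} | T \subset S)
     (-1) ^+ inversions T (S :\: T) * (a T * b (S :\: T))].

(* Contraction with the first argument: a |-> a(w, -, ..., -). *)
Definition contract (K : pzRingType) (w : 'rV[K]_8) (a : form K) : form K :=
  [ffun S : {set 'I_8} => \sum_(i | i \notin S)
     (-1) ^+ #|[set j in S | (j < i)%N]| * w 0 i * a (i |: S)].

(* dx [:: i; j; k; l] is dx_{ijkl} with the usual indices 1..8, for
   i < j < k < l. *)
Definition dx (K : pzRingType) (s : seq nat) : form K :=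
  [ffun S : {set 'I_8} => (S == [set i : 'I_8 | i.+1 \in s])%:R].

Definition Omega (R : realType) : form R := [ffun S =>
    dx R [:: 1; 2; 3; 4] S + dx R [:: 1; 2; 5; 6] S + dx R [:: 1; 2; 7; 8] S
  + dx R [:: 1; 3; 5; 7] S - dx R [:: 1; 3; 6; 8] S - dx R [:: 1; 4; 5; 8] S
  - dx R [:: 1; 4; 6; 7] S - dx R [:: 2; 3; 5; 8] S - dx R [:: 2; 3; 6; 7] S
  - dx R [:: 2; 4; 5; 7] S + dx R [:: 2; 4; 6; 8] S + dx R [:: 3; 4; 5; 6] S
  + dx R [:: 3; 4; 7; 8] S + dx R [:: 5; 6; 7; 8] S].

(* Vectors are rows and an endomorphism L acts by v |-> v *m L.  Then
   L i j = g(L e_i, e_j), so that this is omega_L(v, w) = g(L v, w). *)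
Definition kahler (R : realType) (L : 'M[R]_8) : form R :=
  [ffun S : {set 'I_8} =>
     \sum_(i < 8) \sum_(j < 8 | (i < j)%N && (S == [set i; j])) L i j].

Definition hermitian_structure (R : realType) (L : 'M[R]_8) : Prop :=
  L *m L = - 1%:M /\ L *m L^T = 1%:M.

Definition vector10 (R : realType) (L : 'M[R]_8) (w : 'rV[R[i]]_8) : Prop :=
  w *m map_mx (real_complex R) L = ('i : R[i]) *: w.

Definition vector01 (R : realType) (L : 'M[R]_8) (w : 'rV[R[i]]_8) : Prop :=
  w *m map_mx (real_complex R) L = - ('i : R[i]) *: w.

(* A (p + q)-form is of type (p, q) when evaluating it on vectors each of
   which is of type (1, 0) or (0, 1) gives 0, unless exactly p of them are of
   type (1, 0) and q of type (0, 1); that is, contracting p + 1 vectors of type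
   (1, 0), or q + 1 vectors of type (0, 1), gives 0. *)
Definition has_type (R : realType) (L : 'M[R]_8) (p q : nat) (a : form R[i]) :
    Prop :=
  [/\ homogeneous (p + q) a,
      forall ws : seq 'rV[R[i]]_8, size ws = p.+1 ->
        (forall w, w \in ws -> vector10 L w) ->
        forall S, foldr (@contract R[i]) a ws S = 0
    & forall ws : seq 'rV[R[i]]_8, size ws = q.+1 ->
        (forall w, w \in ws -> vector01 L w) ->
        forall S, foldr (@contract R[i]) a ws S = 0].

(* The norm for which the dx_S are orthonormal. *)
Definition form_norm (R : realType) (a : form R[i]) : R :=
  Num.sqrt (\sum_(S : {set 'I_8}) (ComplexField.Normc.normc (a S)) ^+ 2).

Definition SU4_structure (R : realType) (L : 'M[R]_8) (theta : form R[i]) :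
    Prop :=
  [/\ hermitian_structure L, has_type L 4 0 theta & form_norm theta = 4].

Definition Spin7_compatible (R : realType) (L : 'M[R]_8)
    (theta : form R[i]) : Prop :=
  forall S, 2^-1 * wedge (kahler L) (kahler L) S + complex.Re (theta S)
            = Omega R S.

(* The family U'; theta is determined by L, and an element is denoted by its
   complex structure. *)
Definition U' (R : realType) (L : 'M[R]_8) : Prop :=
  exists theta : form R[i], SU4_structure L theta /\ Spin7_compatible L theta.

Definition partial (R : realType) (j : 'I_8) (f : 'rV[R]_8 -> R) :
    'rV[R]_8 -> R :=
  fun x => 'D_(delta_mx 0 j) f x.

Fixpoint Ck (R : realType) (k : nat) (U : set 'rV[R]_8) (f : 'rV[R]_8 -> R) :
    Prop :=
  (forall x, U x -> {for x, continuous f}) /\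
  match k with
  | 0%N => True
  | k'.+1 => forall j : 'I_8,
      (forall x, U x -> derivable f x (delta_mx 0 j)) /\ Ck k' U (partial j f)
  end.

(* Meant for open U. *)
Definition smooth (R : realType) (U : set 'rV[R]_8) (f : 'rV[R]_8 -> R) :
    Prop :=
  forall k, Ck k U f.

Definition smoothC (R : realType) (U : set 'rV[R]_8) (f : 'rV[R]_8 -> R[i]) :
    Prop :=
  smooth U (fun x => complex.Re (f x)) /\ smooth U (fun x => complex.Im (f x)).

Definition smoothM (R : realType) (m n : nat) (U : set 'rV[R]_8)
    (f : 'rV[R]_8 -> 'M[R[i]]_(m, n)) : Prop :=
  forall a b, smoothC U (fun x => f x a b).

Definition partialC (R : realType) (j : 'I_8) (f : 'rV[R]_8 -> R[i]) :
    'rV[R]_8 -> R[i] :=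
  fun x => partial j (fun y => complex.Re (f y)) x
           +i* partial j (fun y => complex.Im (f y)) x.

Definition partialM (R : realType) (m n : nat) (j : 'I_8)
    (f : 'rV[R]_8 -> 'M[R[i]]_(m, n)) : 'rV[R]_8 -> 'M[R[i]]_(m, n) :=
  fun x => \matrix_(a, b) partialC j (fun y => f y a b) x.

(* Exterior derivative of a form-valued function; D gives the partial
   derivatives of K-valued functions. *)
Definition ext_d (R : realType) (K : pzRingType)
    (D : 'I_8 -> ('rV[R]_8 -> K) -> 'rV[R]_8 -> K)
    (a : 'rV[R]_8 -> form K) : 'rV[R]_8 -> form K :=
  fun x => [ffun S : {set 'I_8} => \sum_(i in S)
     (-1) ^+ #|[set j in S | (j < i)%N]| * D i (fun y => a y (S :\ i)) x].

(* The lattice Lambda whose Z-basis is given by the rows of B. *)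
Definition lattice (R : realType) (B : 'M[R]_8) : set 'rV[R]_8 :=
  [set map_mx (fun z : int => z%:~R : R) n *m B | n in [set: 'rV[int]_8]]%classic.

(* Open subsets of M and functions on them are represented by their pullbacks
   to R^8. *)
Definition periodic_set (R : realType) (B : 'M[R]_8) (U : set 'rV[R]_8) :
    Prop :=
  forall x l, lattice B l -> U x -> U (x + l).

Definition periodic_on (R : realType) (B : 'M[R]_8) (T : Type)
    (U : set 'rV[R]_8) (f : 'rV[R]_8 -> T) : Prop :=
  forall x l, lattice B l -> U x -> f (x + l) = f x.

Fixpoint cube_integral (R : realType) (n : nat) : ('rV[R]_n -> R) -> R :=
  match n with
  | 0%N => fun f => f 0
  | n'.+1 => fun f =>
      Rintegral (@lebesgue_measure R) `[0, 1]%classic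
        (fun t : R => cube_integral
           (fun u : 'rV[R]_n' => f (row_mx (t%:M : 'M[R]_1) u)))
  end.

(* Integral over M, with the standard orientation, of the 8-form f dx_{1...8}:
   the integral of f over the fundamental parallelepiped {t *m B} of Lambda,
   t in [0, 1]^8. *)
Definition torus_integral (R : realType) (B : 'M[R]_8) (f : 'rV[R]_8 -> R) :
    R :=
  `|\det B| * cube_integral (fun t : 'rV[R]_8 => f (t *m B)).

Definition collinear (R : realType) (N : nat) (u v : 'rV[R[i]]_N) : Prop :=
  exists2 c : R[i], c != 0 & v = c *: u.

(* (M, L) is algebraic: it has a holomorphic embedding in some CP^N (its image
   is algebraic by Chow's theorem).  The map sends x to the line spanned by
   phi x; near every point it has a lift psi to C^(N+1) \ 0 that is smooth and
   satisfies d psi (L v) = 'i d psi (v), and its differential, d psi (v) modulo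
   psi, is injective. *)
Definition algebraic_torus (R : realType) (B L : 'M[R]_8) : Prop :=
  exists (N : nat) (phi : 'rV[R]_8 -> 'rV[R[i]]_N.+1),
    [/\ forall x, phi x != 0,
        forall x y, collinear (phi x) (phi y) <-> lattice B (x - y)
      & forall x0, exists (U : set 'rV[R]_8)
                          (psi : 'rV[R]_8 -> 'rV[R[i]]_N.+1),
          [/\ open U /\ U x0,
              smoothM U psi,
              forall x, U x -> psi x != 0 /\ collinear (phi x) (psi x),
              forall x, U x -> forall i : 'I_8,
                \sum_(j < 8) (L i j)%:C *: partialM j psi x
                = ('i : R[i]) *: partialM i psi x
            & forall x, U x -> forall (v : 'rV[R]_8) (c : R[i]),
                \sum_(j < 8) (v 0 j)%:C *: partialM j psi x = c *: psi x ->
                v = 0]].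

Definition adjoint (R : realType) (r : nat) (a : 'M[R[i]]_r) : 'M[R[i]]_r :=
  map_mx (@conjc R) a^T.

(* A smooth hermitian bundle of rank r on M, given by a trivialising open cover
   with local unitary frames.  In the i-th frame a section has components
   s_i in C^r, and s_i = g_ij s_j on overlaps, with g_ij = trans i j. *)
Record hermitian_bundle (R : realType) (B : 'M[R]_8) (r : nat) := HermBundle {
  chart : Type;
  dom : chart -> set 'rV[R]_8;
  trans : chart -> chart -> 'rV[R]_8 -> 'M[R[i]]_r;
  dom_open : forall i, open (dom i);
  dom_periodic : forall i, periodic_set B (dom i);
  dom_cover : forall x, exists i, dom i x;
  trans_smooth : forall i j, smoothM (dom i `&` dom j)%classic (trans i j);
  trans_periodic : forall i j, periodic_on B (dom i `&` dom j)%classic (trans i j);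
  trans_unitary : forall i j x, dom i x -> dom j x ->
    trans i j x *m adjoint (trans i j x) = 1%:M;
  trans_cocycle : forall i j k x, dom i x -> dom j x -> dom k x ->
    trans i j x *m trans j k x = trans i k x }.

(* A hermitian connection, given by its u(r)-valued connection 1-forms A_i in
   the local frames: it sends s_i to d s_i + A_i s_i, so that
   A_i = g_ij A_j g_ij^-1 - (d g_ij) g_ij^-1. *)
Record hermitian_connection (R : realType) (B : 'M[R]_8) (r : nat)
    (E : hermitian_bundle B r) := HermConnection {
  conn : chart E -> 'rV[R]_8 -> form 'M[R[i]]_r;
  conn_degree : forall i x, dom i x -> homogeneous 1 (conn i x);
  conn_smooth : forall i S, smoothM (dom i) (fun x => conn i x S);
  conn_periodic : forall i, periodic_on B (dom i) (conn i);
  conn_skew : forall i x S, dom i x -> adjoint (conn i x S) = - conn i x S;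
  conn_gauge : forall i j x (k : 'I_8), dom i x -> dom j x ->
    conn i x [set k]%SET *m trans i j x
    = trans i j x *m conn j x [set k]%SET - partialM k (trans i j) x }.

Definition curvature (R : realType) (B : 'M[R]_8) (r : nat)
    (E : hermitian_bundle B r) (A : hermitian_connection E) (i : chart E)
    (x : 'rV[R]_8) : form 'M[R[i]]_r :=
  [ffun S => ext_d (@partialM R r r) (conn A i) x S
             + wedge (conn A i x) (conn A i x) S].

(* Inner product of the 2-form F with omega_L: the adjoint of exterior
   multiplication by omega_L. *)
Definition Lambda_contract (R : realType) (L : 'M[R]_8) (r : nat)
    (F : form 'M[R[i]]_r) : 'M[R[i]]_r :=
  \sum_(S : {set 'I_8}) (kahler L S)%:C *: F S.

Definition HYM (R : realType) (B : 'M[R]_8) (r : nat)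
    (E : hermitian_bundle B r) (A : hermitian_connection E) (L : 'M[R]_8) :
    Prop :=
  (forall (i : chart E) x, dom i x -> forall a b : 'I_r,
     has_type L 1 1 [ffun S => curvature A i x S a b]) /\
  (exists lambda : R[i], forall (i : chart E) x, dom i x ->
     Lambda_contract L (curvature A i x) = lambda%:M).

Definition trace_form (R : realType) (r : nat) (F : form 'M[R[i]]_r) :
    form R[i] := [ffun S => \tr (F S)].

(* Traces of products of curvature forms do not depend on the chart. *)
Definition chart_at (R : realType) (B : 'M[R]_8) (r : nat)
    (E : hermitian_bundle B r) (x : 'rV[R]_8) : chart E :=
  projT1 (cid (dom_cover E x)).

(* Chern-Weil: i / (2 pi) tr F *)
Definition c1_form (R : realType) (B : 'M[R]_8) (r : nat)
    (E : hermitian_bundle B r) (A : hermitian_connection E) (x : 'rV[R]_8) :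
    form R :=
  [ffun S => complex.Re
     ('i * ((2 * pi)^-1)%:C * trace_form (curvature A (chart_at E x) x) S)].

(* Chern-Weil: 1 / (8 pi^2) (tr (F /\ F) - tr F /\ tr F) *)
Definition c2_form (R : realType) (B : 'M[R]_8) (r : nat)
    (E : hermitian_bundle B r) (A : hermitian_connection E) (x : 'rV[R]_8) :
    form R :=
  let F := curvature A (chart_at E x) x in
  [ffun S => complex.Re (((8 * pi ^+ 2)^-1)%:C
     * (trace_form (wedge F F) S - wedge (trace_form F) (trace_form F) S))].

(* The class c_1(E) vanishes in de Rham cohomology.  As H^2(M, Z) has no
   torsion, this is the same as c_1(E) = 0 in H^2(M, Z). *)
Definition c1_zero (R : realType) (B : 'M[R]_8) (r : nat)
    (E : hermitian_bundle B r) (A : hermitian_connection E) : Prop :=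
  exists eta : 'rV[R]_8 -> form R,
    [/\ forall x, homogeneous 1 (eta x),
        forall S, smooth [set: 'rV[R]_8]%classic (fun x => eta x S),
        periodic_on B [set: 'rV[R]_8]%classic eta
      & forall x, c1_form A x = ext_d (@partial R) eta x].

Definition c2_cup_kahler2 (R : realType) (B : 'M[R]_8) (r : nat)
    (E : hermitian_bundle B r) (A : hermitian_connection E) (L : 'M[R]_8) : R :=
  torus_integral B (fun x =>
    wedge (c2_form A x) (wedge (kahler L) (kahler L)) [set: 'I_8]%SET).

(* Main.v *)
Require Import Defs.
From mathcomp Require Import all_boot all_order all_algebra.
From mathcomp Require Import all_classical all_reals all_analysis.
From mathcomp Require Import complex.
From mathcomp Require Import ring lra zify.
Import Defs.
Set Implicit Arguments.
Unset Strict Implicit.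
Unset Printing Implicit Defensive.
Import Order.TTheory GRing.Theory Num.Theory.
Import numFieldNormedType.Exports.
Local Open Scope ring_scope.

(** Write F for the curvature of A.

    Linear algebra.  Contracting the (4,0)-form of an SU(4)-structure with its own
    Kaehler form gives 0, so the compatibility condition turns into the linear system
    Omega contracted with omega_K = 3 omega_K ([U'_contraction]).  Its solutions depend
    on the entries of their first row ([U'_entry]), and from this explicit form
    one reads off that any two members of U' anticommute up to a scalar matrix
    ([U'_clifford]) and that the square of omega_K is self-dual ([U'_self_dual]).
    By self-duality the integrand of the cup product of c_2 with the square of omega_K is
    the inner product of the Chern form with that square, and a computation with
    antisymmetric arrays ([kahler_square_pairing_mx]) gives, for 2-forms a and b killed
    by the contraction with omega_K, minus twice the bilinear inner product of a with b(K., K.).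

    Pointwise inequality.  Suppose that F is of type (1,1) for I and that its contraction
    with omega_I vanishes.  An L in U' is a multiple of I plus a part that anticommutes with
    I, and the latter is orthogonal to the forms of type (1,1); so F contracts to 0 with
    omega_L too ([U'_primitive]).  As F is skew-hermitian, the coefficient of
    tr(F /\ F) /\ omega_L^2 is, up to a positive constant, the inner product of F with
    F(L., L.).  The two forms have the same norm, and they agree for L = I; hence the
    coefficient for I minus the one for L is a positive multiple of |F - F(L., L.)|^2
    ([square_pairing_difference]).  It is nonnegative, and it vanishes exactly where F is of
    type (1,1) for L.

    Global argument.  As c_1(E) = 0, the form tr F is exact.  The integral of its
    contraction with omega_I is 0 by the divergence theorem on the torus, so the constant of
    the HYM condition for I is 0 ([Lambda_curvature_eq0]).  For the same reason
    tr F /\ tr F /\ omega_K^2, which is a divergence because mixed derivatives commute,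
    integrates to 0 ([exact_square_pairing_integral]).  What remains of the difference of the
    two cup products is a positive multiple of the integral of |F - F(L., L.)|^2
    ([c2_cup_kahler2_defect]).  This function is continuous and periodic, because curvature
    forms in different frames are conjugate ([curvature_conjugate]); so the
    integral is nonnegative, and it is 0 only if F is everywhere of type (1,1) for L. *)

(** * Integration over the unit cube *)

Section CubeIntegral.
Local Open Scope classical_set_scope.
Context {R : realType}.
Notation mu := (@lebesgue_measure R).

Lemma row_continuous_at (T : topologicalType) n (f : T -> 'rV[R]_n) (x : T) :
  (forall j, {for x, continuous (fun y => f y 0 j)}) -> {for x, continuous f}.
Proof.
move=> cf A [P Px PA]; rewrite /= nbhs_filterE.
have : \forall y \near x, forall j, P 0 j (f y 0 j).
  by apply: filter_forall => j; exact: (cf j (P 0 j) (Px 0 j)).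
by apply: filterS => y Py; apply: PA => i j; rewrite ord1.
Qed.

Lemma row_continuous (T : topologicalType) n (f : T -> 'rV[R]_n) :
  (forall j, continuous (fun y => f y 0 j)) -> continuous f.
Proof. by move=> cf x; apply: row_continuous_at => j; exact: cf. Qed.

Lemma continuous_at_cst (T : topologicalType) (a : R) (x : T) :
  {for x, continuous (fun=> a)}.
Proof. exact: cvg_cst. Qed.

Lemma continuous_atD (T : topologicalType) (f g : T -> R) (x : T) :
  {for x, continuous f} -> {for x, continuous g} ->
  {for x, continuous (fun y => f y + g y)}.
Proof. by move=> cf cg; apply: cvgD. Qed.

Lemma continuous_atM (T : topologicalType) (f g : T -> R) (x : T) :
  {for x, continuous f} -> {for x, continuous g} ->
  {for x, continuous (fun y => f y * g y)}.
Proof. by move=> cf cg; apply: cvgM. Qed.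

Lemma continuous_atN (T : topologicalType) (f : T -> R) (x : T) :
  {for x, continuous f} -> {for x, continuous (fun y => - f y)}.
Proof. by move=> cf; apply: cvgN. Qed.

Lemma continuous_at_sum (T : topologicalType) (I : Type) (r : seq I) (P : pred I)
    (F : I -> T -> R) (x : T) : (forall i, P i -> {for x, continuous (F i)}) ->
  {for x, continuous (fun y => \sum_(i <- r | P i) F i y)}.
Proof.
move=> cF; elim: r => [|i r IH].
  rewrite (_ : (fun _ => _) = cst 0); first exact: cst_continuous.
  by apply/funext => y; rewrite big_nil.
rewrite (_ : (fun _ => _) = fun y => (if P i then F i y else 0)
    + \sum_(i <- r | P i) F i y); last first.
  by apply/funext => y; rewrite big_cons; case: ifP => _; rewrite ?add0r.
apply: cvgD => //.
by case: ifP => [/cF//|_]; exact: cvg_cst.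
Qed.

Section OnRows.
Context {m : nat}.
Implicit Types (f g : 'rV[R]_m -> R) (x : 'rV[R]_m).

Lemma row_continuous_cst (a : R) x : {for x, continuous (fun _ : 'rV[R]_m => a)}.
Proof. exact: continuous_at_cst. Qed.

Lemma row_continuousD f g x : {for x, continuous f} -> {for x, continuous g} ->
  {for x, continuous (fun y => f y + g y)}.
Proof. exact: continuous_atD. Qed.

Lemma row_continuousM f g x : {for x, continuous f} -> {for x, continuous g} ->
  {for x, continuous (fun y => f y * g y)}.
Proof. exact: continuous_atM. Qed.

Lemma row_continuousN f x : {for x, continuous f} -> {for x, continuous (fun y => - f y)}.
Proof. exact: continuous_atN. Qed.

Lemma row_continuousB f g x : {for x, continuous f} -> {for x, continuous g} ->
  {for x, continuous (fun y => f y - g y)}.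
Proof. by move=> cf cg; apply: row_continuousD => //; exact: row_continuousN. Qed.

Lemma row_continuous_sum (I : Type) (r : seq I) (P : pred I) (F : I -> 'rV[R]_m -> R) x :
  (forall i, P i -> {for x, continuous (F i)}) ->
  {for x, continuous (fun y => \sum_(i <- r | P i) F i y)}.
Proof. exact: continuous_at_sum. Qed.

End OnRows.

Lemma continuous_mulmxr m n (B : 'M[R]_(m, n)) :
  continuous (fun t : 'rV[R]_m => t *m B).
Proof.
apply: row_continuous => j.
rewrite (_ : (fun _ => _) = fun t : 'rV[R]_m => \sum_k t 0 k * B k j); last first.
  by apply/funext => t; rewrite mxE.
move=> x; apply: continuous_at_sum => k _.
by apply: continuousM; [exact: coord_continuous|exact: cst_continuous].
Qed.

Lemma cvg_pair_nbhs (T : Type) (U V : topologicalType) (F : set_system T)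
    {FF : Filter F} (f : T -> U) (g : T -> V) (u : U) (v : V) :
  f @ F --> u -> g @ F --> v -> (f x, g x) @[x --> F] --> (u, v).
Proof. by move=> fu gv; exact: (@cvg_pair T U V F (nbhs u) (nbhs v)). Qed.

(** The identification of R x R^n with R^(1 + n) under which [cube_integral] is an iterated integral. *)
Definition cons_row n (p : R * 'rV[R]_n) : 'rV[R]_(1 + n) :=
  row_mx (p.1%:M : 'M[R]_1) p.2.

Lemma cons_row_continuous n : continuous (@cons_row n).
Proof.
apply: row_continuous => j; rewrite -(fintype.splitK j); case: (fintype.split j) => k /=.
  rewrite (_ : (fun _ => _) = fun y : R * 'rV[R]_n => y.1); last first.
    by apply/funext => y; rewrite /cons_row row_mxEl ord1 mxE.
  by move=> x; exact: cvg_fst.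
rewrite (_ : (fun _ => _) = fun y : R * 'rV[R]_n => y.2 0 k); last first.
  by apply/funext => y; rewrite /cons_row row_mxEr.
move=> x; apply: (@cvg_comp _ _ _ snd (fun M : 'rV[R]_n => M 0 k)).
  exact: cvg_snd.
exact: coord_continuous.
Qed.

Definition cube n : set 'rV[R]_n := [set v | forall i, `[0, 1] (v ord0 i)].
Arguments cube : clear implicits.

Lemma cube_compact n : compact (cube n).
Proof. exact: (@rV_compact R n (fun=> `[0, 1]) (fun=> @segment_compact _ _ _)). Qed.

(** By compactness of the cube, continuity at the points (t0, u) gives an estimate that is uniform in u. *)
Lemma near_uniform n (f : R * 'rV[R]_n -> R) (t0 e : R) : continuous f -> 0 < e ->
  \forall t \near t0, forall u, cube n u -> `|f (t0, u) - f (t, u)| < e.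
Proof.
move=> cf e0.
have /compact_near_coveringP cov := @cube_compact n.
suff H u : cube n u ->
    \forall p \near (u, t0), `|f (t0, p.1) - f (p.2, p.1)| < e.
  exact: (cov R (nbhs t0) (fun t u => `|f (t0, u) - f (t, u)| < e) _ H).
move=> _.
have e20 : 0 < e / 2 by rewrite divr_gt0.
have /cvgr_dist_lt/(_ _ e20) c1 := cf (t0, u).
have /cvgr_dist_lt/(_ _ e20) c2 : f (t0, v) @[v --> u] --> f (t0, u).
  apply: (@cvg_comp _ _ _ (fun v => (t0, v)) f (nbhs u) (nbhs (t0, u)) (nbhs (f (t0, u)))); last exact: cf.
  by apply: cvg_pair_nbhs; [exact: cvg_cst|exact: cvg_id].
have {}c1 : \forall p \near (u, t0), `|f (t0, u) - f (p.2, p.1)| < e / 2.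
  have : (fun p : 'rV[R]_n * R => (p.2, p.1)) @ (u, t0) --> (t0, u).
    by apply: cvg_pair_nbhs; [exact: cvg_snd|exact: cvg_fst].
  by move/(_ _ c1).
have {}c2 : \forall p \near (u, t0), `|f (t0, u) - f (t0, (p : 'rV[R]_n * R).1)| < e / 2.
  have h : fst @ (u, t0) --> u by exact: cvg_fst.
  exact: (h _ c2).
near=> p => /=.
rewrite [e]splitr (le_lt_trans (ler_distD (f (t0, u)) _ _))// ltrD//.
  by rewrite distrC; near: p.
by near: p.
Unshelve. all: by end_near. Qed.

Lemma integrable01 (f : R -> R) : continuous f -> mu.-integrable `[0, 1] (EFin \o f).
Proof.
move=> cf; apply: continuous_compact_integrable; first exact: segment_compact.
exact: continuous_subspaceT.
Qed.

(** A positive value of f at t bounds f from below by f t / 2 on a subinterval of positive length. *)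
Lemma Rintegral01_eq0 (f : R -> R) : continuous f ->
  (forall t, `[0, 1] t -> 0 <= f t) -> \int[mu]_(t in `[0, 1]) f t = 0 ->
  forall t, `[0, 1] t -> f t = 0.
Proof.
move=> cf f0 intf t t01; apply/eqP; rewrite eq_le f0// andbT leNgt; apply/negP => ft0.
have c0 : 0 < f t / 2 by rewrite divr_gt0.
have /cvgr_dist_lt/(_ _ c0)/nbhs_ballP[d /= d0 fd] := cf t.
move: (t01); rewrite /= in_itv /= => /andP[t0 t1].
(* to the right of t if t <= 1/2, to the left otherwise *)
have [a [b [ab a0 b1 abd]]] : exists a b, [/\ a < b, 0 <= a, b <= 1
    & forall x, `[a, b] x -> f t / 2 <= f x].
  have H x : `|t - x| < d -> f t / 2 <= f x.
    move=> /fd; rewrite ltr_norml => /andP[_]; lra.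
  have [t12|t12] := leP t (1/2).
    exists t, (t + Num.min (d / 2) (1/2)); split.
    - by rewrite ltrDl lt_min; apply/andP; split; lra.
    - by [].
    - have : Num.min (d / 2) (1/2) <= 1/2 by rewrite ge_min lexx orbT.
      lra.
    move=> x; rewrite /= in_itv /= => /andP[tx xt]; apply: H.
    have : Num.min (d / 2) (1/2) <= d/2 by rewrite ge_min lexx.
    rewrite ltr_norml; lra.
  exists (t - Num.min (d / 2) (1/2)), t; split.
  - by rewrite ltrBlDr ltrDl lt_min; apply/andP; split; lra.
  - have : Num.min (d / 2) (1/2) <= 1/2 by rewrite ge_min lexx orbT.
    lra.
  - by [].
  move=> x; rewrite /= in_itv /= => /andP[tx xt]; apply: H.
  have : Num.min (d / 2) (1/2) <= d/2 by rewrite ge_min lexx.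
  rewrite ltr_norml; lra.
have sub : `[a, b] `<=` `[0, 1].
  by move=> x /=; rewrite !in_itv /= => /andP[ax xb]; apply/andP; split; lra.
have intab : mu.-integrable `[a, b] (EFin \o f).
  by apply: integrableS (integrable01 cf).
have h1 : (\int[mu]_(x in `[a, b]) (f x)%:E <= \int[mu]_(x in `[0%R, 1%R]) (f x)%:E)%E.
  apply: ge0_subset_integral => //.
    by have /integrableP[] := integrable01 cf.
have h2 : \int[mu]_(x in `[a, b]) f x <= 0.
  rewrite -intf /Rintegral fine_le//.
  - by apply: integrable_fin_num.
  - by apply: integrable_fin_num => //; exact: integrable01.
have h3 : \int[mu]_(x in `[a, b]) (cst (f t / 2)) x <= \int[mu]_(x in `[a, b]) f x.
  apply: le_Rintegral => //.
  by apply: continuous_compact_integrable; [exact: segment_compact|exact: cst_continuous].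
have := le_trans h3 h2.
have muab : mu `[a, b] = (b - a)%:E.
  by rewrite lebesgue_measure_itv /= lte_fin ab.
rewrite Rintegral_cst//.
have -> : fine (mu `[a, b]) = b - a by exact: (congr1 fine muab).
by rewrite leNgt mulr_gt0// subr_gt0.
Qed.

End CubeIntegral.
Arguments cube {R} n _.

Section CubeIntegralProps.
Local Open Scope classical_set_scope.
Context {R : realType}.
Notation mu := (@lebesgue_measure R).

Lemma pair_continuous (U V : topologicalType) (t : U) :
  continuous (fun u : V => (t, u)).
Proof.
move=> u; apply: (@cvg_pair_nbhs _ _ _ (nbhs u)); last exact: cvg_id.
by apply: cvg_cst.
Qed.

Lemma cons_row_slice_continuous n (f : 'rV[R]_(1 + n) -> R) t : continuous f ->
  continuous (fun u => f (cons_row (t, u))).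
Proof.
move=> cf u; apply: continuous_comp; last exact: cf.
apply: (@continuous_comp _ _ _ (fun u => (t, u)) (@cons_row R n)).
  exact: pair_continuous.
exact: cons_row_continuous.
Qed.

Lemma cons_row_comp_continuous n (f : 'rV[R]_(1 + n) -> R) : continuous f ->
  continuous (fun p => f (cons_row p)).
Proof.
by move=> cf p; apply: continuous_comp; [exact: cons_row_continuous|exact: cf].
Qed.

Lemma cube_integralS n (f : 'rV[R]_(1 + n) -> R) :
  cube_integral f = \int[mu]_(t in `[0, 1])
    cube_integral (fun u => f (cons_row (t, u))).
Proof. by []. Qed.

Lemma cube_cons n (t : R) (u : 'rV[R]_n) :
  cube (1 + n) (cons_row (t, u)) <-> `[0, 1] t /\ cube n u.
Proof.
split=> [c|[ht hu] i].
  split=> [|j]; first by have := c (lshift n 0); rewrite /cons_row row_mxEl !mxE.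
  by have := c (rshift 1 j); rewrite /cons_row row_mxEr.
rewrite -(fintype.splitK i); case: (fintype.split i) => j /=.
  by rewrite /cons_row row_mxEl mxE (ord1 j) mulr1n.
by rewrite /cons_row row_mxEr; exact: hu.
Qed.

Lemma cons_rowK n (v : 'rV[R]_(1 + n)) :
  cons_row (lsubmx v 0 0, rsubmx v) = v.
Proof. by rewrite /cons_row -mx11_scalar hsubmxK. Qed.

(** These three properties have to be proved together, by induction on the dimension: the outer
    integral is additive only because the inner one depends continuously on the outer
    variable, and that follows from them through [cube_integral_dist]. *)
Definition cube_positive_linear n :=
  [/\ forall (a : R) (f g : 'rV[R]_n -> R), continuous f -> continuous g ->
        cube_integral (fun u => a * f u + g u)
        = a * cube_integral f + cube_integral g,
      forall f : 'rV[R]_n -> R, continuous f -> (forall u, cube n u -> 0 <= f u) ->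
        0 <= cube_integral f
    & cube_integral (fun _ : 'rV[R]_n => 1 : R) = 1].

Section Consequences.
Variables (n : nat).
Hypothesis lin : cube_positive_linear n.
Let linP a (f g : 'rV[R]_n -> R) (cf : continuous f) (cg : continuous g) :
  cube_integral (fun u => a * f u + g u) = a * cube_integral f + cube_integral g.
Proof. by case: lin => + _ _; apply. Qed.

Lemma cube_integral_dist (f g : 'rV[R]_n -> R) (e : R) :
  continuous f -> continuous g ->
  (forall u, cube n u -> `|f u - g u| <= e) ->
  `|cube_integral f - cube_integral g| <= e.
Proof.
move=> cf cg fge.
case: lin => _ pos one.
have aux (h k : 'rV[R]_n -> R) : continuous h -> continuous k ->
    (forall u, cube n u -> `|h u - k u| <= e) ->
    cube_integral h - cube_integral k <= e.
  move=> ch ck hke.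
  have c1 : continuous (fun _ : 'rV[R]_n => 1 : R) by exact: cst_continuous.
  have c2 : continuous (fun u : 'rV[R]_n => -1 * h u + k u).
    move=> u; apply: row_continuousD; last exact: ck.
    by apply: row_continuousM; [exact: row_continuous_cst|exact: ch].
  have c3 : continuous (fun u : 'rV[R]_n => e * 1 + (-1 * h u + k u)).
    by move=> u; apply: row_continuousD; [exact: row_continuous_cst|exact: c2].
  have : 0 <= cube_integral (fun u => e * 1 + (-1 * h u + k u)).
    apply: pos => // u /hke; rewrite ler_norml; lra.
  by rewrite (linP e c1 c2) one (linP _ ch ck); lra.
rewrite ler_norml; apply/andP; split; last exact: aux.
rewrite lerNl opprB; apply: aux => // u cu; rewrite distrC; exact: fge.
Qed.

(** The integral is 1-Lipschitz for the sup norm on the cube. *)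
Lemma cube_integral_param (f : R * 'rV[R]_n -> R) : continuous f ->
  continuous (fun t => cube_integral (fun u => f (t, u))).
Proof.
move=> cf t0; apply/cvgrPdist_le => e e0.
have ct t : continuous (fun u => f (t, u)).
  move=> u; apply: (@continuous_comp _ _ _ (fun u => (t, u)) f); last exact: cf.
  exact: pair_continuous.
have : \forall t \near t0, forall u, cube n u -> `|f (t0, u) - f (t, u)| < e.
  exact: near_uniform.
by apply: filterS => t ft; apply: cube_integral_dist => // u /ft /ltW.
Qed.

End Consequences.

Lemma cube_positive_linearP n : cube_positive_linear n.
Proof.
elim: n => [|n IH].
  split=> //= f _; apply => i; by case: i.
have [lin pos one] := IH.
have ci (f : 'rV[R]_(1 + n) -> R) : continuous f ->
    continuous (fun t => cube_integral (fun u => f (cons_row (t, u)))).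
  move=> cf; apply: (cube_integral_param IH (f := fun p => f (cons_row p))).
  exact: cons_row_comp_continuous.
split=> [a f g cf cg|f cf f0|].
- rewrite !cube_integralS.
  rewrite -RintegralZl//; last exact: integrable01 (ci _ cf).
  rewrite -RintegralD//; first last.
  + exact: integrable01 (ci _ cg).
  + apply: integrable01 => t; apply: continuous_atM; first exact: continuous_at_cst.
    exact: ci.
  apply: eq_Rintegral => t _.
  by rewrite (lin a)//; exact: cons_row_slice_continuous.
- rewrite cube_integralS; apply: Rintegral_ge0 => t t01.
  apply: pos => [|u cu]; first exact: cons_row_slice_continuous.
  by apply: f0; apply/cube_cons.
- rewrite cube_integralS; under eq_Rintegral do rewrite one.
  rewrite Rintegral_cst//.
  have m1 : mu `[0, 1] = 1%:E.
    by rewrite lebesgue_measure_itv /= lte_fin ltr01 -EFinB subr0.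
  have -> : fine (mu `[0, 1]) = 1 by exact: (congr1 fine m1).
  by rewrite mulr1.
Qed.

Lemma cube_integral_linear n (a : R) (f g : 'rV[R]_n -> R) :
  continuous f -> continuous g ->
  cube_integral (fun u => a * f u + g u) = a * cube_integral f + cube_integral g.
Proof. by have [+ _ _] := cube_positive_linearP n; apply. Qed.

Lemma cube_integral_ge0 n (f : 'rV[R]_n -> R) : continuous f ->
  (forall u, cube n u -> 0 <= f u) -> 0 <= cube_integral f.
Proof. by have [_ + _] := cube_positive_linearP n; apply. Qed.

Lemma cube_integral_cst n (a : R) : cube_integral (fun _ : 'rV[R]_n => a) = a.
Proof.
have [_ _ one] := cube_positive_linearP n.
have c (b : R) : continuous (fun _ : 'rV[R]_n => b) by exact: cst_continuous.
have := cube_integral_linear a (c 1) (c 0).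
have := cube_integral_linear 1 (c 0) (c 0).
rewrite (_ : (fun _ => 1 * 0 + 0) = fun=> 0); last first.
  by apply/funext => ?; rewrite mulr0 addr0.
rewrite (_ : (fun _ => a * 1 + 0) = fun=> a); last first.
  by apply/funext => ?; rewrite mulr1 addr0.
rewrite one; lra.
Qed.

Lemma cube_integral_slice_continuous n (f : 'rV[R]_(1 + n) -> R) : continuous f ->
  continuous (fun t => cube_integral (fun u => f (cons_row (t, u)))).
Proof.
move=> cf.
apply: (cube_integral_param (@cube_positive_linearP n) (f := fun p => f (cons_row p))).
exact: cons_row_comp_continuous.
Qed.

Lemma cube_integral_eq0 n (f : 'rV[R]_n -> R) : continuous f ->
  (forall u, cube n u -> 0 <= f u) -> cube_integral f = 0 ->
  forall u, cube n u -> f u = 0.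
Proof.
elim: n f => [|n IH] f cf f0.
  by move=> /= f00 u _; rewrite -[RHS]f00; congr f; apply/rowP => -[].
rewrite cube_integralS => int0 v cv.
move: (cv); rewrite -[v]cons_rowK => /cube_cons[t01 cu].
apply: (IH (fun u => f (cons_row (_, u)))) => //.
- exact: cons_row_slice_continuous.
- by move=> u hu; apply: f0; apply/cube_cons.
apply: (Rintegral01_eq0 (cube_integral_slice_continuous cf)) => // t ht.
apply: cube_integral_ge0; first exact: cons_row_slice_continuous.
by move=> u hu; apply: f0; apply/cube_cons.
Qed.

End CubeIntegralProps.

(** * Mean values and mixed derivatives *)

Section Calculus.
Local Open Scope classical_set_scope.
Context {R : realType}.
Notation mu := (@lebesgue_measure R).

(** The hypothesis is on a symmetric interval, and s and t are in no particular order: this is the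
    form in which difference quotients at h of either sign use it. *)
Lemma mean_value (f df : R -> R) (s t : R) :
  (forall x, `|x - s| <= `|t - s| -> is_derive x 1 f (df x)) ->
  exists2 c, `|c - s| <= `|t - s| & f t - f s = df c * (t - s).
Proof.
move=> fd.
have cf x : `|x - s| <= `|t - s| -> {for x, continuous f}.
  by move=> /fd xd; apply: differentiable_continuous; apply/derivable1_diffP.
have [st|ts] := leP s t.
  have Nst : `|t - s| = t - s by rewrite ger0_norm ?subr_ge0.
  rewrite Nst in fd cf *.
  have [||c] := @MVT_segment _ f df s t st.
  - by move=> x; rewrite in_itv/= => /andP[sx xt]; apply: fd; rewrite ler_norml; lra.
  - apply: continuous_in_subspaceT => x; rewrite inE/= in_itv/= => /andP[sx xt].
    by apply: cf; rewrite ler_norml; lra.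
  by rewrite in_itv/= => /andP[sc ct] h; exists c => //; rewrite ler_norml; lra.
have Nst : `|t - s| = s - t by rewrite distrC gtr0_norm ?subr_gt0.
rewrite Nst in fd cf *.
have [||c] := @MVT_segment _ f df t s (ltW ts).
- by move=> x; rewrite in_itv/= => /andP[sx xt]; apply: fd; rewrite ler_norml; lra.
- apply: continuous_in_subspaceT => x; rewrite inE/= in_itv/= => /andP[sx xt].
  by apply: cf; rewrite ler_norml; lra.
rewrite in_itv/= => /andP[sc ct] h; exists c; first by rewrite ler_norml; lra.
by rewrite -(opprB s t) mulrN -h opprB.
Qed.

Lemma Rintegral_derivative (G g : R -> R) : continuous g ->
  (forall t : R, is_derive t (1 : R) G (g t)) ->
  \int[mu]_(t in `[0, 1]) g t = G 1 - G 0.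
Proof.
move=> cg dG.
have cG : continuous G.
  move=> t; apply: differentiable_continuous; apply/derivable1_diffP.
  by have := dG t; case.
rewrite /Rintegral (@continuous_FTC2 _ g G)//.
- exact: continuous_subspaceT.
- split.
  + by move=> x _; have := dG x; case.
  + by apply: cvg_at_right_filter; exact: cG.
  + by apply: cvg_at_left_filter; exact: cG.
- by move=> x _; rewrite derive1E; have := dG x; case.
Qed.

Lemma cvgD_real (F : set_system R) {FF : Filter F} (f g : R -> R) (a b : R) :
  f @ F --> a -> g @ F --> b -> (fun h => f h + g h) @ F --> a + b.
Proof. exact: cvgD. Qed.

Section Lines.
Context {V : normedModType R}.
Implicit Types (f : V -> R) (x v w : V).

Lemma is_derive_line f x v (a : R) : derivable f (x + a *: v) v ->
  is_derive a (1 : R) (fun t => f (x + t *: v)) ('D_v f (x + a *: v)).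
Proof.
have E : (fun h : R => h^-1 *: (f (x + (h *: 1 + a) *: v) - f (x + a *: v)))
       = (fun h : R => h^-1 *: (f (h *: v + (x + a *: v)) - f (x + a *: v))).
  apply/funext => h; congr (_ *: (f _ - _)).
  by rewrite [h *: (1 : R)]mulr1 scalerDl addrCA.
by move=> d; split; rewrite /derivable /derive /= E.
Qed.

Lemma is_derive_line0 f x v (df : R) :
  is_derive (0 : R) (1 : R) (fun t : R => f (x + t *: v)) df -> is_derive x v f df.
Proof.
have E : (fun h : R => h^-1 *: (f (x + (h *: (1 : R) + (0 : R)) *: v) - f (x + (0 : R) *: v)))
       = (fun h : R => h^-1 *: (f (h *: v + x) - f x)).
  apply/funext => h; congr (_ *: (f _ - f _)); last by rewrite scale0r addr0.
  by rewrite [h *: (1 : R)]mulr1 addr0 addrC.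
by case; rewrite /derivable /derive /= E => h1 h2; split.
Qed.

Lemma is_derive_scaled_direction f x v (a : R) : derivable f x v ->
  is_derive x (a *: v) f (a * 'D_v f x).
Proof.
move=> d; apply: is_derive_line0.
rewrite (_ : (fun t => _) = (fun t => f (x + t *: v)) \o ( *%R a)); last first.
  by apply/funext => t /=; rewrite scalerA mulrC.
have d0 : is_derive (a * 0) (1 : R) (fun t => f (x + t *: v)) ('D_v f x).
  have := @is_derive_line f x v 0; rewrite scale0r addr0 mulr0 => /(_ d) //.
rewrite mulrC; apply: is_derive1_comp.
by have := is_deriveZ a (is_derive_id (0 : R) (1 : R)); rewrite [a *: _]mulr1.
Qed.

(** The increment along v + w is an increment along v from x, followed by an increment along w from a
    nearby point; the latter is a mean value of 'D_w f, which is continuous at x. *)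
Lemma is_derive_sum_direction f x v w : derivable f x v ->
  (forall y, derivable f y w) -> {for x, continuous (fun y => 'D_w f y)} ->
  is_derive x (v + w) f ('D_v f x + 'D_w f x).
Proof.
move=> dv dw cw.
(* the limit of the difference quotients gives both the derivability and the value *)
suff H : h^-1 *: (f (h *: (v + w) + x) - f x) @[h --> 0^'] --> 'D_v f x + 'D_w f x.
  by split; [apply/cvg_ex; eexists; exact: H|exact/cvg_lim].
have E : (fun h : R => h^-1 *: (f (h *: (v + w) + x) - f x)) =
   (fun h : R => h^-1 *: (f (h *: v + x) - f x) +
                 h^-1 *: (f (h *: v + x + h *: w) - f (h *: v + x))).
  apply/funext => h; rewrite -scalerDr; congr (_ *: _).
  by rewrite scalerDr addrAC; ring.
rewrite E; apply: cvgD_real; first exact: dv.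
apply/cvgrPdist_lt => e e0.
have /cvgr_dist_lt/(_ _ e0)/nbhs_ballP[d /= d0 fd] := cw.
have N0 : 0 < `|v| + `|w| + 1 by rewrite ltr_wpDl// addr_ge0.
(* for this bound on h, the point x + h v + c w is at distance less than d from x *)
exists (d / (`|v| + `|w| + 1)) => /=; first by rewrite divr_gt0.
move=> h /=; rewrite sub0r normrN => hd h0.
have [|c] := @mean_value (fun t => f (h *: v + x + t *: w))
   (fun t => 'D_w f (h *: v + x + t *: w)) 0 h.
  by move=> t _; exact: (@is_derive_line f (h *: v + x) w t (dw _)).
rewrite !subr0 scale0r addr0 => chd ->.
rewrite [_ *: _]mulrC mulfK//; apply: fd.
rewrite -ball_normE /= (_ : x - _ = - (h *: v + c *: w)); last first.
  by rewrite [h *: v + x]addrC -addrA opprD addrA subrr add0r.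
rewrite normrN (le_lt_trans (ler_normD _ _))// !normrZ.
move: hd; rewrite ltr_pdivlMr// => hd.
have := ler_wpM2r (normr_ge0 w) chd.
have := normr_ge0 h.
rewrite !mulrDr in hd; lra.
Qed.

(** Two mean values, first along v and then along w, for the second difference of f. *)
Lemma mixed_derivative_mean f x v w (s : R) (U : set V) :
  (forall a b : R, `|a| <= `|s| -> `|b| <= `|s| -> U (x + a *: v + b *: w)) ->
  (forall y, U y -> derivable f y v) ->
  (forall y, U y -> derivable ('D_v f) y w) ->
  exists a b, [/\ `|a| <= `|s|, `|b| <= `|s| &
    f (x + s *: v + s *: w) - f (x + s *: v) - f (x + s *: w) + f x =
    'D_w ('D_v f) (x + a *: v + b *: w) * s ^+ 2].
Proof.
move=> Us dv dvw.
(* the second difference is phi s - phi 0 *)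
pose phi (t : R) := f (x + s *: w + t *: v) - f (x + t *: v).
have [|a] := @mean_value phi
    (fun t => 'D_v f (x + s *: w + t *: v) - 'D_v f (x + t *: v)) 0 s.
  move=> t; rewrite !subr0 => ts; apply: is_deriveB.
    apply: is_derive_line; apply: dv.
    by rewrite addrAC; apply: Us.
  apply: is_derive_line; apply: dv.
  by rewrite -[_ + _]addr0 -(scale0r w); apply: Us; rewrite ?normr0.
rewrite !subr0 => sa phiE.
have [|b] := @mean_value (fun t => 'D_v f (x + a *: v + t *: w))
    (fun t => 'D_w ('D_v f) (x + a *: v + t *: w)) 0 s.
  move=> t; rewrite !subr0 => ts.
  by apply: (@is_derive_line ('D_v f)); apply: dvw; apply: Us.
rewrite !subr0 scale0r addr0 => sb psiE; exists a, b; split => //.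
rewrite expr2 mulrA -psiE -[in 'D_v f (x + a *: v + s *: w)]addrA.
rewrite [a *: v + _]addrC addrA -phiE /phi scale0r !addr0.
rewrite -[x + s *: w + s *: v]addrA [s *: w + _]addrC addrA; ring.
Qed.

Let quotient_unique (p q r t A B s : R) : s != 0 ->
  p - q - r + t = A * s ^+ 2 -> p - r - q + t = B * s ^+ 2 -> A = B.
Proof.
move=> s0 E1 E2; apply: (mulIf (_ : s ^+ 2 != 0)); first by rewrite expf_neq0.
by rewrite -E1 -E2; ring.
Qed.

Let close_trans (A B C e : R) : `|A - C| < e / 2 -> `|B - C| < e / 2 -> `|A - B| <= e.
Proof. rewrite !ltr_norml ler_norml; lra. Qed.

(** The second difference of [mixed_derivative_mean] is symmetric in v and w, so each mixed
    derivative takes the same value at some point that is arbitrarily close to x. *)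
Lemma mixed_derivatives_commute f x v w (U : set V) : open U -> U x ->
  (forall y, U y -> derivable f y v) -> (forall y, U y -> derivable f y w) ->
  (forall y, U y -> derivable ('D_v f) y w) ->
  (forall y, U y -> derivable ('D_w f) y v) ->
  {for x, continuous ('D_w ('D_v f))} -> {for x, continuous ('D_v ('D_w f))} ->
  'D_w ('D_v f) x = 'D_v ('D_w f) x.
Proof.
move=> oU Ux dv dw dvw dwv cvw cwv.
apply/eqP; rewrite -subr_eq0 -normr_le0; apply/ler_addgt0Pl => e e0; rewrite addr0.
have e20 : 0 < e / 2 by rewrite divr_gt0.
have /nbhs_ballP[d0 /= d00 Ud] := open_nbhs_nbhs (conj oU Ux).
have /cvgr_dist_lt/(_ _ e20)/nbhs_ballP[d1 /= d10 fd1] := cvw.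
have /cvgr_dist_lt/(_ _ e20)/nbhs_ballP[d2 /= d20 fd2] := cwv.
have N0 : 0 < `|v| + `|w| + 1 by rewrite ltr_wpDl// addr_ge0.
pose d := Num.min d0 (Num.min d1 d2).
have dd : 0 < d by rewrite !lt_min d00 d10 d20.
(* so small that all the points x + a v + b w, for |a|, |b| <= s, are at distance less than d from x *)
pose s := d / (`|v| + `|w| + 1) / 2.
have s0 : 0 < s by rewrite !divr_gt0.
have near a b : `|a| <= `|s| -> `|b| <= `|s| -> `|x - (x + a *: v + b *: w)| < d.
  move=> ha hb; rewrite -addrA opprD addrA subrr add0r normrN.
  rewrite (le_lt_trans (ler_normD _ _))// !normrZ.
  have := ler_wpM2r (normr_ge0 w) hb; have := ler_wpM2r (normr_ge0 v) ha.
  rewrite (gtr0_norm s0).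
  have : s * (`|v| + `|w| + 1) = d / 2.
    by rewrite /s mulrAC divfK// gt_eqF.
  rewrite !mulrDr; lra.
have dd0 : d <= d0 by rewrite /d ge_min lexx.
have dd1 : d <= d1 by rewrite /d !ge_min lexx !orbT.
have dd2 : d <= d2 by rewrite /d !ge_min lexx !orbT.
have Us a b : `|a| <= `|s| -> `|b| <= `|s| -> U (x + a *: v + b *: w).
  move=> ha hb; apply: Ud; rewrite -ball_normE /=.
  exact: lt_le_trans (near _ _ ha hb) _.
have Us' a b : `|a| <= `|s| -> `|b| <= `|s| -> U (x + a *: w + b *: v).
  by move=> ha hb; rewrite addrAC; exact: Us.
have [a [b [ha hb E1]]] := mixed_derivative_mean Us dv dvw.
have [b' [a' [hb' ha' E2]]] := mixed_derivative_mean Us' dw dwv.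
have : 'D_w ('D_v f) (x + a *: v + b *: w) = 'D_v ('D_w f) (x + b' *: w + a' *: v).
  move: E2; rewrite [x + s *: w + s *: v]addrAC => E2.
  exact: (quotient_unique (lt0r_neq0 s0) E1 E2).
have h1 : `|'D_w ('D_v f) x - 'D_w ('D_v f) (x + a *: v + b *: w)| < e / 2.
  by apply: fd1; rewrite -ball_normE; exact: lt_le_trans (near _ _ ha hb) dd1.
have h2 : `|'D_v ('D_w f) x - 'D_v ('D_w f) (x + b' *: w + a' *: v)| < e / 2.
  apply: fd2; rewrite -ball_normE /= addrAC.
  exact: lt_le_trans (near _ _ ha' hb') dd2.
by move=> E; move: h2; rewrite -E; exact: close_trans.
Qed.
End Lines.
End Calculus.

(** * Derivatives under the integral over the cube *)

Section TorusIntegral.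
Local Open Scope classical_set_scope.
Context {R : realType}.
Notation mu := (@lebesgue_measure R).

(** The coordinates of v are added one at a time with [is_derive_sum_direction]. *)
Lemma is_derive_rows m (f : 'rV[R]_m -> R) (x v : 'rV[R]_m) :
  (forall j y, derivable f y (delta_mx 0 j)) ->
  (forall j, continuous (fun y => 'D_(delta_mx 0 j) f y)) ->
  is_derive x v f (\sum_j v 0 j * 'D_(delta_mx 0 j) f x).
Proof.
move=> df cdf.
rewrite [in X in is_derive _ X _ _](row_sum_delta v).
elim: (index_enum 'I_m) => [|j r IH].
  by rewrite !big_nil; exact: is_derive0.
rewrite !big_cons addrC [X in is_derive _ _ _ X]addrC.
have dj y : is_derive y (v 0 j *: delta_mx 0 j) f (v 0 j * 'D_(delta_mx 0 j) f y).
  exact: is_derive_scaled_direction.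
have [d0 E0] := IH.
have dw y : derivable f y (v 0 j *: delta_mx 0 j) by have [] := dj y.
have Ew y : 'D_(v 0 j *: delta_mx 0 j) f y = v 0 j * 'D_(delta_mx 0 j) f y.
  by have [] := dj y.
have cw : {for x, continuous (fun y => 'D_(v 0 j *: delta_mx 0 j) f y)}.
  rewrite (_ : (fun y => _) = fun y => v 0 j * 'D_(delta_mx 0 j) f y).
    by apply: row_continuousM; [exact: row_continuous_cst|exact: cdf].
  by apply/funext => y; exact: Ew.
by have := is_derive_sum_direction d0 dw cw; rewrite E0 Ew.
Qed.

(** By the mean value theorem the difference quotients of f in t are values of g at nearby points,
    hence uniformly close to g (t, u) for u in the cube. *)
Lemma is_derive_cube_integral n (f g : R * 'rV[R]_n -> R) (t : R) :
  continuous f -> continuous g ->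
  (forall (s : R) u, is_derive s (1 : R) (fun s' => f (s', u)) (g (s, u))) ->
  is_derive t (1 : R) (fun s => cube_integral (fun u => f (s, u)))
    (cube_integral (fun u => g (t, u))).
Proof.
move=> cf cg dfg.
have sl (h : R * 'rV[R]_n -> R) s : continuous h -> continuous (fun u => h (s, u)).
  move=> ch u; apply: (@continuous_comp _ _ _ (fun u => (s, u)) h); last exact: ch.
  exact: pair_continuous.
suff H : h^-1 *: (cube_integral (fun u => f (h *: (1 : R) + t, u))
     - cube_integral (fun u => f (t, u))) @[h --> 0^'] --> cube_integral (fun u => g (t, u)).
  by split; [apply/cvg_ex; eexists; exact: H|exact/cvg_lim].
apply/cvgrPdist_le => e e0.
have /nbhs_ballP[d /= d0 nu] := near_uniform t cg e0.
exists d => //= h /=; rewrite sub0r normrN => hd h0.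
rewrite [h *: 1]mulr1.
have -> : h^-1 *: (cube_integral (fun u => f (h + t, u)) - cube_integral (fun u => f (t, u)))
   = cube_integral (fun u => h^-1 * f (h + t, u) + (- h^-1 * f (t, u) + 0)).
  rewrite (cube_integral_linear h^-1 (g := fun u => - h^-1 * f (t, u) + 0)).
  - rewrite (cube_integral_linear (- h^-1) (g := fun=> 0)) ?cube_integral_cst.
    + by rewrite /GRing.scale /=; ring.
    + exact: sl.
    + exact: row_continuous_cst.
  - exact: sl.
  - move=> u; apply: row_continuousD; last exact: row_continuous_cst.
    by apply: row_continuousM; [exact: row_continuous_cst|exact: sl].
apply: cube_integral_dist.
- exact: cube_positive_linearP.
- exact: sl.
- move=> u; apply: row_continuousD; first by apply: row_continuousM; [exact: row_continuous_cst|exact: sl].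
  apply: row_continuousD; last exact: row_continuous_cst.
  by apply: row_continuousM; [exact: row_continuous_cst|exact: sl].
move=> u cu.
have [c] := @mean_value _ (fun s => f (s, u)) (fun s => g (s, u)) t (h + t)
  (fun s _ => dfg s u).
rewrite addrK => chd fE.
have -> : h^-1 * f (h + t, u) + (- h^-1 * f (t, u) + 0) = g (c, u).
  by rewrite addr0 mulNr -mulrBr fE mulrC mulfK.
apply/ltW/nu => //; rewrite -ball_normE /= distrC; exact: le_lt_trans hd.
Qed.

Lemma cons_row_line n (t : R) (u : 'rV[R]_n) :
  cons_row (t, u) = cons_row (0, u) + t *: delta_mx 0 (lshift n 0).
Proof.
apply/rowP => i; rewrite -(fintype.splitK i); case: (fintype.split i) => j /=.
  by rewrite /cons_row [RHS]mxE !row_mxEl !mxE (ord1 j) /= !mulr1n mulr1 add0r.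
rewrite /cons_row [RHS]mxE !row_mxEr !mxE (_ : rshift 1 j == lshift n 0 = false).
  by rewrite andbF mulr0 addr0.
by apply/negbTE; rewrite -val_eqE.
Qed.

Lemma cons_row_delta n (t : R) (u : 'rV[R]_n) (a : R) k :
  cons_row (t, u + a *: delta_mx 0 k) = cons_row (t, u) + a *: delta_mx 0 (rshift 1 k).
Proof.
apply/rowP => i; rewrite -(fintype.splitK i); case: (fintype.split i) => j /=.
  rewrite /cons_row [RHS]mxE !row_mxEl !mxE (_ : lshift n j == rshift 1 k = false).
    by rewrite andbF mulr0 addr0.
  by apply/negbTE; rewrite -val_eqE /= (ord1 j).
rewrite /cons_row [RHS]mxE !row_mxEr !mxE; congr (_ + _ * (_ && _)%:R).
Qed.

(** In the outermost variable this is the fundamental theorem of calculus, after the derivative is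
    moved out of the inner integral; in the other variables the inner integral already vanishes. *)
Lemma cube_integral_derivative_periodic n (f : 'rV[R]_n -> R) (k : 'I_n) :
  continuous f -> (forall x, derivable f x (delta_mx 0 k)) ->
  continuous (fun x => 'D_(delta_mx 0 k) f x) ->
  (forall x, f (x + delta_mx 0 k) = f x) ->
  cube_integral (fun x => 'D_(delta_mx 0 k) f x) = 0.
Proof.
elim: n f k => [f [] //|n IH]; rewrite -[n.+1]/(1 + n)%N => f k cf df cdf pf.
rewrite cube_integralS.
have [k0|[k' kE]] : k = lshift n 0 \/ exists k', k = rshift 1 k'.
  rewrite -(fintype.splitK k); case: (fintype.split k) => j /=; last by right; exists j.
  by left; rewrite (ord1 j).
  apply: etrans (Rintegral_derivative
    (G := fun t => cube_integral (fun u => f (cons_row (t, u))))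
    (g := fun t => cube_integral (fun u => 'D_(delta_mx 0 k) f (cons_row (t, u)))) _ _) _.
  - exact: (cube_integral_slice_continuous (f := fun x => 'D_(delta_mx 0 k) f x)).
  - move=> t; apply: (@is_derive_cube_integral n (f \o @cons_row R n)
      ((fun x => 'D_(delta_mx 0 k) f x) \o @cons_row R n)).
    + exact: cons_row_comp_continuous.
    + exact: cons_row_comp_continuous.
    + move=> s u /=.
      rewrite (_ : (fun s' => _) = fun s' => f (cons_row (0, u) + s' *: delta_mx 0 k)).
        by rewrite cons_row_line -k0; exact: is_derive_line.
      by apply/funext => s'; rewrite cons_row_line -k0.
  - apply/eqP; rewrite subr_eq0; apply/eqP; congr cube_integral; apply/funext => u.
    by rewrite cons_row_line scale1r -k0 pf.
rewrite (_ : (fun t => _) = cst 0); first by rewrite Rintegral_cst// mul0r.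
apply/funext => t /=.
have E u : is_derive u (delta_mx 0 k') (fun u => f (cons_row (t, u)))
    ('D_(delta_mx 0 k) f (cons_row (t, u))).
  apply: is_derive_line0.
  rewrite (_ : (fun s' => _) = fun s' => f (cons_row (t, u) + s' *: delta_mx 0 k)).
    have := @is_derive_line _ _ f (cons_row (t, u)) (delta_mx 0 k) 0.
    by rewrite scale0r addr0; apply.
  by apply/funext => s'; rewrite cons_row_delta kE.
rewrite (_ : (fun u => _) = 'D_(delta_mx 0 k') (fun u => f (cons_row (t, u)))); last first.
  by apply/funext => u; have [] := E u.
apply: IH.
- exact: cons_row_slice_continuous.
- by move=> u; have [] := E u.
- rewrite (_ : (fun u => _) = fun u => 'D_(delta_mx 0 k) f (cons_row (t, u))).
    exact: (cons_row_slice_continuous (f := fun x => 'D_(delta_mx 0 k) f x)).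
  by apply/funext => u; have [] := E u.
- by move=> u; rewrite -[delta_mx 0 k']scale1r cons_row_delta scale1r -kE pf.
Qed.

End TorusIntegral.

(** * Integration over the torus *)

Section Torus.
Local Open Scope classical_set_scope.
Context {R : realType} (B : 'M[R]_8) (B_unit : B \in unitmx).
Implicit Types (f g : 'rV[R]_8 -> R).

Lemma mulmxr_comp_continuous f : continuous f -> continuous (fun t : 'rV[R]_8 => f (t *m B)).
Proof. by move=> cf t; apply: continuous_comp; [exact: continuous_mulmxr|exact: cf]. Qed.

Lemma torus_integral_linear (a : R) f g : continuous f -> continuous g ->
  torus_integral B (fun x => a * f x + g x)
  = a * torus_integral B f + torus_integral B g.
Proof.
move=> cf cg; rewrite /torus_integral.
rewrite (cube_integral_linear a (f := fun t => f (t *m B)) (g := fun t => g (t *m B))).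
- by rewrite mulrDr mulrCA.
- exact: mulmxr_comp_continuous.
- exact: mulmxr_comp_continuous.
Qed.

Lemma torus_integral_cst (a : R) : torus_integral B (fun=> a) = `|\det B| * a.
Proof. by rewrite /torus_integral cube_integral_cst. Qed.

Lemma det_gt0 : 0 < `|\det B|.
Proof. by rewrite normr_gt0; move: B_unit; rewrite unitmxE unitfE. Qed.

Lemma torus_integral_ge0 f : continuous f -> (forall x, 0 <= f x) ->
  0 <= torus_integral B f.
Proof.
move=> cf f0; apply: mulr_ge0 => //; apply: cube_integral_ge0 => //.
exact: mulmxr_comp_continuous.
Qed.

Lemma fundamental_domain (x : 'rV[R]_8) :
  exists2 t, cube 8 t & exists2 l, lattice B l & x = t *m B + l.
Proof.
pose y := x *m invmx B.
exists (\row_j (y 0 j - (Num.floor (y 0 j))%:~R)).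
  move=> j /=; rewrite mxE in_itv /= subr_ge0 lerBlDr.
  by rewrite ge_floor addrC -intrD1 ltW// floorD1_gt.
exists (map_mx (fun z : int => z%:~R : R) (\row_j Num.floor (y 0 j)) *m B).
  by exists (\row_j Num.floor (y 0 j)).
rewrite -mulmxDl (_ : _ + _ = y) ?mulmxKV//.
by apply/rowP => j; rewrite !mxE subrK.
Qed.

(** Periodicity carries the vanishing on the fundamental parallelepiped to the whole space. *)
Lemma torus_integral_eq0 f : continuous f -> (forall x, 0 <= f x) ->
  periodic_on B setT f -> torus_integral B f = 0 -> forall x, f x = 0.
Proof.
move=> cf f0 pf /eqP; rewrite mulf_eq0 gt_eqF ?det_gt0//= => /eqP int0 x.
have [t ct [l Bl ->]] := fundamental_domain x; rewrite pf//.
apply: (cube_integral_eq0 (f := fun t => f (t *m B)) _ _ int0 ct) => //.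
exact: mulmxr_comp_continuous.
Qed.

Lemma is_derive_mulmxr f (t : 'rV[R]_8) v (df : R) :
  is_derive (t *m B) (v *m B) f df -> is_derive t v (fun t => f (t *m B)) df.
Proof.
have E : (fun h : R => h^-1 *: (f ((h *: v + t) *m B) - f (t *m B)))
       = (fun h : R => h^-1 *: (f (h *: (v *m B) + t *m B) - f (t *m B))).
  by apply/funext => h; rewrite mulmxDl scalemxAl.
by case; rewrite /derivable /derive /= -E => h1 h2; split.
Qed.

(** The derivative along a coordinate is a combination of derivatives along the basis of the lattice,
    and in the coordinates of that basis the function has period 1 in each variable. *)
Lemma torus_integral_partial f (i : 'I_8) : continuous f ->
  (forall j x, derivable f x (delta_mx 0 j)) ->
  (forall j, continuous (partial j f)) ->
  periodic_on B setT f -> torus_integral B (partial i f) = 0.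
Proof.
move=> cf df cdf pf; apply/eqP; rewrite mulf_eq0; apply/orP; right; apply/eqP.
pose phi k := fun t : 'rV[R]_8 => \sum_j B k j * partial j f (t *m B).
have dphi k t : is_derive t (delta_mx 0 k) (fun t => f (t *m B)) (phi k t).
  apply: is_derive_mulmxr.
  have -> : phi k t = \sum_j ((delta_mx 0 k : 'rV[R]_8) *m B) 0 j * 'D_(delta_mx 0 j) f (t *m B).
    by apply: eq_bigr => j _; rewrite -rowE mxE.
  exact: is_derive_rows.
have cphi k : continuous (phi k).
  move=> t; apply: row_continuous_sum => j _; apply: row_continuousM; first exact: row_continuous_cst.
  exact: mulmxr_comp_continuous.
have phi0 k : cube_integral (phi k) = 0.
  have E : (fun t => 'D_(delta_mx 0 k) (fun t => f (t *m B)) t) = phi k.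
    by apply/funext => t; have [] := dphi k t.
  rewrite -E; apply: cube_integral_derivative_periodic.
  - exact: mulmxr_comp_continuous.
  - by move=> t; have [] := dphi k t.
  - by rewrite E.
  - move=> t; rewrite mulmxDl pf//.
    exists (delta_mx 0 k) => //; congr (_ *m _).
    by apply/rowP => j; rewrite !mxE; case: (_ && _).
have -> : (fun t => partial i f (t *m B)) = fun t => \sum_k (invmx B) i k * phi k t.
  apply/funext => t; rewrite /phi.
  under eq_bigr do rewrite mulr_sumr.
  rewrite exchange_big /=.
  under eq_bigr => j _.
    under eq_bigr do rewrite mulrA.
    rewrite -mulr_suml (_ : \sum_k _ = (invmx B *m B) i j); last by rewrite mxE.
    rewrite mulVmx// mxE.
    over.
  rewrite (bigD1 i)//= eqxx mulr1n mul1r big1 ?addr0// => j /negbTE ji.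
  by rewrite eq_sym ji mul0r.
have csum r : continuous (fun t : 'rV[R]_8 => \sum_(k <- r) (invmx B) i k * phi k t).
  move=> t; apply: row_continuous_sum => k _; apply: row_continuousM; [exact: row_continuous_cst|exact: cphi].
elim: (index_enum 'I_8) => [|k r IH].
  rewrite (_ : (fun t => _) = fun=> 0) ?cube_integral_cst//.
  by apply/funext => t; rewrite big_nil.
rewrite (_ : (fun t => _) = fun t => (invmx B) i k * phi k t
   + \sum_(k <- r) (invmx B) i k * phi k t); last first.
  by apply/funext => t; rewrite big_cons.
by rewrite cube_integral_linear// phi0 IH mulr0 addr0.
Qed.

End Torus.

(** * Two-forms as antisymmetric arrays *)

Local Open Scope complex_scope.

Section TwoForms.

Lemma ltn_neq n (i j : 'I_n) : (i < j)%N -> i != j.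
Proof. by move=> ij; apply/eqP => ijE; rewrite ijE ltnn in ij. Qed.

Lemma pair_eq (i j k l : 'I_8) : (i < j)%N -> (k < l)%N ->
  ([set i; j] == [set k; l]) = (i == k) && (j == l).
Proof.
move=> ij kl; apply/eqP/andP => [E|[/eqP-> /eqP->]//].
have := set21 k l; have := set22 k l; have := set21 i j; have := set22 i j.
rewrite {1 2}E -E !inE -!val_eqE /=.
move=> /orP[]/eqP j1 /orP[]/eqP i1 /orP[]/eqP l1 /orP[]/eqP k1; split; apply/eqP; lia.
Qed.

(** Counts the ways of writing U as an increasing pair; it turns sums over sets into sums over pairs. *)
Lemma card2_pairs (U : {set 'I_8}) :
  (\sum_(i < 8) \sum_(j < 8 | (i < j)%N && (U == [set i; j])) 1 = (#|U| == 2%N))%N.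
Proof.
have [/cards2P[a [b [ab ->]]]|U2] := boolP (#|U| == 2%N); last first.
  rewrite big1// => i _; rewrite big1// => j /andP[ij /eqP UE].
  by move: U2; rewrite UE cards2 (ltn_neq ij).
have {ab} [a' [b' [ab ->]]] : exists a' b' : 'I_8, (a' < b')%N /\ [set a; b] = [set a'; b'].
  move: ab; rewrite -val_eqE /= neq_ltn => /orP[ab|ba]; first by exists a, b.
  by exists b, a; rewrite finset.setUC.
rewrite (bigD1 a')//= (bigD1 b') /=; last by rewrite ab eqxx.
rewrite big1 ?addn0 => [|j /andP[/andP[aj]]]; last first.
  by rewrite pair_eq// eqxx /= eq_sym => ->.
rewrite big1 ?addn0// => i ia; rewrite big1// => j /andP[ij].
by rewrite pair_eq// eq_sym (negbTE ia).
Qed.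

Lemma sum_pairs (V : nmodType) (G : {set 'I_8} -> V) :
  (forall U : {set 'I_8}, #|U| != 2%N -> G U = 0) ->
  \sum_U G U = \sum_(i < 8) \sum_(j < 8 | (i < j)%N) G [set i; j].
Proof.
move=> G0.
transitivity (\sum_U \sum_(i < 8) \sum_(j < 8 | (i < j)%N && (U == [set i; j])) G U).
  apply: eq_bigr => U _.
  have -> : \sum_(i < 8) \sum_(j < 8 | (i < j)%N && (U == [set i; j])) G U
     = G U *+ (\sum_(i < 8) \sum_(j < 8 | (i < j)%N && (U == [set i; j])) 1)%N.
    by rewrite -sumrMnr; apply: eq_bigr => i _; rewrite -sumrMnr; apply: eq_bigr.
  rewrite card2_pairs; case: eqP => [_|/eqP/G0 ->]; rewrite ?mulr1n ?mul0rn//.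
rewrite exchange_big /=; apply: eq_bigr => i _.
under eq_bigr do rewrite big_mkcondr.
rewrite exchange_big /=; apply: eq_bigr => j ij.
by rewrite -big_mkcond /= big_pred1_eq.
Qed.

Lemma inversionsE (T U : {set 'I_8}) :
  inversions T U = (\sum_(p in T) \sum_(q in U) (q < p))%N.
Proof.
rewrite /inversions -sum1dep_card pair_big_dep /=.
rewrite [RHS]big_mkcond [LHS]big_mkcond /=; apply: eq_bigr => -[p q] _ /=.
by case: (p \in T); case: (q \in U); case: (q < p)%N.
Qed.

Lemma inversions_pairs (a b c d : 'I_8) : a != b -> c != d ->
  inversions [set a; b] [set c; d] = ((c < a) + (d < a) + ((c < b) + (d < b)))%N.
Proof.
move=> ab cd; rewrite inversionsE.
rewrite big_setU1 ?inE//= big_set1.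
by rewrite !big_setU1 ?inE//= !big_set1.
Qed.

Lemma sign_pairs (K : pzRingType) (a b c d : 'I_8) : a != b -> c != d ->
  (-1) ^+ inversions [set a; b] [set c; d] =
  (-1) ^+ ((c < a)%N (+) (d < a)%N (+) ((c < b)%N (+) (d < b)%N)) :> K.
Proof.
by move=> ab cd; rewrite inversions_pairs// -signr_odd !oddD !oddb.
Qed.

(** Extending the coefficients of a 2-form by antisymmetry removes the conditions i < j from sums. *)
Definition coef2 (K : zmodType) (a : form K) : 'M[K]_8 :=
  \matrix_(i, j) if (i < j)%N then a [set i; j]
                 else if (j < i)%N then - a [set i; j] else 0.

Lemma coef2_skew (K : zmodType) (a : form K) i j : coef2 a j i = - coef2 a i j.
Proof.
rewrite !mxE finset.setUC; case: ltngtP => _; rewrite ?opprK//; by rewrite oppr0.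
Qed.

Lemma coef2_lt (K : zmodType) (a : form K) (i j : 'I_8) : (i < j)%N ->
  coef2 a i j = a [set i; j].
Proof. by move=> ij; rewrite mxE ij. Qed.

Lemma coef2_kahler (R : realType) (L : 'M[R]_8) : (forall i j, L j i = - L i j) ->
  coef2 (kahler L) = L.
Proof.
move=> sk.
have lt_ (i j : 'I_8) : (i < j)%N -> kahler L [set i; j] = L i j.
  move=> ij; rewrite ffunE (bigD1 i)//= (bigD1 j) /=; last by rewrite ij eqxx.
  rewrite big1 ?addr0 => [|l /andP[/andP[il]]]; last first.
    by rewrite pair_eq// eqxx /= eq_sym => ->.
  rewrite big1 ?addr0// => k ki; rewrite big1// => l /andP[kl].
  by rewrite pair_eq// eq_sym (negbTE ki).
apply/matrixP => i j; rewrite mxE; case: ltngtP => [/lt_//|ji|/ord_inj <-].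
  by rewrite finset.setUC lt_// -sk.
have := sk i i; lra.
Qed.

Lemma kahler_homogeneous (R : realType) (L : 'M[R]_8) : homogeneous 2 (kahler L).
Proof.
move=> S S2; rewrite ffunE big1// => i _; rewrite big1// => j /andP[ij /eqP SE].
by move: S2; rewrite SE cards2 (ltn_neq ij).
Qed.

Lemma big_4set (V : nmodType) (p q r s : 'I_8) (G : 'I_8 -> V) :
  uniq [:: p; q; r; s] ->
  \sum_(i in [set p; q; r; s]) G i = G p + G q + G r + G s.
Proof.
move=> u; rewrite (eq_bigl (fun i => i \in [:: p; q; r; s])); last first.
  by move=> i; rewrite !inE -!orbA.
by rewrite -big_uniq//= !big_cons big_nil addr0 !addrA.
Qed.

Lemma uniq4 (p q r s : 'I_8) : (p < q < r)%N -> (r < s)%N -> uniq [:: p; q; r; s].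
Proof.
move=> /andP[pq qr] rs /=; rewrite !inE !negb_or !(ltn_neq pq, ltn_neq qr, ltn_neq rs).
by rewrite (ltn_neq (ltn_trans pq qr)) (ltn_neq (ltn_trans qr rs))
  (ltn_neq (ltn_trans pq (ltn_trans qr rs))).
Qed.

(** The six terms are the six ways of splitting the four indices into two pairs. *)
Lemma wedge_sorted (K : pzRingType) (a b : form K) (p q r s : 'I_8) :
  homogeneous 2 a -> (p < q < r)%N -> (r < s)%N ->
  let A i j := a [set i; j] in let B i j := b [set i; j] in
  wedge a b [set p; q; r; s] =
  A p q * B r s - A p r * B q s + A p s * B q r
  + A q r * B p s - A q s * B p r + A r s * B p q.
Proof.
move=> ha pqr rs A B; have u := uniq4 pqr rs.
move: (pqr) => /andP[pq qr].
set S := [set p; q; r; s].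
pose G (T : {set 'I_8}) := (-1) ^+ inversions T (S :\: T) * (a T * b (S :\: T)).
transitivity (\sum_(i in S) \sum_(j in S) if (i < j)%N then G [set i; j] else 0).
  rewrite ffunE big_mkcond /= sum_pairs => [|U U2]; last first.
    by rewrite ha// mul0r mulr0; case: ifP.
  rewrite [RHS]big_mkcond /=; apply: eq_bigr => i _.
  rewrite big_mkcond /=; case: (boolP (i \in S)) => iS; last first.
    apply: big1 => j _; case: ifP => // _; case: ifP => //.
    by rewrite finset.subUset !finset.sub1set (negbTE iS).
  rewrite [RHS]big_mkcond /=; apply: eq_bigr => j _.
  by rewrite finset.subUset !finset.sub1set iS /=; case: (j \in S); case: (i < j)%N.
have diff (i j k l : 'I_8) : uniq [:: i; j; k; l] -> S =i [:: i; j; k; l] ->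
    S :\: [set i; j] = [set k; l].
  move=> u' SE; apply/setP => m; rewrite finset.in_setD SE !inE.
  move: u'; rewrite /= !inE !negb_or => /and4P[/and3P[ij ik il] /andP[jk jl] kl _].
  case: (eqVneq m i) => [->|mi] /=; first by rewrite (negbTE ik) (negbTE il).
  by case: (eqVneq m j) => [->|mj] //=; rewrite (negbTE jk) (negbTE jl).
have SE (i j k l : 'I_8) : perm_eq [:: p; q; r; s] [:: i; j; k; l] ->
    S :\: [set i; j] = [set k; l].
  move=> pe; apply: diff; first by rewrite -(perm_uniq pe).
  by move=> m; rewrite -(perm_mem pe) !inE -!orbA.
have pr := ltn_trans pq qr; have qs := ltn_trans qr rs; have ps := ltn_trans pq qs.
have N (x y : 'I_8) : (x < y)%N -> (y < x)%N = false by move=> xy; lia.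
have GE (i j k l : 'I_8) : (i < j)%N -> (k < l)%N ->
    perm_eq [:: p; q; r; s] [:: i; j; k; l] ->
    G [set i; j] = (-1) ^+ ((k < i)%N (+) (l < i)%N (+) ((k < j)%N (+) (l < j)%N)) * (A i j * B k l).
  by move=> ij kl pe; rewrite /G (SE _ _ _ _ pe) sign_pairs ?ltn_neq.
have {}GE : (G [set p; q] = A p q * B r s) * (G [set p; r] = - (A p r * B q s))
   * (G [set p; s] = A p s * B q r) * (G [set q; r] = A q r * B p s)
   * (G [set q; s] = - (A q s * B p r)) * (G [set r; s] = A r s * B p q).
  split; [split; [split; [split; [split|]|]|]|].
  - by rewrite (GE p q r s)// !(N _ _ pr, N _ _ ps, N _ _ qr, N _ _ qs) /= expr0 mul1r.
  - rewrite (GE p r q s) ?(N _ _ pq, N _ _ ps, N _ _ rs, qr) /= ?expr1 ?mulN1r//.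
    by apply/permP => f /=; lia.
  - rewrite (GE p s q r) ?(N _ _ pq, N _ _ pr, qs, rs) /= ?expr0 ?mul1r//.
    by apply/permP => f /=; lia.
  - rewrite (GE q r p s) ?(N _ _ qs, N _ _ rs, pq, pr) /= ?expr0 ?mul1r//.
    by apply/permP => f /=; lia.
  - rewrite (GE q s p r) ?(N _ _ qr, pq, ps, rs) /= ?expr1 ?mulN1r//.
    by apply/permP => f /=; lia.
  - rewrite (GE r s p q) ?(pr, qr, ps, qs) /= ?expr0 ?mul1r//.
    by apply/permP => f /=; lia.
rewrite !big_4set// !ltnn !(pq, pr, ps, qr, qs, rs) !(N _ _ pq, N _ _ pr, N _ _ ps, N _ _ qr, N _ _ qs, N _ _ rs).
rewrite !GE !addr0 !add0r !addrA //.
Qed.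

End TwoForms.

(** * Pairing with the square of a Kaehler form *)

Section KahlerSquare.
Context {R : realType}.
Implicit Types (L : 'M[R]_8).

(** The coefficients of omega_L /\ omega_L / 2, as an antisymmetric array. *)
Definition half_square (L : 'M[R]_8) (i j k l : 'I_8) : R :=
  L i j * L k l - L i k * L j l + L i l * L j k.

Lemma disjoint_pairs (i j k l : 'I_8) :
  [disjoint [set i; j] & [set k; l]] = [&& i != k, i != l, j != k & j != l].
Proof.
by rewrite finset.disjoints_subset finset.subUset !finset.sub1set !inE !negb_or -!andbA.
Qed.

Lemma half_square_not_disjoint L i j k l : (forall i j, L j i = - L i j) ->
  ~~ [disjoint [set i; j] & [set k; l]] -> half_square L i j k l = 0.
Proof.
move=> sk; have d m : L m m = 0 by have := sk m m; lra.
rewrite disjoint_pairs !negb_and !negbK /half_square.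
move=> /orP[|/orP[|/orP[|]]] /eqP <-; rewrite ?d.
- by rewrite (sk i j); ring.
- by rewrite (sk i j) (sk i k); ring.
- ring.
- by rewrite (sk k j); ring.
Qed.

Section Skew.
Variables (L : 'M[R]_8) (sk : forall i j, L j i = - L i j).

Lemma half_square12 i j k l : half_square L j i k l = - half_square L i j k l.
Proof. by rewrite /half_square (sk i j); ring. Qed.

Lemma half_square23 i j k l : half_square L i k j l = - half_square L i j k l.
Proof. by rewrite /half_square (sk j k); ring. Qed.

Lemma half_square34 i j k l : half_square L i j l k = - half_square L i j k l.
Proof. by rewrite /half_square (sk k l); ring. Qed.

End Skew.

(** Both sides change by the same sign when the indices are sorted, so the six relative positions
    of the two pairs reduce to [wedge_sorted]. *)
Lemma kahler_square_pairs L (i j k l : 'I_8) : (forall i j, L j i = - L i j) ->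
  (i < j)%N -> (k < l)%N -> [disjoint [set i; j] & [set k; l]] ->
  (-1) ^+ inversions [set i; j] [set k; l]
    * wedge (kahler L) (kahler L) ([set i; j] :|: [set k; l])
  = 2 * half_square L i j k l.
Proof.
move=> sk ij kl; rewrite disjoint_pairs => /and4P[ik il jk jl].
have K (a b : 'I_8) : (a < b)%N -> kahler L [set a; b] = L a b.
  by move=> ab; rewrite -coef2_lt// coef2_kahler.
have W (p q r s : 'I_8) : (p < q < r)%N -> (r < s)%N ->
    wedge (kahler L) (kahler L) [set p; q; r; s] = 2 * half_square L p q r s.
  move=> pqr rs; rewrite wedge_sorted//; last exact: kahler_homogeneous.
  have /andP[pq qr] := pqr.
  by rewrite !K// ?(ltn_trans _ rs)// ?(ltn_trans pq)// ?(ltn_trans qr)// /half_square; ring.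
have SE (p q r s : 'I_8) : perm_eq [:: i; j; k; l] [:: p; q; r; s] ->
    [set i; j] :|: [set k; l] = [set p; q; r; s].
  move=> pe; apply/setP => m; have := perm_mem pe m; rewrite !inE -!orbA //.
rewrite sign_pairs ?ltn_neq//.
have N (x y : 'I_8) : (x < y)%N -> (y < x)%N = false by move=> xy; lia.
have pe (p q r s : 'I_8) : perm_eq [:: i; j; k; l] [:: p; q; r; s] ->
    (p < q < r)%N -> (r < s)%N ->
    wedge (kahler L) (kahler L) ([set i; j] :|: [set k; l]) = 2 * half_square L p q r s.
  by move=> /SE ->; exact: W.
have lt_total (x y : 'I_8) : x != y -> (x < y)%N \/ (y < x)%N.
  by rewrite -val_eqE /= neq_ltn => /orP.
have P (p q r s : 'I_8) : (forall f : pred 'I_8,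
    (f i + (f j + (f k + (f l + 0))) = f p + (f q + (f r + (f s + 0))))%N) ->
    perm_eq [:: i; j; k; l] [:: p; q; r; s].
  by move=> H; apply/permP => f; exact: H.
have [ik'|ki] := lt_total _ _ ik; last first.
  have kj := ltn_trans ki ij; rewrite ki kj.
  have [il'|li] := lt_total _ _ il; last first.
    have lj := ltn_trans li ij; rewrite li lj /= expr0 mul1r.
    rewrite (pe k l i j) ?kl ?li ?ij//; last by apply: P => f; lia.
    by rewrite half_square23// half_square34// half_square12// half_square23// !opprK.
  rewrite (N _ _ il'); have [jl'|lj] := lt_total _ _ jl.
    rewrite (N _ _ jl') /= expr0 mul1r (pe k i j l) ?ki ?ij//; last by apply: P => f; lia.
    by rewrite half_square12// half_square23// opprK.
  rewrite lj /= expr1 mulN1r (pe k i l j) ?ki ?il'//; last by apply: P => f; lia.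
  by rewrite half_square12// half_square34// half_square23// opprK mulrN opprK.
have il' := ltn_trans ik' kl; rewrite (N _ _ ik') (N _ _ il').
have [jk'|kj] := lt_total _ _ jk.
  have jl' := ltn_trans jk' kl; rewrite (N _ _ jk') (N _ _ jl') /= expr0 mul1r.
  by rewrite (pe i j k l) ?ij.
rewrite kj; have [jl'|lj] := lt_total _ _ jl.
  rewrite (N _ _ jl') /= expr1 mulN1r (pe i k j l) ?ik' ?kj//; last by apply: P => f; lia.
  by rewrite half_square23// mulrN opprK.
rewrite lj /= expr0 mul1r (pe i k l j) ?ik' ?kl//; last by apply: P => f; lia.
by rewrite half_square34// half_square23// opprK.
Qed.

(** The inner product of the 4-forms a /\ b and omega_L /\ omega_L. *)
Definition kahler_square_pairing (a b : form R[i]) L : R[i] :=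
  \sum_(T : {set 'I_8}) wedge a b T * (wedge (kahler L) (kahler L) T)%:C.

(** Bilinear rather than sesquilinear: conjugates are written where they are needed. *)
Definition frobenius (X Y : 'M[R[i]]_8) : R[i] := \sum_i \sum_j X i j * Y i j.

(** The pairs (U, T) with U contained in T correspond to the disjoint pairs (U, V), with T the union of
    U and V. *)
Lemma sum_wedge (K : pzRingType) (a b : form K) (G : {set 'I_8} -> K) :
  \sum_(T : {set 'I_8}) wedge a b T * G T =
  \sum_(U : {set 'I_8}) \sum_(V : {set 'I_8} | [disjoint U & V])
     (-1) ^+ inversions U V * (a U * b V) * G (U :|: V).
Proof.
transitivity (\sum_(U : {set 'I_8}) \sum_(T : {set 'I_8} | U \subset T)
     (-1) ^+ inversions U (T :\: U) * (a U * b (T :\: U)) * G T).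
  under eq_bigr do rewrite ffunE mulr_suml big_mkcond.
  by rewrite exchange_big /=; apply: eq_bigr => U _; rewrite -big_mkcond.
apply: eq_bigr => U _.
rewrite (reindex_onto (fun V => U :|: V) (fun T => T :\: U)) /=; last first.
  by move=> T UT; rewrite -{1}(finset.setIidPr UT) finset.setID.
have E V : ((U :|: V) :\: U == V) = [disjoint U & V].
  rewrite finset.setDUl finset.setDv finset.set0U finset.setDE.
  by rewrite (sameP eqP finset.setIidPl) disjoint_sym finset.disjoints_subset.
apply: eq_big => V; first by rewrite finset.subsetUl /= E.
by move=> /andP[_ /eqP ->].
Qed.

Lemma kahler_square_pairingE (a b : form R[i]) L : (forall i j, L j i = - L i j) ->
  homogeneous 2 a -> homogeneous 2 b ->
  kahler_square_pairing a b L =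
  \sum_(i < 8) \sum_(j < 8 | (i < j)%N) \sum_(k < 8) \sum_(l < 8 | (k < l)%N)
     coef2 a i j * coef2 b k l * (2 * half_square L i j k l)%:C.
Proof.
move=> sk ha hb.
rewrite /kahler_square_pairing sum_wedge sum_pairs => [|U U2]; last first.
  by rewrite big1// => V _; rewrite ha// mul0r mulr0 mul0r.
apply: eq_bigr => i _; apply: eq_bigr => j ij.
rewrite big_mkcond sum_pairs /= => [|U U2]; last first.
  by case: ifP => // _; rewrite hb// !mulr0 mul0r.
apply: eq_bigr => k _; apply: eq_bigr => l kl.
rewrite !coef2_lt//; case: ifPn => [d|nd]; last first.
  by rewrite half_square_not_disjoint// !mulr0.
rewrite -kahler_square_pairs// rmorphM rmorphXn rmorphN1.
by rewrite -[LHS]mulrA [RHS]mulrCA.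
Qed.

Lemma sum_upper (K : comPzRingType) (F : 'I_8 -> 'I_8 -> K) :
  (forall i j, F j i = F i j) -> (forall i, F i i = 0) ->
  2 * (\sum_(i < 8) \sum_(j < 8 | (i < j)%N) F i j) = \sum_i \sum_j F i j.
Proof.
move=> Fs F0; rewrite mulr_natl mulr2n.
rewrite {2}(eq_bigr (fun i : 'I_8 => \sum_(j < 8) if (i < j)%N then F i j else 0)); last first.
  by move=> i _; rewrite big_mkcond.
rewrite exchange_big /= -big_split /=; apply: eq_bigr => i _.
rewrite [X in X + _]big_mkcond -big_split /=; apply: eq_bigr => j _.
case: ltngtP => [ij|ji|/ord_inj ->]; rewrite ?addr0 ?add0r// ?F0//.
Qed.

Lemma frobenius_conjugate (X Y : 'M[R[i]]_8) (M : 'M[R[i]]_8) :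
  frobenius X (M *m Y *m M^T) = \sum_i \sum_j \sum_k \sum_l X i j * Y k l * (M i k * M j l).
Proof.
apply: eq_bigr => i _; apply: eq_bigr => j _.
rewrite mxE mulr_sumr exchange_big; apply: eq_bigr => l _.
rewrite !mxE mulr_suml mulr_sumr; apply: eq_bigr => k _.
by ring.
Qed.

(** As [half_square] vanishes when an index is repeated, the disjointness in [sum_wedge] can be
    dropped; by antisymmetry the sums over increasing pairs are a quarter of the full sum. *)
Lemma kahler_square_pairing_full (a b : form R[i]) L : (forall i j, L j i = - L i j) ->
  homogeneous 2 a -> homogeneous 2 b ->
  2 * kahler_square_pairing a b L =
  \sum_i \sum_j \sum_k \sum_l coef2 a i j * coef2 b k l * (half_square L i j k l)%:C.
Proof.
move=> sk ha hb; rewrite kahler_square_pairingE//.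
set A := coef2 a; set B := coef2 b.
have skA i j : A j i = - A i j by exact: coef2_skew.
have skB i j : B j i = - B i j by exact: coef2_skew.
have A0 i : A i i = 0 by rewrite mxE ltnn.
have B0 i : B i i = 0 by rewrite mxE ltnn.
pose F i j k l := A i j * B k l * (half_square L i j k l)%:C.
have inner i j : \sum_(k < 8) \sum_(l < 8 | (k < l)%N) A i j * B k l * (2 * half_square L i j k l)%:C
    = \sum_k \sum_l F i j k l.
  rewrite -(@sum_upper _ (F i j)) => [|k l|k].
  - rewrite mulr_sumr; apply: eq_bigr => k _; rewrite mulr_sumr; apply: eq_bigr => l _.
    by rewrite rmorphM rmorph_nat /F; ring.
  - by rewrite /F skB half_square34// !mulrN rmorphN; ring.
  - by rewrite /F B0 mulr0 mul0r.
under eq_bigr => i _ do under eq_bigr => j _ do rewrite inner.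
apply: (@sum_upper _ (fun i j => \sum_k \sum_l F i j k l)) => [i j|i].
  apply: eq_bigr => k _; apply: eq_bigr => l _.
  by rewrite /F skA half_square12// rmorphN; ring.
by apply: big1 => k _; apply: big1 => l _; rewrite /F A0 !mul0r.
Qed.

(** The first term of [half_square] gives the product of the contractions; by antisymmetry of b each of
    the two others gives minus the pairing of a with M b M^T. *)
Lemma kahler_square_pairing_mx (a b : form R[i]) L : (forall i j, L j i = - L i j) ->
  homogeneous 2 a -> homogeneous 2 b ->
  let M := map_mx (real_complex R) L in let A := coef2 a in let B := coef2 b in
  2 * kahler_square_pairing a b L = frobenius M A * frobenius M B - 2 * frobenius A (M *m B *m M^T).
Proof.
move=> sk ha hb M A B; rewrite kahler_square_pairing_full//.
have skB i j : B j i = - B i j by exact: coef2_skew.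
have -> : frobenius M A * frobenius M B = \sum_i \sum_j \sum_k \sum_l A i j * B k l * (M i j * M k l).
  rewrite /frobenius mulr_suml; apply: eq_bigr => i _; rewrite mulr_suml; apply: eq_bigr => j _.
  rewrite mulr_sumr; apply: eq_bigr => k _; rewrite mulr_sumr; apply: eq_bigr => l _; ring.
have E : frobenius A (M *m B *m M^T)
    = - \sum_i \sum_j \sum_k \sum_l A i j * B k l * (M i l * M j k).
  rewrite frobenius_conjugate -sumrN; apply: eq_bigr => i _; rewrite -sumrN; apply: eq_bigr => j _.
  rewrite exchange_big -sumrN; apply: eq_bigr => k _; rewrite -sumrN; apply: eq_bigr => l _.
  by rewrite skB; ring.
rewrite mulr_natl mulr2n [X in - (X + _)]frobenius_conjugate E opprD opprK addrA.
rewrite -sumrB -big_split; apply: eq_bigr => i _ /=.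
do 3! (rewrite -sumrB -big_split; apply: eq_bigr => ? _ /=).
by rewrite /half_square !mxE rmorphD rmorphB !rmorphM /=; ring.
Qed.

End KahlerSquare.

(** * The contraction of Omega with a compatible Kaehler form *)

Section Spin7.
Context {R : realType}.
Implicit Types (L : 'M[R]_8).

(** An orthogonal complex structure has L^T = L^-1 = - L. *)
Lemma hermitian_structure_skew L : hermitian_structure L -> forall i j, L j i = - L i j.
Proof.
case=> LL LLT i j.
have E : L^T = - L.
  by rewrite -[L^T]mul1mx -[1%:M]opprK -LL mulNmx -mulmxA LLT mulmx1.
by have /matrixP/(_ i j) := E; rewrite !mxE.
Qed.

Definition position (k : 'I_8) (S : {set 'I_8}) := #|[set j in S | (j < k)%N]|.

Lemma position_setU1 (k l : 'I_8) (S : {set 'I_8}) : k \notin S ->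
  position l (k |: S) = ((k < l) + position l S)%N.
Proof.
move=> kS; rewrite /position; case: (ltnP k l) => kl.
  rewrite (_ : [set j in k |: S | _] = k |: [set j in S | (j < l)%N]).
    by rewrite cardsU1 !inE (negbTE kS).
  by apply/setP => j; rewrite !inE; case: eqP => //= ->; rewrite kl.
rewrite add0n; apply: eq_card => j; rewrite !inE; case: eqP => //= ->.
by rewrite ltnNge kl andbF.
Qed.

Lemma inversions_position (k l : 'I_8) (S : {set 'I_8}) : k != l ->
  inversions [set k; l] S = (position k S + position l S)%N.
Proof.
move=> kl; rewrite inversionsE big_setU1 ?inE//= big_set1.
by rewrite /position -!sum1_card; congr (_ + _)%N; rewrite [LHS]big_mkcond [RHS]big_mkcond;
  apply: eq_bigr => q _; rewrite !inE; case: (q \in S); case: ltnP.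
Qed.

(** A form of type (4,0) satisfies theta(e_k L, ...) = 'i theta(e_k, ...), so its contraction with
    omega_L is 'i times the sum of theta(e_k, e_k, ...), which is 0. *)
Lemma theta_contraction L (theta : form R[i]) (S : {set 'I_8}) :
  hermitian_structure L -> (forall i j, L j i = - L i j) -> has_type L 4 0 theta ->
  \sum_(k < 8) \sum_(l < 8 | (k < l)%N)
     (if [disjoint [set k; l] & S] then
       (-1) ^+ inversions [set k; l] S * (L k l)%:C * theta ([set k; l] :|: S) else 0) = 0.
Proof.
move=> [LL LLT] sk [_ _ h01].
pose M := map_mx (real_complex R) L.
have row0 (k : 'I_8) (S' : {set 'I_8}) : \sum_(l | l \notin S') (-1) ^+ position l S'
    * ((delta_mx 0 k : 'rV[R[i]]_8) 0 l + 'i * M k l) * theta (l |: S') = 0.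
  (* e_k + 'i e_k L is of type (0, 1) *)
  pose w : 'rV[R[i]]_8 := delta_mx 0 k + 'i *: row k M.
  have w01 : vector01 L w.
    rewrite /vector01 /w -/M mulmxDl -scalemxAl -!row_mul -rowE.
    have -> : M *m M = - 1%:M by rewrite -map_mxM LL map_mxN map_mx1.
    rewrite linearN /= row1 scalerN scalerDr !scaleNr scalerA -expr2 sqrCi scaleN1r opprK.
    by rewrite addrC.
  have wE v : v \in [:: w] -> vector01 L v by rewrite inE => /eqP ->.
  by rewrite -[RHS](h01 [:: w] erefl wE S') /= ffunE; apply: eq_bigr => l _; rewrite !mxE.
pose F (k l : 'I_8) := if [&& k \notin S, l \notin S & k != l] then
  (-1) ^+ position k S * ((-1) ^+ (k < l)%N * (-1) ^+ position l S) * M k l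
    * theta ([set k; l] :|: S) else 0.
have F0 k : \sum_l F k l = 0.
  have [kS|kS] := boolP (k \in S).
    by apply: big1 => l _; rewrite /F kS.
  rewrite -[RHS](mulr0 ((-1) ^+ position k S * - 'i)) -[in RHS](row0 k (k |: S)).
  rewrite mulr_sumr big_mkcond [RHS]big_mkcond /=.
  apply: eq_bigr => l _; rewrite !inE negb_or /F kS /= andbC eq_sym.
  case: eqVneq => //= kl; case: (l \in S) => //=.
  rewrite position_setU1// exprD !mxE eqxx (negbTE kl) /= add0r.
  rewrite (_ : [set k; l] :|: S = l |: (k |: S)); last first.
    by rewrite [RHS]finset.setUA [_ |: [set k]]finset.setUC.
  have ii : 'i * 'i = -1 :> R[i] by rewrite -expr2 sqrCi.
  transitivity (- ('i * 'i) * ((-1) ^+ position k S * ((-1) ^+ (k < l)%N * (-1) ^+ position l S) *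
    (L k l)%:C * theta (l |: (k |: S)))); last by ring.
  by rewrite ii opprK mul1r.
have Fs k l : F l k = F k l.
  rewrite /F andbCA eq_sym; case: (k \notin S); case: (l \notin S) => //=.
  rewrite (finset.setUC [set l] [set k]) !mxE sk rmorphN.
  case: (eqVneq k l) => //=; rewrite -val_eqE /=; case: ltngtP => //= _ _.
    by rewrite ?expr0 ?expr1; ring.
  by rewrite ?expr0 ?expr1; ring.
have Fd k : F k k = 0 by rewrite /F eqxx !andbF.
have Fsum : \sum_(k < 8) \sum_(l < 8 | (k < l)%N) F k l = 0.
  have := sum_upper Fs Fd; rewrite [RHS]big1 => [/eqP|k _]; last exact: F0.
  by rewrite mulf_eq0 pnatr_eq0 /= => /eqP.
transitivity (- \sum_(k < 8) \sum_(l < 8 | (k < l)%N) F k l); last by rewrite Fsum oppr0.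
rewrite -sumrN; apply: eq_bigr => k _.
rewrite -sumrN; apply: eq_bigr => l kl; rewrite /F (ltn_neq kl) andbT.
have -> : [disjoint [set k; l] & S] = (k \notin S) && (l \notin S).
  by rewrite finset.disjoints_subset finset.subUset !finset.sub1set !inE.
case: ifP => _; last by rewrite oppr0.
by rewrite inversions_position ?ltn_neq// exprD kl !mxE expr1; ring.
Qed.

(** The first term of [half_square] gives 4 L i j, as the squares of the entries of L add up to 8, and
    the two others give - (L i j) / 2 each, as L L = -1. *)
Lemma half_square_contraction L (i j : 'I_8) :
  hermitian_structure L -> (forall i j, L j i = - L i j) ->
  \sum_(k < 8) \sum_(l < 8 | (k < l)%N) half_square L k l i j * L k l = 3 * L i j.
Proof.
move=> [LL LLT] sk.
have two0 : 2 != 0 :> R by rewrite pnatr_eq0.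
apply: (mulfI two0).
rewrite (sum_upper (F := fun k l => half_square L k l i j * L k l)); first last.
- by move=> k; rewrite (_ : L k k = 0) ?mulr0//; have := sk k k; lra.
- by move=> k l; rewrite half_square12// sk mulrNN.
have norm : \sum_k \sum_l L k l * L k l = 8.
  have /(congr1 mxtrace) := LLT; rewrite mxtrace_scalar => <-.
  by apply: eq_bigr => k _; rewrite mxE; apply: eq_bigr => l _; rewrite mxE.
have sq a b : \sum_k \sum_l L k a * L l b * L k l = L a b.
  have /(congr1 (fun M => (L^T *m M) a b)) := LL.
  rewrite mulmxN mulmx1 !mxE sk opprK => <-; apply: eq_bigr => k _.
  rewrite !mxE mulr_sumr; apply: eq_bigr => l _; ring.
transitivity (L i j * (\sum_k \sum_l L k l * L k l)
   - \sum_k \sum_l L k i * L l j * L k l + \sum_k \sum_l L k j * L l i * L k l).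
  rewrite mulr_sumr -sumrB -big_split; apply: eq_bigr => k _ /=.
  rewrite mulr_sumr -sumrB -big_split; apply: eq_bigr => l _ /=.
  by rewrite /half_square; ring.
rewrite norm !sq (sk i j); ring.
Qed.

Lemma complex_ReZ (x : R) (z : R[i]) : complex.Re (x%:C * z) = x * complex.Re z.
Proof. by case: z => a b /=; rewrite mul0r subr0. Qed.

(** The array of Omega, with the sign of the permutation that sorts (k, l, i, j), for
    k < l and i < j. *)
Definition Omega_coef (k l i j : 'I_8) : R :=
  if [disjoint [set k; l] & [set i; j]] then
    (-1) ^+ inversions [set k; l] [set i; j] * Omega R ([set k; l] :|: [set i; j])
  else 0.

(** Omega is half the square of omega_L plus Re theta, and theta contributes nothing. *)
Lemma U'_contraction L (i j : 'I_8) : U' L -> (i < j)%N ->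
  \sum_(k < 8) \sum_(l < 8 | (k < l)%N) Omega_coef k l i j * L k l = 3 * L i j.
Proof.
move=> [theta [[hL ht _] cL]] ij.
have sk := hermitian_structure_skew hL.
rewrite -(half_square_contraction i j hL sk).
have /(congr1 (@complex.Re R)) := theta_contraction [set i; j] hL sk ht.
rewrite raddf_sum /= => th0.
rewrite -[RHS]addr0 -[X in _ + X]th0 -big_split; apply: eq_bigr => k _ /=.
rewrite raddf_sum -big_split; apply: eq_bigr => l kl /=.
rewrite /Omega_coef; case: ifPn => [d|nd]; last first.
  by rewrite half_square_not_disjoint// !mul0r addr0.
rewrite -cL mulrDr mulrDl; congr (_ + _).
  by rewrite mulrCA kahler_square_pairs// mulrA mulVf ?pnatr_eq0// mul1r.
rewrite -(rmorphN1 (real_complex R)) -rmorphXn -rmorphM complex_ReZ mulrAC.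
by rewrite mulrAC.
Qed.

Definition Omega_terms : seq (seq nat * bool) :=
  [:: ([:: 1; 2; 3; 4], false); ([:: 1; 2; 5; 6], false); ([:: 1; 2; 7; 8], false);
      ([:: 1; 3; 5; 7], false); ([:: 1; 3; 6; 8], true); ([:: 1; 4; 5; 8], true);
      ([:: 1; 4; 6; 7], true); ([:: 2; 3; 5; 8], true); ([:: 2; 3; 6; 7], true);
      ([:: 2; 4; 5; 7], true); ([:: 2; 4; 6; 8], false); ([:: 3; 4; 5; 6], false);
      ([:: 3; 4; 7; 8], false); ([:: 5; 6; 7; 8], false)]%N.

Definition same_indices (s : seq nat) (k l i j : nat) : bool :=
  all (fun m => (m \in [:: k; l; i; j]) == (m.+1 \in s)) (iota 0 8).
Arguments same_indices : simpl never.

(** The value of [Omega_coef] as a computable integer. *)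
Definition Omega_integer (k l i j : nat) : int :=
  if [&& k != i, k != j, l != i & l != j] then
    (-1) ^+ ((i < k)%N (+) (j < k)%N (+) ((i < l)%N (+) (j < l)%N)) *
    foldr (fun (t : seq nat * bool) (s : int) => (if same_indices t.1 k l i j then (-1) ^+ t.2 else 0) + s) 0 Omega_terms
  else 0.

Lemma Omega_sum S : Omega R S = \sum_(t <- Omega_terms) (-1) ^+ t.2 * dx R t.1 S.
Proof.
by rewrite ffunE /Omega_terms !big_cons big_nil /= !expr0 !expr1; ring.
Qed.

Lemma dx_pairs s (k l i j : 'I_8) :
  dx R s ([set k; l] :|: [set i; j]) =
  (same_indices s k l i j)%:R.
Proof.
rewrite ffunE; congr (nat_of_bool _)%:R; apply/eqP/allP => [/setP E m|H].
  rewrite mem_iota /= add0n => m8; have := E (Ordinal m8).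
  by rewrite !inE -!val_eqE /= -!orbA => ->.
apply/setP => m; have /H/eqP : val m \in iota 0 8 by rewrite mem_iota /= add0n.
by rewrite !inE -!val_eqE /= -!orbA.
Qed.

Lemma Omega_coefE (k l i j : 'I_8) : (k < l)%N -> (i < j)%N ->
  Omega_coef k l i j = (Omega_integer k l i j)%:~R.
Proof.
move=> kl ij; rewrite /Omega_coef disjoint_pairs -!val_eqE /= /Omega_integer.
case: ifP => // _; rewrite sign_pairs ?ltn_neq// Omega_sum rmorphM rmorphXn rmorphN1.
congr (_ * _); elim: Omega_terms => [|t ts IH]; first by rewrite big_nil.
rewrite big_cons IH /= rmorphD /=; congr (_ + _); rewrite dx_pairs.
by case: (same_indices _ _ _ _ _); rewrite ?mulr1 ?mulr0// rmorphXn rmorphN1.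
Qed.

(** The nonzero terms of the (i, j) component of the contraction of Omega with a 2-form. *)
Definition contraction_terms (i j : nat) : seq (int * nat * nat) :=
  [seq t <- [seq (Omega_integer k l i j, k, l) | k <- iota 0 8, l <- iota 0 8]
   | (t.1.2 < t.2)%N && (t.1.1 != 0)].

(** Indices in nat, for the tables below. *)
Definition entry L (i j : nat) : R := L (inord i) (inord j).

Lemma entryE L (i j : 'I_8) : L i j = entry L i j.
Proof. by rewrite /entry !inord_val. Qed.

Lemma contraction_equation L (i j : nat) ts : U' L -> (i < j < 8)%N ->
  contraction_terms i j = ts ->
  \sum_(t <- ts) t.1.1%:~R * entry L t.1.2 t.2 = 3 * entry L i j.
Proof.
move=> UL /andP[ij j8] <-; have i8 := ltn_trans ij j8.
rewrite /entry -(U'_contraction UL); last by rewrite !inordK.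
rewrite /contraction_terms big_filter big_mkcond big_allpairs_dep.
rewrite -[iota 0 8]/(index_iota 0 8) big_mkord; apply: eq_bigr => k _.
rewrite big_mkord [RHS]big_mkcond /=; apply: eq_bigr => l _.
case: ifPn => [/andP[kl _]|]; last first.
  rewrite negb_and negbK => /orP[/negbTE -> //|/eqP z].
  by case: ifP => // kl; rewrite Omega_coefE ?inordK// z mul0r.
by rewrite kl Omega_coefE ?inordK// !inord_val.
Qed.

End Spin7.

(** * The compatible complex structures in coordinates *)

Section Coordinates.
Context {R : realType}.
Implicit Types (L : 'M[R]_8).

(** The matrices of the seven-dimensional space of solutions of [contraction_equation], in
    terms of the first row c of the matrix. *)
Definition U_table (c : nat -> R) : seq (seq R) :=
  [:: [::     0%R;   c 1;   c 2;   c 3;   c 4;   c 5;   c 6;   c 7];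
      [:: - c 1;     0%R;   c 3; - c 2;   c 5; - c 4;   c 7; - c 6];
      [:: - c 2; - c 3;     0%R;   c 1;   c 6; - c 7; - c 4;   c 5];
      [:: - c 3;   c 2; - c 1;     0%R; - c 7; - c 6;   c 5;   c 4];
      [:: - c 4; - c 5; - c 6;   c 7;     0%R;   c 1;   c 2; - c 3];
      [:: - c 5;   c 4;   c 7;   c 6; - c 1;     0%R; - c 3; - c 2];
      [:: - c 6; - c 7;   c 4; - c 5; - c 2;   c 3;     0%R;   c 1];
      [:: - c 7;   c 6; - c 5; - c 4;   c 3;   c 2; - c 1;     0%R]]%N.

Definition U_entry (c : nat -> R) (i j : nat) : R :=
  nth 0 (nth [::] (U_table c) i) j.

Lemma U'_hermitian L : U' L -> hermitian_structure L.
Proof. by case=> theta [[]]. Qed.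

Lemma U'_skew L : U' L -> forall i j, L j i = - L i j.
Proof. by move/U'_hermitian; exact: hermitian_structure_skew. Qed.

(** Computes the coefficients of the equation of the pair (i, j) before it is used. *)
Ltac contraction_at UL i j :=
  let ts := eval vm_compute in (contraction_terms i j) in
  have := @contraction_equation _ _ i j ts UL isT erefl;
  rewrite !big_cons big_nil /= addr0.

(** The 28 equations fall into seven systems, one for each c, in the four entries that turn out to
    be equal up to sign. *)
Lemma U'_first_row L : U' L -> let e := entry L in let c := e 0%N in
  ([/\ e 2 3 = c 1, e 4 5 = c 1 & e 6 7 = c 1]
  /\ [/\ e 1 3 = - c 2, e 4 6 = c 2 & e 5 7 = - c 2]
  /\ [/\ e 1 2 = c 3, e 4 7 = - c 3 & e 5 6 = - c 3]
  /\ [/\ e 1 5 = - c 4, e 2 6 = - c 4 & e 3 7 = c 4]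
  /\ [/\ e 1 4 = c 5, e 2 7 = c 5 & e 3 6 = c 5]
  /\ [/\ e 1 7 = - c 6, e 2 4 = c 6 & e 3 5 = - c 6]
  /\ [/\ e 1 6 = c 7, e 2 5 = - c 7 & e 3 4 = - c 7])%N.
Proof.
move=> UL /=; 
split.
  contraction_at UL 0%N 1%N; contraction_at UL 2%N 3%N; contraction_at UL 4%N 5%N; contraction_at UL 6%N 7%N.
  by move=> e3 e2 e1 e0; split; lra.
split.
  contraction_at UL 0%N 2%N; contraction_at UL 1%N 3%N; contraction_at UL 4%N 6%N; contraction_at UL 5%N 7%N.
  by move=> e3 e2 e1 e0; split; lra.
split.
  contraction_at UL 0%N 3%N; contraction_at UL 1%N 2%N; contraction_at UL 4%N 7%N; contraction_at UL 5%N 6%N.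
  by move=> e3 e2 e1 e0; split; lra.
split.
  contraction_at UL 0%N 4%N; contraction_at UL 1%N 5%N; contraction_at UL 2%N 6%N; contraction_at UL 3%N 7%N.
  by move=> e3 e2 e1 e0; split; lra.
split.
  contraction_at UL 0%N 5%N; contraction_at UL 1%N 4%N; contraction_at UL 2%N 7%N; contraction_at UL 3%N 6%N.
  by move=> e3 e2 e1 e0; split; lra.
split.
  contraction_at UL 0%N 6%N; contraction_at UL 1%N 7%N; contraction_at UL 2%N 4%N; contraction_at UL 3%N 5%N.
  by move=> e3 e2 e1 e0; split; lra.
contraction_at UL 0%N 7%N; contraction_at UL 1%N 6%N; contraction_at UL 2%N 5%N; contraction_at UL 3%N 4%N.
by move=> e3 e2 e1 e0; split; lra.
Qed.

Lemma U'_entry L (i j : nat) : U' L -> (i < 8)%N -> (j < 8)%N ->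
  entry L i j = U_entry (entry L 0) i j.
Proof.
move=> UL; have sk a b : entry L a b = - entry L b a by exact: U'_skew.
have d a : entry L a a = 0 by have := sk a a; lra.
have [[? ? ?] [[? ? ?] [[? ? ?] [[? ? ?] [[? ? ?] [[? ? ?] [? ? ?]]]]]]] := U'_first_row UL.
do 8?[case: i => [|i] //]; do 8?[case: j => [|j] //]; move=> _ _; rewrite /U_entry /= ?d//.
all: first [by [] | by rewrite sk; congr (- _) | rewrite sk; lra].
Qed.

End Coordinates.

Section Clifford.
Context {R : realType}.
Implicit Types (L I : 'M[R]_8).

(** The Clifford relations of the seven-dimensional space, checked entry by entry. *)
Lemma U_entry_clifford (c d : nat -> R) (i j : nat) : (i < 8)%N -> (j < 8)%N ->
  \sum_(k <- iota 0 8) (U_entry c i k * U_entry d k j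
     + U_entry d i k * U_entry c k j)
  = (-2 * \sum_(k <- iota 1 7) c k * d k) *+ (i == j).
Proof.
rewrite [iota 0 8]/= [iota 1 7]/= !big_cons !big_nil.
do 8?[case: i => [|i] //]; do 8?[case: j => [|j] //]; move=> _ _; rewrite /U_entry /=.
all: rewrite ?mulr1n ?mulr0n; ring.
Qed.

Lemma U'_clifford L I : U' L -> U' I ->
  exists s, L *m I + I *m L = s%:M.
Proof.
move=> UL UI; exists (-2 * \sum_(k <- iota 1 7) entry L 0 k * entry I 0 k).
apply/matrixP => i j; rewrite !mxE -[i == j]/(val i == val j) -U_entry_clifford ?ltn_ord//.
rewrite -big_split -[iota 0 8]/(index_iota 0 8) big_mkord; apply: eq_bigr => k _.
by rewrite !entryE !U'_entry ?ltn_ord.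
Qed.

Definition list_half_square (e : nat -> nat -> R) (x : seq nat) : R :=
  if x is [:: p; q; r; s] then e p q * e r s - e p r * e q s + e p s * e q r else 0.

Definition list_inversions (x y : seq nat) : nat :=
  sumn [seq count (fun q => q < p)%N y | p <- x].

(** Self-duality of the square of omega_L for all subsets of {0, ..., 7} with four elements;
    the subset is given by its characteristic sequence so that it can be enumerated. *)
Lemma U_entry_self_dual (c : nat -> R) (bs : bitseq) :
  size bs = 8%N -> count id bs = 4%N ->
  let x := mask bs (iota 0 8) in let y := mask (map negb bs) (iota 0 8) in
  (-1) ^+ odd (list_inversions x y) * list_half_square (U_entry c) y
  = list_half_square (U_entry c) x.
Proof.
do 8!(case: bs => [//|[] bs]).
all: case: bs => // _; rewrite /= ?add0n ?addn0; try by [].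
all: move=> _; rewrite /list_inversions /U_entry /= ?expr0 ?expr1.
all: ring.
Qed.

Lemma indices_filter (T : {set 'I_8}) :
  [seq val i | i <- enum T] = [seq n <- iota 0 8 | inord n \in T].
Proof.
rewrite -val_enum_ord filter_map; congr map; rewrite enumT; apply: eq_filter => i /=.
by rewrite inord_val.
Qed.

Lemma inversions_list (T U : {set 'I_8}) :
  inversions T U = list_inversions [seq val i | i <- enum T] [seq val i | i <- enum U].
Proof.
rewrite inversionsE /list_inversions sumnE -map_comp big_map -big_enum /=.
apply: eq_bigr => p _ /=; rewrite -big_enum /= count_map -sum1_count [RHS]big_mkcond.
by apply: eq_bigr => q _ /=; case: ltnP.
Qed.

Lemma kahler_square_list L (T : {set 'I_8}) : (forall i j, L j i = - L i j) -> #|T| = 4%N ->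
  wedge (kahler L) (kahler L) T = 2 * list_half_square (entry L) [seq val i | i <- enum T].
Proof.
move=> sk; rewrite cardE.
have : sorted ltn [seq val i | i <- enum T].
  rewrite indices_filter; apply: sorted_filter; last exact: iota_ltn_sorted.
  exact: ltn_trans.
have : T = [set i in enum T] by apply/setP => i; rewrite inE mem_enum.
case: (enum T) => [|p [|q [|r [|s [|? ?]]]]] // TE /and4P[pq qr rs _] _ /=.
have -> : T = [set p; q; r; s] by rewrite TE; apply/setP => i; rewrite !inE -!orbA.
have {}pq : (p < q)%N := pq; have {}qr : (q < r)%N := qr; have {}rs : (r < s)%N := rs.
have K (i j : 'I_8) : (i < j)%N -> kahler L [set i; j] = entry L i j.
  by move=> ij; rewrite -coef2_lt// coef2_kahler// entryE.
rewrite wedge_sorted ?pq ?qr//; last exact: kahler_homogeneous.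
rewrite !K ?(ltn_trans pq qr, ltn_trans qr rs, ltn_trans pq (ltn_trans qr rs))//; ring.
Qed.

(** The subset T is translated into its characteristic sequence, for which [U_entry_self_dual]
    does the computation. *)
Lemma U'_self_dual L (T : {set 'I_8}) : U' L -> #|T| = 4%N ->
  (-1) ^+ inversions T (~: T) * wedge (kahler L) (kahler L) (~: T)
  = wedge (kahler L) (kahler L) T.
Proof.
move=> UL T4; have sk := U'_skew UL.
have C4 : #|~: T| = 4%N by rewrite cardsCs card_ord finset.setCK T4.
rewrite !kahler_square_list// inversions_list mulrCA; congr (2 * _).
have xE (S : {set 'I_8}) : list_half_square (entry L) [seq val i | i <- enum S]
    = list_half_square (U_entry (entry L 0)) [seq val i | i <- enum S].
  by case: (enum S) => [|p [|q [|r [|s [|? ?]]]]] //=; rewrite !U'_entry ?ltn_ord.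
pose bs := [seq inord n \in T | n <- iota 0 8].
have := @U_entry_self_dual (entry L 0) bs.
have -> : mask bs (iota 0 8) = [seq val i | i <- enum T].
  by rewrite indices_filter filter_mask.
have -> : mask (map negb bs) (iota 0 8) = [seq val i | i <- enum (~: T)].
  by rewrite indices_filter filter_mask -map_comp; congr mask; apply: eq_map => n /=; rewrite inE.
cbv zeta; rewrite -!xE signr_odd; apply; first by rewrite size_map size_iota.
by rewrite count_map -size_filter -indices_filter size_map -cardE.
Qed.

(** Self-duality turns the top coefficient of the wedge product into an inner product. *)
Lemma wedge_kahler_square (c : form R) L : U' L ->
  (forall T : {set 'I_8}, #|T| != 4%N -> c T = 0) ->
  wedge c (wedge (kahler L) (kahler L)) [set: 'I_8]
  = \sum_(T : {set 'I_8}) c T * wedge (kahler L) (kahler L) T.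
Proof.
move=> UL c0; rewrite ffunE; under eq_bigl do rewrite finset.subsetT.
apply: eq_bigr => T _; rewrite finset.setTD.
have [/eqP T4|T4] := boolP (#|T| == 4%N); last by rewrite c0// !mul0r mulr0.
by rewrite mulrCA U'_self_dual.
Qed.

End Clifford.

(** * Forms of type (1,1) and primitive forms *)

Section Types.
Context {R : realType}.
Implicit Types (L I : 'M[R]_8) (a : form R[i]) (A X Y N : 'M[R[i]]_8).

Notation cx := (map_mx (real_complex R)).

(** Contracting with w first evaluates a at (w, v). *)
Lemma contract2 a (v w : 'rV[R[i]]_8) :
  contract v (contract w a) finset.set0 = - (v *m coef2 a *m w^T) 0 0.
Proof.
transitivity (- \sum_k \sum_l v 0 k * coef2 a k l * w 0 l); last first.
  congr (- _); rewrite mxE exchange_big; apply: eq_bigr => l _ /=.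
  by rewrite !mxE mulr_suml; apply: eq_bigr => k _.
rewrite ffunE -sumrN; under eq_bigl do rewrite inE.
apply: eq_bigr => k _; rewrite -[#|_|]/(position k finset.set0).
have -> : position k finset.set0 = 0%N.
  by apply/eqP; rewrite cards_eq0; apply/eqP/setP => j; rewrite !inE.
rewrite expr0 mul1r finset.setU0 ffunE mulr_sumr -sumrN big_mkcond /=.
apply: eq_bigr => l _; rewrite !inE.
have -> : #|[set j in [set k] | (j < l)%N]| = (k < l)%N.
  case: (ltnP k l) => kl; last first.
    apply/eqP; rewrite cards_eq0; apply/eqP/setP => j; rewrite !inE.
    by case: eqVneq => //= ->; rewrite ltnNge kl.
  rewrite (_ : [set j in _ | _] = [set k]) ?cards1//; apply/setP => j; rewrite !inE.
  by case: eqVneq => //= ->; rewrite kl.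
rewrite (finset.setUC [set l] [set k]) mxE -val_eqE /=; case: ltngtP => //= lk.
- by rewrite expr1; ring.
- by rewrite expr0; ring.
- by rewrite mulr0 mul0r oppr0.
Qed.

Lemma contract2_eq0 a (v w : 'rV[R[i]]_8) (S : {set 'I_8}) : homogeneous 2 a ->
  S != finset.set0 -> contract v (contract w a) S = 0.
Proof.
move=> ha S0; rewrite ffunE big1// => k kS; rewrite ffunE big1 ?mulr0// => l lS.
rewrite ha ?mulr0// cardsU1 lS cardsU1 kS !add1n !eqSS cards_eq0 //.
Qed.

Lemma kahler_square1 L : L *m L = - 1%:M -> cx L *m cx L = - 1%:M.
Proof. by move=> LL; rewrite -map_mxM LL map_mxN map_mx1. Qed.

(** The rows of 1 - 'i M and 1 + 'i M span the vectors of type (1,0) and (0,1), respectively.  The sum of the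
    two vanishing conditions is a(v, w) = a(v M, w M); conversely this forces
    a(v, w) = - a(v, w) for vectors of the same type. *)
Lemma has_type11P L a : L *m L = - 1%:M ->
  has_type L 1 1 a <-> homogeneous 2 a /\ cx L *m coef2 a *m (cx L)^T = coef2 a.
Proof.
move=> LL; have MM := kahler_square1 LL; set M := cx L; set A := coef2 a.
have ii : 'i * 'i = -1 :> R[i] by rewrite -expr2 sqrCi.
split=> [[ha h1 h2]|[ha MA]].
  split => //.
  have col (N : 'M[R[i]]_8) : (forall k l, contract (row k N) (contract (row l N) a) finset.set0 = 0) ->
      N *m A *m N^T = 0.
    move=> h; apply/matrixP => k l; rewrite [RHS]mxE -[RHS]oppr0 -[in RHS](h k l).
    rewrite contract2 opprK -row_mul tr_row [LHS]mxE [RHS]mxE; apply: eq_bigr => m _.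
    by rewrite [row _ _ _ _]mxE [col _ _ _ _]mxE.
  have v10 k : vector10 L (row k (1%:M - 'i *: M)).
    rewrite /vector10 -row_mul.
    transitivity (row k ('i *: (1%:M - 'i *: M))); last by rewrite linearZ.
    congr row.
    rewrite -/M mulmxBl mul1mx -scalemxAl MM scalerBr scalerA ii.
    by rewrite scalerN opprK scaleN1r opprK addrC.
  have v01 k : vector01 L (row k (1%:M + 'i *: M)).
    rewrite /vector01 -row_mul.
    transitivity (row k (- 'i *: (1%:M + 'i *: M))); last by rewrite linearZ.
    congr row.
    rewrite -/M mulmxDl mul1mx -scalemxAl MM scalerDr scalerA mulNr ii.
    by rewrite scalerN scaleNr opprK scale1r addrC.
  have e1 : (1%:M - 'i *: M) *m A *m (1%:M - 'i *: M)^T = 0.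
    apply: col => k l; have := h1 [:: row k _; row l _] erefl; apply => w.
    by rewrite !inE => /orP[]/eqP ->.
  have e2 : (1%:M + 'i *: M) *m A *m (1%:M + 'i *: M)^T = 0.
    apply: col => k l; have := h2 [:: row k _; row l _] erefl; apply => w.
    by rewrite !inE => /orP[]/eqP ->.
  have two0 : 2 != 0 :> R[i] by rewrite pnatr_eq0.
  apply/eqP; rewrite eq_sym -subr_eq0; apply/eqP; apply: (scalerI two0); rewrite scaler0.
  transitivity ((1%:M - 'i *: M) *m A *m (1%:M - 'i *: M)^T
     + (1%:M + 'i *: M) *m A *m (1%:M + 'i *: M)^T); last by rewrite e1 e2 addr0.
  have -> : (1%:M - 'i *: M)^T = 1%:M - 'i *: M^T.
    by apply/matrixP => i j; rewrite !mxE eq_sym.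
  have -> : (1%:M + 'i *: M)^T = 1%:M + 'i *: M^T.
    by apply/matrixP => i j; rewrite !mxE eq_sym.
  rewrite !mulmxBl !mulmxDl !mulmxBr !mulmxDr !mul1mx !mulmx1.
  rewrite -!scalemxAl -!scalemxAr !scalerA ii scaleN1r -mulmxA.
  set P := A *m _; set Q := M *m A; set T := M *m _; clearbody P Q T.
  by apply/matrixP => i j; rewrite !mxE; ring.
(* c is 'i for vectors of type (1, 0) and - 'i for vectors of type (0, 1) *)
have anti (v w : 'rV[R[i]]_8) (c : R[i]) : c * c = -1 -> v *m M = c *: v -> w *m M = c *: w ->
    contract v (contract w a) finset.set0 = 0.
  move=> cc hv hw; rewrite contract2 -/A.
  have : v *m A *m w^T = - (v *m A *m w^T).
    rewrite -{1}MA !mulmxA hv -!mulmxA -trmx_mul hw.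
    have -> : (c *: w)^T = c *: w^T by apply/matrixP => i j; rewrite !mxE.
    by rewrite -scalemxAl -!scalemxAr scalerA cc scaleN1r.
  move/(congr1 (fun N : 'M[R[i]]_1 => N 0 0)); rewrite [RHS]mxE => /eqP.
  by rewrite -subr_eq0 opprK -mulr2n mulrn_eq0 /= => /eqP ->; rewrite oppr0.
split => //= [[|v [|w []]] //= _ h S|[|v [|w []]] //= _ h S].
  have [->|S0] := eqVneq S finset.set0; last exact: contract2_eq0.
  by apply: (anti v w ('i) ii); apply: h; rewrite !inE eqxx ?orbT.
have [->|S0] := eqVneq S finset.set0; last exact: contract2_eq0.
by apply: (anti v w (- ('i))); rewrite ?mulrNN//; apply: h; rewrite !inE eqxx ?orbT.
Qed.

Lemma frobeniusE X Y : frobenius X Y = \tr (X *m Y^T).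
Proof.
by rewrite /mxtrace; apply: eq_bigr => i _; rewrite mxE; apply: eq_bigr => j _; rewrite mxE.
Qed.

Lemma frobenius_adjoint X Y N : frobenius X (N *m Y *m N^T) = frobenius (N^T *m X *m N) Y.
Proof.
by rewrite !frobeniusE !trmx_mul trmxK -!mulmxA [RHS]mxtrace_mulC -!mulmxA.
Qed.

(** By [U'_clifford], I^T L I = - s I - L.  As A is invariant under I, its pairing with L is the
    opposite of itself, up to a multiple of its pairing with I. *)
Lemma U'_primitive L I A : U' L -> U' I ->
  cx I *m A *m (cx I)^T = A -> frobenius (cx I) A = 0 -> frobenius (cx L) A = 0.
Proof.
move=> UL UI IA I0; have [s LI] := U'_clifford UL UI.
have [II _] := U'_hermitian UI; have skI := U'_skew UI.
have It : (cx I)^T = - cx I by apply/matrixP => i j; rewrite !mxE skI rmorphN.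
have E : (cx I)^T *m cx L *m cx I = - s%:C *: cx I - cx L.
  have LI' : cx L *m cx I = s%:C%:M - cx I *m cx L.
    have /(congr1 cx) := LI; rewrite map_mxD !map_mxM map_scalar_mx /= => <-.
    by rewrite addrK.
  rewrite -mulmxA LI' It mulmxBr mulmxA !mulNmx kahler_square1// opprK mul_mx_scalar.
  by rewrite mulNmx mul1mx scaleNr.
have := congr1 (frobenius (cx L)) IA; rewrite frobenius_adjoint E => h.
have lin : frobenius (- s%:C *: cx I - cx L) A = - s%:C * frobenius (cx I) A - frobenius (cx L) A.
  rewrite mulr_sumr -sumrB; apply: eq_bigr => i _; rewrite mulr_sumr -sumrB.
  by apply: eq_bigr => j _; rewrite !mxE; ring.
move: h; rewrite lin I0 mulr0 sub0r => /eqP.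
by rewrite eq_sym -subr_eq0 opprK -mulr2n mulrn_eq0 /= => /eqP.
Qed.

Definition sqnorm A : R := \sum_i \sum_j (complex.Re (A i j) ^+ 2 + complex.Im (A i j) ^+ 2).

Lemma sqnorm_ge0 A : 0 <= sqnorm A.
Proof. by apply: sumr_ge0 => i _; apply: sumr_ge0 => j _; rewrite addr_ge0 ?sqr_ge0. Qed.

Lemma sqnorm_eq0 A : sqnorm A = 0 -> A = 0.
Proof.
have pos i j : 0 <= complex.Re (A i j) ^+ 2 + complex.Im (A i j) ^+ 2.
  by rewrite addr_ge0 ?sqr_ge0.
move/eqP; rewrite psumr_eq0 => [|i _]; last by apply: sumr_ge0.
move/allP => h; apply/matrixP => i j; have := h i (mem_index_enum i).
rewrite /= psumr_eq0// => /allP/(_ j (mem_index_enum j)) /=.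
rewrite paddr_eq0 ?sqr_ge0// !sqrf_eq0 mxE => /andP[/eqP h1 /eqP h2].
by move: h1 h2; case: (A i j) => a' b' /= -> ->.
Qed.

Notation conj := (map_mx (@conjc R)).

(** Polarization: X and its transform by the orthogonal matrix N have the same norm. *)
Lemma frobenius_distance X N : N^T *m N = 1%:M -> conj N = N ->
  complex.Re (frobenius X (conj X)) - complex.Re (frobenius X (N *m conj X *m N^T))
  = sqnorm (X - N *m X *m N^T) / 2.
Proof.
move=> NN cN; set Y := N *m X *m N^T.
have cY : N *m conj X *m N^T = conj Y by rewrite /Y !map_mxM -map_trmx cN.
rewrite cY.
have YY : frobenius Y (conj Y) = frobenius X (conj X).
  rewrite -cY frobenius_adjoint /Y !mulmxA NN mul1mx -mulmxA NN mulmx1 //.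
have re (Z T : 'M[R[i]]_8) : complex.Re (frobenius Z (conj T)) = \sum_i \sum_j
    (complex.Re (Z i j) * complex.Re (T i j) + complex.Im (Z i j) * complex.Im (T i j)).
  rewrite raddf_sum; apply: eq_bigr => i _; rewrite raddf_sum; apply: eq_bigr => j _.
  by rewrite mxE; case: (Z i j) (T i j) => z1 z2 [t1 t2] /=; ring.
have two0 : 2 != 0 :> R by rewrite pnatr_eq0.
apply: (mulIf two0); rewrite divfK//.
transitivity (complex.Re (frobenius X (conj X)) + complex.Re (frobenius Y (conj Y))
   - 2 * complex.Re (frobenius X (conj Y))); first by rewrite YY; ring.
clearbody Y.
rewrite !re mulr_sumr -big_split -sumrB; apply: eq_bigr => i _ /=.
rewrite mulr_sumr -big_split -sumrB; apply: eq_bigr => j _ /=.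
by rewrite !mxE; case: (X i j) (Y i j) => x1 x2 [y1 y2] /=; ring.
Qed.

End Types.

(** * Derivatives of complex matrix-valued functions *)

Section ComplexCalculus.
Local Open Scope classical_set_scope.
Context {R : realType}.
Implicit Types (x : 'rV[R]_8) (k : 'I_8).

Section Real.
Implicit Types f g : 'rV[R]_8 -> R.

Lemma derivative_cst (a : R) x v : is_derive x v (fun _ : 'rV[R]_8 => a) 0.
Proof. exact: is_derive_cst. Qed.

Lemma derivativeN f x v df : is_derive x v f df -> is_derive x v (fun y => - f y) (- df).
Proof. exact: is_deriveN. Qed.

Lemma derivativeD f g x v df dg : is_derive x v f df -> is_derive x v g dg ->
  is_derive x v (fun y => f y + g y) (df + dg).
Proof. exact: is_deriveD. Qed.

Lemma derivativeM f g x v df dg : is_derive x v f df -> is_derive x v g dg ->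
  is_derive x v (fun y => f y * g y) (df * g x + f x * dg).
Proof.
move=> hf hg; rewrite (_ : (fun y => _) = f * g)//.
by apply: is_derive_eq; rewrite /GRing.scale /= addrC [g x * _]mulrC.
Qed.
End Real.

(** Carrying the value of the derivative makes the product rules composable. *)
Definition is_partialC k (f : 'rV[R]_8 -> R[i]) x (d : R[i]) : Prop :=
  is_derive x (delta_mx 0 k) (fun y => complex.Re (f y)) (complex.Re d) /\
  is_derive x (delta_mx 0 k) (fun y => complex.Im (f y)) (complex.Im d).

Definition is_partialM m n k (f : 'rV[R]_8 -> 'M[R[i]]_(m, n)) x (D : 'M[R[i]]_(m, n)) :=
  forall a b, is_partialC k (fun y => f y a b) x (D a b).

Lemma is_partialC_val k f x d : is_partialC k f x d -> partialC k f x = d.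
Proof. by case: d => u v [] [_ /= h1] [_ /= h2]; rewrite /partialC /partial h1 h2. Qed.

Lemma is_partialM_val m n k (f : 'rV[R]_8 -> 'M[R[i]]_(m, n)) x D :
  is_partialM k f x D -> partialM k f x = D.
Proof. by move=> h; apply/matrixP => a b; rewrite mxE (is_partialC_val (h a b)). Qed.

Lemma is_partialC_near k (f g : 'rV[R]_8 -> R[i]) x d : (\forall y \near x, f y = g y) ->
  is_partialC k f x d -> is_partialC k g x d.
Proof.
move=> fg [h1 h2]; split.
  by apply: near_eq_is_derive h1; apply: filterS fg => y ->.
by apply: near_eq_is_derive h2; apply: filterS fg => y ->.
Qed.

Lemma is_partialM_near m n k (f g : 'rV[R]_8 -> 'M[R[i]]_(m, n)) x D :
  (\forall y \near x, f y = g y) -> is_partialM k f x D -> is_partialM k g x D.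
Proof.
move=> fg h a b; apply: is_partialC_near (h a b).
by apply: filterS fg => y ->.
Qed.

Lemma is_partialC_cst k (c : R[i]) x : is_partialC k (fun=> c) x 0.
Proof. by split; exact: derivative_cst. Qed.

Lemma is_partialCD k (f g : 'rV[R]_8 -> R[i]) x df dg :
  is_partialC k f x df -> is_partialC k g x dg ->
  is_partialC k (fun y => f y + g y) x (df + dg).
Proof.
move=> [f1 f2] [g1 g2]; split; rewrite raddfD.
  rewrite (_ : (fun y => _) = fun y => complex.Re (f y) + complex.Re (g y)).
    exact: derivativeD.
  by apply/funext => y; rewrite raddfD.
rewrite (_ : (fun y => _) = fun y => complex.Im (f y) + complex.Im (g y)).
  exact: derivativeD.
by apply/funext => y; rewrite raddfD.
Qed.

Lemma is_partialCN k (f : 'rV[R]_8 -> R[i]) x df :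
  is_partialC k f x df -> is_partialC k (fun y => - f y) x (- df).
Proof.
move=> [f1 f2]; split; rewrite raddfN.
  rewrite (_ : (fun y => _) = fun y => - complex.Re (f y)).
    exact: derivativeN.
  by apply/funext => y; rewrite raddfN.
rewrite (_ : (fun y => _) = fun y => - complex.Im (f y)).
  exact: derivativeN.
by apply/funext => y; rewrite raddfN.
Qed.

Lemma is_partialC_conj k (f : 'rV[R]_8 -> R[i]) x df :
  is_partialC k f x df -> is_partialC k (fun y => conjc (f y)) x (conjc df).
Proof.
have Re_conj (z : R[i]) : complex.Re (conjc z) = complex.Re z by case: z.
have Im_conj (z : R[i]) : complex.Im (conjc z) = - complex.Im z by case: z.
move=> [f1 f2]; split.
  rewrite Re_conj (_ : (fun y => _) = fun y => complex.Re (f y))//.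
  by apply/funext => y; rewrite Re_conj.
rewrite Im_conj (_ : (fun y => _) = fun y => - complex.Im (f y)).
  exact: derivativeN.
by apply/funext => y; rewrite Im_conj.
Qed.

Lemma complex_ReD (u v : R[i]) : complex.Re (u + v) = complex.Re u + complex.Re v.
Proof. exact: raddfD. Qed.

Lemma complex_ImD (u v : R[i]) : complex.Im (u + v) = complex.Im u + complex.Im v.
Proof. exact: raddfD. Qed.

Lemma complex_ReM (u v : R[i]) : complex.Re (u * v)
  = complex.Re u * complex.Re v - complex.Im u * complex.Im v.
Proof. by case: u v => ? ? [? ?]. Qed.

Lemma complex_ImM (u v : R[i]) : complex.Im (u * v)
  = complex.Re u * complex.Im v + complex.Im u * complex.Re v.
Proof. by case: u v => ? ? [? ?]. Qed.

Lemma is_partialCM k (f g : 'rV[R]_8 -> R[i]) x df dg :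
  is_partialC k f x df -> is_partialC k g x dg ->
  is_partialC k (fun y => f y * g y) x (df * g x + f x * dg).
Proof.
move=> [f1 f2] [g1 g2]; split.
  rewrite (_ : (fun y => _) = fun y => complex.Re (f y) * complex.Re (g y)
      + - (complex.Im (f y) * complex.Im (g y))).
    apply: is_derive_eq (derivativeD (derivativeM f1 g1) (derivativeN (derivativeM f2 g2))) _.
    by rewrite complex_ReD !complex_ReM; ring.
  by apply/funext => y; rewrite complex_ReM.
rewrite (_ : (fun y => _) = fun y => complex.Re (f y) * complex.Im (g y)
      + complex.Im (f y) * complex.Re (g y)).
  apply: is_derive_eq (derivativeD (derivativeM f1 g2) (derivativeM f2 g1)) _.
  by rewrite complex_ImD !complex_ImM; ring.
by apply/funext => y; rewrite complex_ImM.
Qed.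

Lemma is_partialC_sum k (I : Type) (r : seq I) (f : I -> 'rV[R]_8 -> R[i]) x df :
  (forall i, is_partialC k (f i) x (df i)) ->
  is_partialC k (fun y => \sum_(i <- r) f i y) x (\sum_(i <- r) df i).
Proof.
move=> h; elim: r => [|i r IH].
  rewrite big_nil (_ : (fun y => _) = fun=> 0); first exact: is_partialC_cst.
  by apply/funext => y; rewrite big_nil.
rewrite big_cons (_ : (fun y => _) = fun y => f i y + \sum_(j <- r) f j y).
  exact: is_partialCD.
by apply/funext => y; rewrite big_cons.
Qed.

(** The order of the factors matters, as in the product rules for matrices. *)
Lemma is_partialMM m n p k (f : 'rV[R]_8 -> 'M[R[i]]_(m, n))
    (g : 'rV[R]_8 -> 'M[R[i]]_(n, p)) x df dg :
  is_partialM k f x df -> is_partialM k g x dg ->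
  is_partialM k (fun y => f y *m g y) x (df *m g x + f x *m dg).
Proof.
move=> hf hg a b; rewrite !mxE -big_split /=.
rewrite (_ : (fun y => _) = fun y => \sum_j f y a j * g y j b).
  by apply: is_partialC_sum => j; exact: is_partialCM.
by apply/funext => y; rewrite mxE.
Qed.

Lemma is_partialMD m n k (f g : 'rV[R]_8 -> 'M[R[i]]_(m, n)) x df dg :
  is_partialM k f x df -> is_partialM k g x dg ->
  is_partialM k (fun y => f y + g y) x (df + dg).
Proof.
move=> hf hg a b; rewrite !mxE (_ : (fun y => _) = fun y => f y a b + g y a b).
  exact: is_partialCD.
by apply/funext => y; rewrite mxE.
Qed.

Lemma is_partialMN m n k (f : 'rV[R]_8 -> 'M[R[i]]_(m, n)) x df :
  is_partialM k f x df -> is_partialM k (fun y => - f y) x (- df).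
Proof.
move=> hf a b; rewrite !mxE (_ : (fun y => _) = fun y => - f y a b).
  exact: is_partialCN.
by apply/funext => y; rewrite mxE.
Qed.

Lemma is_partialM_adjoint r k (f : 'rV[R]_8 -> 'M[R[i]]_r) x df :
  is_partialM k f x df -> is_partialM k (fun y => adjoint (f y)) x (adjoint df).
Proof.
move=> hf a b; rewrite !mxE (_ : (fun y => _) = fun y => conjc (f y b a)).
  exact: is_partialC_conj.
by apply/funext => y; rewrite !mxE.
Qed.

Lemma smoothC_partial (U : set 'rV[R]_8) f x k : smoothC U f -> U x ->
  is_partialC k f x (partialC k f x).
Proof.
move=> [h1 h2] Ux; split; apply: derivableP.
  by have [_ /(_ k)[+ _]] := h1 1%N; exact.
by have [_ /(_ k)[+ _]] := h2 1%N; exact.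
Qed.

Lemma smoothM_partial m n (U : set 'rV[R]_8) (f : 'rV[R]_8 -> 'M[R[i]]_(m, n)) x k :
  smoothM U f -> U x -> is_partialM k f x (partialM k f x).
Proof. by move=> sf Ux a b; rewrite mxE; apply: (smoothC_partial _ (sf a b) Ux). Qed.

Lemma smooth_partial (U : set 'rV[R]_8) f k : smooth U f -> smooth U (partial k f).
Proof. by move=> sf n; have [_ /(_ k)[_]] := sf n.+1. Qed.

Lemma smooth_continuous (U : set 'rV[R]_8) f x : smooth U f -> U x -> {for x, continuous f}.
Proof. by move=> sf Ux; have [+ _] := sf 0%N; exact. Qed.

Lemma smooth_derivable (U : set 'rV[R]_8) f x k : smooth U f -> U x ->
  derivable f x (delta_mx 0 k).
Proof. by move=> sf Ux; have [_ /(_ k)[+ _]] := sf 1%N; exact. Qed.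

Lemma smooth_partialC (U : set 'rV[R]_8) f k : smoothC U f -> smoothC U (partialC k f).
Proof. by move=> [h1 h2]; split; exact: smooth_partial. Qed.

Lemma smooth_partialM m n (U : set 'rV[R]_8) (f : 'rV[R]_8 -> 'M[R[i]]_(m, n)) k :
  smoothM U f -> smoothM U (partialM k f).
Proof.
move=> sf a b; rewrite (_ : (fun x => _) = partialC k (fun y => f y a b)).
  exact: smooth_partialC.
by apply/funext => x; rewrite mxE.
Qed.

Lemma partial_commute (U : set 'rV[R]_8) f x k l : open U -> smooth U f -> U x ->
  partial k (partial l f) x = partial l (partial k f) x.
Proof.
move=> oU sf Ux; apply: (@mixed_derivatives_commute _ _ f x _ _ U oU Ux).
- by move=> y Uy; exact: smooth_derivable Uy.
- by move=> y Uy; exact: smooth_derivable Uy.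
- by move=> y Uy; exact: (@smooth_derivable U (partial l f) y k (smooth_partial l sf) Uy).
- by move=> y Uy; exact: (@smooth_derivable U (partial k f) y l (smooth_partial k sf) Uy).
- exact: (@smooth_continuous U (partial k (partial l f)) x (smooth_partial k (smooth_partial l sf)) Ux).
- exact: (@smooth_continuous U (partial l (partial k f)) x (smooth_partial l (smooth_partial k sf)) Ux).
Qed.

Lemma partialM_commute m n (U : set 'rV[R]_8) (f : 'rV[R]_8 -> 'M[R[i]]_(m, n)) x k l :
  open U -> smoothM U f -> U x ->
  partialM k (partialM l f) x = partialM l (partialM k f) x.
Proof.
move=> oU sf Ux; apply/matrixP => a b; rewrite [LHS]mxE [RHS]mxE.
have E j : (fun y => partialM j f y a b) = partialC j (fun y => f y a b).
  by apply/funext => y; rewrite mxE.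
rewrite (E l) (E k) /partialC /=; have [s1 s2] := sf a b.
by rewrite (partial_commute k l oU s1 Ux) (partial_commute k l oU s2 Ux).
Qed.

End ComplexCalculus.

(** * Curvature in local frames *)

Lemma sum_singletons (V : nmodType) (G : {set 'I_8} -> V) :
  (forall U : {set 'I_8}, #|U| != 1%N -> G U = 0) ->
  \sum_U G U = \sum_(i < 8) G [set i].
Proof.
move=> G0; transitivity (\sum_U \sum_(i < 8 | U == [set i]) G U).
  apply: eq_bigr => U _; have [/cards1P[i ->]|U1] := boolP (#|U| == 1%N).
    rewrite (eq_bigl (pred1 i)) ?big_pred1_eq// => j /=.
    by rewrite eq_sym; apply/eqP/eqP => [/finset.set1_inj//|->].
  by rewrite big1 ?G0// => i _; rewrite G0.
under eq_bigr do rewrite big_mkcond.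
by rewrite exchange_big; apply: eq_bigr => i _; rewrite -big_mkcond /= big_pred1_eq.
Qed.

Lemma subset1_pair (i k l : 'I_8) : ([set i] \subset [set k; l]) = (i == k) || (i == l).
Proof. by rewrite finset.sub1set !inE. Qed.

Lemma pairD1 (k l : 'I_8) : k != l -> [set k; l] :\ k = [set l].
Proof.
move=> kl; apply/setP => m; rewrite !inE; case: (eqVneq m k) => [->|] //=.
by rewrite (negbTE kl).
Qed.

Lemma wedge_pair (K : pzRingType) (a b : form K) (k l : 'I_8) :
  homogeneous 1 a -> (k < l)%N ->
  wedge a b [set k; l] = a [set k] * b [set l] - a [set l] * b [set k].
Proof.
move=> ha kl; have nkl := ltn_neq kl.
rewrite ffunE big_mkcond sum_singletons /= => [|U U1]; last first.
  by rewrite ha// mul0r mulr0; case: ifP.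
rewrite (bigD1 k)//= (bigD1 l) /=; last by rewrite eq_sym.
rewrite big1 ?addr0 => [|i /andP[ik il]]; last first.
  by rewrite subset1_pair (negbTE ik) (negbTE il).
rewrite !subset1_pair !eqxx orbT /= pairD1// (finset.setUC [set k]) pairD1; last by rewrite eq_sym.
rewrite !inversionsE !big_set1 kl [(l < k)%N]ltnNge (ltnW kl) /= expr0 mul1r expr1 mulN1r //.
Qed.

Lemma ext_d_pair (R : realType) (K : pzRingType)
    (D : 'I_8 -> ('rV[R]_8 -> K) -> 'rV[R]_8 -> K) (a : 'rV[R]_8 -> form K) x (k l : 'I_8) :
  (k < l)%N ->
  ext_d D a x [set k; l] = D k (fun y => a y [set l]) x - D l (fun y => a y [set k]) x.
Proof.
move=> kl; have nkl := ltn_neq kl; rewrite ffunE big_setU1 ?inE//= big_set1.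
rewrite pairD1// (finset.setUC [set k]) pairD1; last by rewrite eq_sym.
have -> : #|[set j in [set l; k] | (j < k)%N]| = 0%N.
  apply/eqP; rewrite cards_eq0; apply/eqP/setP => j; rewrite !inE.
  case: (eqVneq j l) => [->|_] /=; first by rewrite ltnNge (ltnW kl).
  by case: eqVneq => //= ->; rewrite ltnn.
have -> : #|[set j in [set l; k] | (j < l)%N]| = 1%N.
  rewrite (_ : [set j in _ | _] = [set k]) ?cards1//; apply/setP => j; rewrite !inE.
  case: (eqVneq j l) => [->|_] /=; first by rewrite ltnn eq_sym (negbTE nkl).
  by case: eqVneq => //= ->; rewrite kl.
by rewrite expr0 mul1r expr1 mulN1r.
Qed.

Section Curvature.
Context {R : realType} {B : 'M[R]_8} {r : nat} {E : hermitian_bundle B r}.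
Variable A : hermitian_connection E.
Implicit Types (c : chart E) (x : 'rV[R]_8) (k l : 'I_8).

Definition component c k : 'rV[R]_8 -> 'M[R[i]]_r := fun y => conn A c y [set k].

Lemma curvature_pair c x k l : dom c x -> (k < l)%N ->
  curvature A c x [set k; l] =
  partialM k (component c l) x - partialM l (component c k) x
  + (component c k x *m component c l x - component c l x *m component c k x).
Proof.
by move=> cx kl; rewrite ffunE ext_d_pair// wedge_pair//; exact: conn_degree.
Qed.

Lemma component_partial c x k l : dom c x ->
  is_partialM k (component c l) x (partialM k (component c l) x).
Proof. by move=> cx; apply: smoothM_partial cx; exact: conn_smooth. Qed.

Lemma near_dom c x : dom c x -> \forall y \near x, dom c y.
Proof. by move=> cx; apply: open_nbhs_nbhs; split => //; exact: dom_open. Qed.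

(** The noncommutative identity behind the gauge covariance of the curvature: P and Q stand for
    the derivatives of the two connection forms a and b, G and H for those of g. *)
Let gauge_algebra n (ak al bk bl g Pkl Plk Qkl Qlk H Gk Gl : 'M[R[i]]_n) :
  ak *m g = g *m bk - Gk -> al *m g = g *m bl - Gl ->
  Pkl *m g + al *m Gk = Gk *m bl + g *m Qkl - H ->
  Plk *m g + ak *m Gl = Gl *m bk + g *m Qlk - H ->
  (Pkl - Plk + (ak *m al - al *m ak)) *m g
  = g *m (Qkl - Qlk + (bk *m bl - bl *m bk)).
Proof.
move=> hk hl ekl elk.
have {}ekl : Pkl *m g = Gk *m bl + g *m Qkl - H - al *m Gk by rewrite -ekl addrK.
have {}elk : Plk *m g = Gl *m bk + g *m Qlk - H - ak *m Gl by rewrite -elk addrK.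
have {}hk : Gk = g *m bk - ak *m g by rewrite hk opprB addrC subrK.
have {}hl : Gl = g *m bl - al *m g by rewrite hl opprB addrC subrK.
rewrite !mulmxDl !mulNmx ekl elk hk hl !(mulmxDr, mulmxN, mulmxDl, mulNmx, mulmxA).
move: (g *m bk *m bl) (ak *m g *m bl) (g *m Qkl) (al *m g *m bk) (al *m ak *m g)
  (g *m bl *m bk) (g *m Qlk) (ak *m al *m g) => M1 M2 M3 M4 M5 M6 M7 M8.
by apply/matrixP => i j; rewrite !mxE; ring.
Qed.

(** Differentiating the relation between the connection forms gives the hypotheses of
    [gauge_algebra]; the second derivatives of the transition function cancel by
    symmetry. *)
Lemma curvature_gauge c c' x k l : dom c x -> dom c' x -> (k < l)%N ->
  curvature A c x [set k; l] *m trans c c' x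
  = trans c c' x *m curvature A c' x [set k; l].
Proof.
move=> cx c'x kl.
have h1 := curvature_pair cx kl.
have h2 := curvature_pair c'x kl.
transitivity ((partialM k (component c l) x - partialM l (component c k) x
  + (component c k x *m component c l x - component c l x *m component c k x)) *m trans c c' x).
  exact: (congr1 (fun N => N *m trans c c' x) h1).
transitivity (trans c c' x *m (partialM k (component c' l) x - partialM l (component c' k) x
  + (component c' k x *m component c' l x - component c' l x *m component c' k x))); last first.
  exact: (congr1 (mulmx (trans c c' x)) (esym h2)).
move=> {h1 h2}.
have sg := trans_smooth c c'.
have oU : open (dom c `&` dom c')%classic by apply: openI; exact: dom_open.
have Ux : (dom c `&` dom c')%classic x by [].
have key p q : partialM p (component c q) x *m trans c c' x
     + component c q x *m partialM p (trans c c') x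
   = partialM p (trans c c') x *m component c' q x
     + trans c c' x *m partialM p (component c' q) x - partialM p (partialM q (trans c c')) x.
  have h1 := is_partialMM (component_partial p q cx) (smoothM_partial p sg Ux).
  have h2 := is_partialMM (smoothM_partial p sg Ux) (component_partial p q c'x).
  have h3 := is_partialMN (smoothM_partial p (smooth_partialM q sg) Ux).
  have nE : \forall y \near x, component c q y *m trans c c' y
      = trans c c' y *m component c' q y + - partialM q (trans c c') y.
    near=> y; apply: conn_gauge; near: y; exact: near_dom.
  have h := is_partialM_near nE h1.
  by rewrite -(is_partialM_val h) (is_partialM_val (is_partialMD h2 h3)).
have H : partialM l (partialM k (trans c c')) x = partialM k (partialM l (trans c c')) x.
  exact: partialM_commute oU sg Ux.
apply: (gauge_algebra _ _ (key k l)); last by rewrite -H; exact: key.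
  exact: conn_gauge.
exact: conn_gauge.
Unshelve. all: by end_near. Qed.

Lemma trans_adjoint c c' x : dom c x -> dom c' x ->
  adjoint (trans c c' x) *m trans c c' x = 1%:M.
Proof. by move=> cx c'x; apply: mulmx1C; exact: trans_unitary. Qed.

Lemma curvature_conjugate c c' x k l : dom c x -> dom c' x -> (k < l)%N ->
  curvature A c x [set k; l]
  = trans c c' x *m curvature A c' x [set k; l] *m adjoint (trans c c' x).
Proof.
move=> cx c'x kl; have := curvature_gauge cx c'x kl.
move/(congr1 (fun N => N *m adjoint (trans c c' x))).
by rewrite -mulmxA trans_unitary// mulmx1.
Qed.

Lemma adjointM n (X Y : 'M[R[i]]_n) : adjoint (X *m Y) = adjoint Y *m adjoint X.
Proof. by rewrite /adjoint trmx_mul map_mxM. Qed.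

Lemma adjointD n (X Y : 'M[R[i]]_n) : adjoint (X + Y) = adjoint X + adjoint Y.
Proof. by apply/matrixP => i j; rewrite !mxE rmorphD. Qed.

Lemma adjointN n (X : 'M[R[i]]_n) : adjoint (- X) = - adjoint X.
Proof. by apply/matrixP => i j; rewrite !mxE rmorphN. Qed.

(** The connection forms are skew-hermitian on an open set, hence so are their derivatives. *)
Lemma curvature_skew c x k l : dom c x -> (k < l)%N ->
  adjoint (curvature A c x [set k; l]) = - curvature A c x [set k; l].
Proof.
move=> cx kl; have h := curvature_pair cx kl; rewrite [curvature A c x _]h.
have sk q y : dom c y -> adjoint (component c q y) = - component c q y.
  by move=> cy; exact: conn_skew.
have skd p q : adjoint (partialM p (component c q) x) = - partialM p (component c q) x.
  have h1 := is_partialM_adjoint (component_partial p q cx).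
  have h2 := is_partialMN (component_partial p q cx).
  have nE : \forall y \near x, adjoint (component c q y) = - component c q y.
    near=> y; apply: sk; near: y; exact: near_dom.
  by rewrite -(is_partialM_val (is_partialM_near nE h1)) (is_partialM_val h2).
rewrite !(adjointD, adjointN, adjointM) !skd !sk//.
rewrite !(mulmxN, mulNmx, opprK).
by apply/matrixP => i j; rewrite ![in LHS]mxE ![in RHS]mxE; ring.
Unshelve. all: by end_near. Qed.

Lemma derive_translate (f : 'rV[R]_8 -> R) x (l v : 'rV[R]_8) : (\forall y \near x, f (y + l) = f y) ->
  'D_v f (x + l) = 'D_v f x.
Proof.
move=> fp; transitivity ('D_v (fun y => f (y + l)) x); last exact: near_eq_derive.
have quotE : (fun h : R => h^-1 *: (f (h *: v + (x + l)) - f (x + l)))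
       = (fun h : R => h^-1 *: (f (h *: v + x + l) - f (x + l))).
  by apply/funext => h; rewrite addrA.
by rewrite /derive /= quotE.
Qed.

Lemma component_periodic c x (l : 'rV[R]_8) p q : lattice B l -> dom c x ->
  partialM p (component c q) (x + l) = partialM p (component c q) x.
Proof.
move=> Bl cx; apply/matrixP => a b; rewrite [LHS]mxE [RHS]mxE /partialC /partial.
have nE : \forall y \near x, component c q (y + l) = component c q y.
  near=> y; rewrite /component (conn_periodic A Bl)//; near: y; exact: near_dom.
by congr (_ +i* _); apply: derive_translate; apply: filterS nE => y ->.
Unshelve. all: by end_near. Qed.

Lemma curvature_periodic c x (l : 'rV[R]_8) k (m : 'I_8) : lattice B l -> dom c x -> (k < m)%N ->
  curvature A c (x + l) [set k; m] = curvature A c x [set k; m].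
Proof.
move=> Bl cx km; have cxl : dom c (x + l) by exact: dom_periodic.
have h1 := curvature_pair cx km; have h2 := curvature_pair cxl km.
apply: etrans h2 _; apply: etrans (esym h1).
rewrite (component_periodic k m Bl cx) (component_periodic m k Bl cx).
have p q : component c q (x + l) = component c q x.
  by rewrite /component (conn_periodic A Bl).
by rewrite !p.
Qed.

End Curvature.

(** * Chern forms paired with Kaehler forms *)

Section ChernDensity.
Context {R : realType} {r : nat}.
Implicit Types (F : form 'M[R[i]]_r) (L I : 'M[R]_8) (S T U : {set 'I_8}).

Notation cx := (map_mx (real_complex R)).
Notation conj := (map_mx (@conjc R)).

Definition entry_form F (m n : 'I_r) : form R[i] := [ffun S => F S m n].

Definition trace_square F : form R[i] := trace_form (wedge F F).

(** The inner product of a 4-form with the square of omega_L; only its real part enters the Chern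
    numbers. *)
Definition square_pairing (a : form R[i]) L : R :=
  complex.Re (\sum_(T : {set 'I_8}) a T * (wedge (kahler L) (kahler L) T)%:C).

Lemma trace_squareE F T : trace_square F T =
  \sum_(U : {set 'I_8} | U \subset T) (-1) ^+ inversions U (T :\: U) * \tr (F U *m F (T :\: U)).
Proof.
rewrite /trace_square !ffunE raddf_sum; apply: eq_bigr => U _ /=.
rewrite -[in LHS]signr_odd -[in RHS]signr_odd !mulr_sign; case: (odd _) => //.
by rewrite raddfN.
Qed.

Lemma trace_square_entries F T :
  trace_square F T = \sum_m \sum_n wedge (entry_form F m n) (entry_form F n m) T.
Proof.
rewrite trace_squareE; under [RHS]eq_bigr do under eq_bigr do rewrite ffunE.
under [RHS]eq_bigr do rewrite exchange_big.
rewrite exchange_big; apply: eq_bigr => U _ /=.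
rewrite mulr_sumr; apply: eq_bigr => m _; rewrite mxE mulr_sumr; apply: eq_bigr => n _.
by rewrite !ffunE.
Qed.

Lemma square_pairing_trace F L : square_pairing (trace_square F) L =
  \sum_m \sum_n complex.Re (kahler_square_pairing (entry_form F m n) (entry_form F n m) L).
Proof.
rewrite /square_pairing; under eq_bigr do rewrite trace_square_entries mulr_suml.
rewrite exchange_big raddf_sum; apply: eq_bigr => m _ /=.
under eq_bigr do rewrite mulr_suml.
by rewrite exchange_big raddf_sum; apply: eq_bigr.
Qed.

Lemma wedge_homogeneous (K : pzRingType) (a b : form K) T :
  homogeneous 2 a -> homogeneous 2 b -> #|T| != 4%N -> wedge a b T = 0.
Proof.
move=> ha hb T4; rewrite ffunE big1// => U UT.
have [/eqP U2|U2] := boolP (#|U| == 2%N); last by rewrite ha// mul0r mulr0.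
rewrite hb ?mulr0 ?mulr0// cardsD (finset.setIidPr UT) U2.
have := subset_leq_card UT; rewrite U2; move: T4; lia.
Qed.

(** The integrand of the cup product with c_2, split into the two terms of the Chern form. *)
Lemma c2_pairing F L (k : R) : U' L -> (forall m n, homogeneous 2 (entry_form F m n)) ->
  wedge [ffun S => complex.Re (k%:C * (trace_form (wedge F F) S
             - wedge (trace_form F) (trace_form F) S))]
    (wedge (kahler L) (kahler L)) [set: 'I_8]
  = k * (square_pairing (trace_square F) L
         - square_pairing (wedge (trace_form F) (trace_form F)) L).
Proof.
move=> UL hF; have htr : homogeneous 2 (trace_form F).
  move=> S S2; rewrite ffunE; apply: big1 => m _.
  by have := hF m m S S2; rewrite ffunE.
rewrite wedge_kahler_square// => [|T T4]; last first.
  rewrite ffunE -/(trace_square F) trace_square_entries big1 => [|m _].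
    by rewrite wedge_homogeneous// subr0 mulr0.
  by apply: big1 => n _; exact: wedge_homogeneous.
rewrite /square_pairing -raddfB -sumrB raddf_sum mulr_sumr; apply: eq_bigr => T _ /=.
rewrite ffunE complex_ReZ -mulrA; congr (_ * _).
by rewrite -mulrBl [_ * _%:C]mulrC complex_ReZ mulrC.
Qed.

Lemma trace_conjugate F F' (g h : 'M[R[i]]_r) : h *m g = 1%:M ->
  (forall S, F S = g *m F' S *m h) ->
  trace_form F = trace_form F' /\ trace_square F = trace_square F'.
Proof.
move=> hg FF; split; apply/ffunP => T.
  by rewrite !ffunE FF mxtrace_mulC mulmxA hg mul1mx.
rewrite !trace_squareE; apply: eq_bigr => U _; congr (_ * _).
rewrite !FF -!mulmxA mxtrace_mulC -!mulmxA.
by rewrite hg mulmx1 [h *m (g *m _)]mulmxA hg mul1mx.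
Qed.

Lemma Lambda_contract_entry L F (m n : 'I_r) : (forall i j, L j i = - L i j) ->
  homogeneous 2 (entry_form F m n) ->
  2 * Lambda_contract L F m n = frobenius (cx L) (coef2 (entry_form F m n)).
Proof.
move=> sk hF; rewrite summxE.
have -> : \sum_S ((kahler L S)%:C *: F S) m n = \sum_S (kahler L S)%:C * entry_form F m n S.
  by apply: eq_bigr => S _; rewrite mxE [entry_form _ _ _ _]ffunE.
rewrite sum_pairs => [|U U2]; last by rewrite hF// mulr0.
apply: etrans (sum_upper (F := fun i j => cx L i j * coef2 (entry_form F m n) i j) _ _).
- congr (_ * _); apply: eq_bigr => i _; apply: eq_bigr => j ij.
  by rewrite coef2_lt// [cx L i j]mxE -[kahler L _]coef2_lt// coef2_kahler.
- by move=> i j; rewrite coef2_skew !mxE sk rmorphN mulrNN.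
- by move=> i; rewrite [coef2 _ i i]mxE ltnn mulr0.
Qed.

(** For K = I and K = L the pairing is the inner product of F with F(K., K.), and for K = I this is
    the squared norm of F. *)
Lemma square_pairing_difference F I L : U' I -> U' L ->
  (forall m n, homogeneous 2 (entry_form F m n)) ->
  (forall S, adjoint (F S) = - F S) ->
  (forall m n, has_type I 1 1 (entry_form F m n)) ->
  Lambda_contract I F = 0 ->
  square_pairing (trace_square F) I - square_pairing (trace_square F) L
  = (\sum_m \sum_n sqnorm (coef2 (entry_form F m n)
       - cx L *m coef2 (entry_form F m n) *m (cx L)^T)) / 2.
Proof.
move=> UI UL hF skF tF LF; rewrite !square_pairing_trace.
have two0 : 2 != 0 :> R[i] by rewrite pnatr_eq0.
have conjF m n : coef2 (entry_form F n m) = - conj (coef2 (entry_form F m n)).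
  have e S : F S n m = - conjc (F S m n).
    by have /matrixP/(_ n m) := skF S; rewrite !mxE => ->; rewrite opprK.
  apply/matrixP => i j; rewrite !mxE !ffunE e; case: ltngtP => _.
  - by [].
  - by rewrite (rmorphN (@conjc R)).
  - by rewrite (rmorph0 (@conjc R)) oppr0.
have LI m n : frobenius (cx I) (coef2 (entry_form F m n)) = 0.
  by rewrite -(Lambda_contract_entry (U'_skew UI) (hF m n)) LF mxE mulr0.
have II : I *m I = - 1%:M by have [] := U'_hermitian UI.
have MI m n : cx I *m coef2 (entry_form F m n) *m (cx I)^T = coef2 (entry_form F m n).
  by have [] := (has_type11P _ II).1 (tF m n).
have P K m n : U' K ->
    complex.Re (kahler_square_pairing (entry_form F m n) (entry_form F n m) K)
    = complex.Re (frobenius (coef2 (entry_form F m n))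
        (cx K *m conj (coef2 (entry_form F m n)) *m (cx K)^T)).
  move=> UK; congr complex.Re; apply: (mulfI two0).
  rewrite (kahler_square_pairing_mx (U'_skew UK))//.
  rewrite (U'_primitive UK UI (MI m n) (LI m n)) mul0r sub0r (conjF m n) mulmxN mulNmx.
  rewrite -mulrN; congr (_ * _); rewrite -sumrN; apply: eq_bigr => i _.
  by rewrite -sumrN; apply: eq_bigr => j _; rewrite !mxE; ring.
have ort K : U' K -> (cx K)^T *m cx K = 1%:M /\ conj (cx K) = cx K.
  move=> UK; split.
    have [_ h] := U'_hermitian UK; rewrite map_trmx -map_mxM.
    by rewrite (mulmx1C h) map_mx1.
  by apply/matrixP => i j; rewrite !mxE /=; rewrite /conjc oppr0.
rewrite -sumrB mulr_suml; apply: eq_bigr => m _.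
rewrite -sumrB mulr_suml; apply: eq_bigr => n _.
rewrite !P//; have [h1 h2] := ort L UL; rewrite -frobenius_distance//.
congr (complex.Re (frobenius _ _) - _).
have [h3 h4] := ort I UI; rewrite -{2}(MI m n) !map_mxM -map_trmx h4 //.
Qed.

End ChernDensity.

(** * Continuity and periodicity of the Chern forms *)

Section ComplexContinuity.
Context {R : realType}.
Implicit Types (f g : 'rV[R]_8 -> R[i]) (x : 'rV[R]_8).

Definition continuousC f x : Prop :=
  {for x, continuous (fun y => complex.Re (f y))} /\
  {for x, continuous (fun y => complex.Im (f y))}.

Lemma continuous_near (f g : 'rV[R]_8 -> R) x : (\forall y \near x, f y = g y) ->
  {for x, continuous f} -> {for x, continuous g}.
Proof.
move=> fg cf; have E : f x = g x by exact: nbhs_singleton fg.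
move: cf; rewrite /prop_for /continuous_at /= E; apply: cvg_trans.
exact: (near_eq_cvg (fg : {near x, f =1 g})).
Qed.

Lemma continuousC_near f g x : (\forall y \near x, f y = g y) ->
  continuousC f x -> continuousC g x.
Proof.
move=> fg [h1 h2]; split.
  by apply: continuous_near h1; apply: filterS fg => y ->.
by apply: continuous_near h2; apply: filterS fg => y ->.
Qed.

Lemma continuousC_cst (c : R[i]) x : continuousC (fun=> c) x.
Proof. by split; exact: row_continuous_cst. Qed.

Lemma continuousCD f g x : continuousC f x -> continuousC g x ->
  continuousC (fun y => f y + g y) x.
Proof.
move=> [f1 f2] [g1 g2]; split.
  rewrite (_ : (fun y => _) = fun y => complex.Re (f y) + complex.Re (g y)).
    exact: row_continuousD.
  by apply/funext => y; rewrite complex_ReD.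
rewrite (_ : (fun y => _) = fun y => complex.Im (f y) + complex.Im (g y)).
  exact: row_continuousD.
by apply/funext => y; rewrite complex_ImD.
Qed.

Lemma continuousCM f g x : continuousC f x -> continuousC g x ->
  continuousC (fun y => f y * g y) x.
Proof.
move=> [f1 f2] [g1 g2]; split.
  rewrite (_ : (fun y => _) = fun y => complex.Re (f y) * complex.Re (g y)
     - complex.Im (f y) * complex.Im (g y)).
    by apply: row_continuousB; exact: row_continuousM.
  by apply/funext => y; rewrite complex_ReM.
rewrite (_ : (fun y => _) = fun y => complex.Re (f y) * complex.Im (g y)
     + complex.Im (f y) * complex.Re (g y)).
  by apply: row_continuousD; exact: row_continuousM.
by apply/funext => y; rewrite complex_ImM.
Qed.

Lemma continuousCN f x : continuousC f x -> continuousC (fun y => - f y) x.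
Proof.
move=> cf; rewrite (_ : (fun y => _) = fun y => -1 * f y).
  by apply: continuousCM cf; exact: continuousC_cst.
by apply/funext => y; rewrite mulN1r.
Qed.

Lemma continuousC_sum (I : Type) (s : seq I) (P : pred I) (f : I -> 'rV[R]_8 -> R[i]) x :
  (forall i, continuousC (f i) x) -> continuousC (fun y => \sum_(i <- s | P i) f i y) x.
Proof.
move=> h; elim: s => [|i s IH].
  rewrite (_ : (fun y => _) = fun=> 0); first exact: continuousC_cst.
  by apply/funext => y; rewrite big_nil.
rewrite (_ : (fun y => _) = fun y => (if P i then f i y else 0) + \sum_(j <- s | P j) f j y).
  by apply: continuousCD => //; case: (P i) => //; exact: continuousC_cst.
by apply/funext => y; rewrite big_cons; case: (P i); rewrite ?add0r.
Qed.

Lemma continuousC_mulmx m n p (f : 'rV[R]_8 -> 'M[R[i]]_(m, n))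
    (g : 'rV[R]_8 -> 'M[R[i]]_(n, p)) x :
  (forall a b, continuousC (fun y => f y a b) x) ->
  (forall a b, continuousC (fun y => g y a b) x) ->
  forall a b, continuousC (fun y => (f y *m g y) a b) x.
Proof.
move=> cf cg a b; rewrite (_ : (fun y => _) = fun y => \sum_j f y a j * g y j b).
  by apply: continuousC_sum => j; exact: continuousCM.
by apply/funext => y; rewrite mxE.
Qed.

Lemma smoothC_continuous (U : set 'rV[R]_8) f x : smoothC U f -> U x -> continuousC f x.
Proof. by move=> [h1 h2] Ux; split; [exact: smooth_continuous h1 Ux|exact: smooth_continuous h2 Ux]. Qed.

Lemma square_pairing_continuous (r : nat) (F : 'rV[R]_8 -> form 'M[R[i]]_r) (L : 'M[R]_8) x :
  (forall S a b, continuousC (fun y => F y S a b) x) ->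
  {for x, continuous (fun y => square_pairing (trace_square (F y)) L)}.
Proof.
move=> cF; rewrite /square_pairing.
suff [] : continuousC (fun y => \sum_(T : {set 'I_8}) trace_square (F y) T
    * (wedge (kahler L) (kahler L) T)%:C) x by [].
apply: continuousC_sum => T; apply: continuousCM; last exact: continuousC_cst.
rewrite (_ : (fun y => _) = fun y => \sum_(U : {set 'I_8} | U \subset T)
   (-1) ^+ inversions U (T :\: U) * \sum_a (F y U *m F y (T :\: U)) a a).
  apply: continuousC_sum => U; apply: continuousCM; first exact: continuousC_cst.
  by apply: continuousC_sum => a; exact: continuousC_mulmx.
by apply/funext => y; rewrite trace_squareE.
Qed.

End ComplexContinuity.

Section CurvatureContinuity.
Context {R : realType} {B : 'M[R]_8} {r : nat} {E : hermitian_bundle B r}.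
Variable A : hermitian_connection E.
Implicit Types (c : chart E) (x : 'rV[R]_8).
Hypothesis hom : forall c x (S : {set 'I_8}), dom c x -> #|S| != 2%N -> curvature A c x S = 0.

Lemma card2_sorted (S : {set 'I_8}) : #|S| = 2%N ->
  exists k l : 'I_8, (k < l)%N /\ S = [set k; l].
Proof.
move/eqP/cards2P => [a [b [ab ->]]].
move: ab; rewrite -val_eqE /= neq_ltn => /orP[ab|ba]; first by exists a, b.
by exists b, a; rewrite finset.setUC.
Qed.

Lemma curvature_cases (P : {set 'I_8} -> Prop) :
  (forall k l : 'I_8, (k < l)%N -> P [set k; l]) ->
  (forall S : {set 'I_8}, #|S| != 2%N -> P S) -> forall S, P S.
Proof.
move=> h2 h S; have [/eqP/card2_sorted[k [l [kl ->]]]|] := boolP (#|S| == 2%N).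
  exact: h2.
exact: h.
Qed.

Lemma curvature_continuous c x (S : {set 'I_8}) a b : dom c x ->
  continuousC (fun y => curvature A c y S a b) x.
Proof.
move=> cx; move: S; apply: curvature_cases => [k l kl|S S2]; last first.
  apply: (@continuousC_near _ (fun=> 0)); last exact: continuousC_cst.
  by apply: filterS (near_dom cx) => y cy; rewrite (hom cy S2) mxE.
have ca q a' b' : continuousC (fun y => component A c q y a' b') x.
  by apply: smoothC_continuous cx; exact: conn_smooth.
have cd p q : continuousC (fun y => partialM p (component A c q) y a b) x.
  apply: smoothC_continuous cx; apply: smooth_partialM; exact: conn_smooth.
apply: (@continuousC_near _ (fun y => partialM k (component A c l) y a b
   + - partialM l (component A c k) y a b
   + ((component A c k y *m component A c l y) a b
     + - (component A c l y *m component A c k y) a b))).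
  apply: filterS (near_dom cx) => y cy; rewrite (curvature_pair A cy kl).
  by rewrite ![in RHS]mxE; congr (_ + _ + (_ + _)); rewrite mxE.
apply: continuousCD; first by apply: continuousCD => //; exact: continuousCN.
apply: continuousCD; last apply: continuousCN; exact: continuousC_mulmx.
Qed.

Lemma curvature_trace_change c c' x : dom c x -> dom c' x ->
  trace_form (curvature A c x) = trace_form (curvature A c' x) /\
  trace_square (curvature A c x) = trace_square (curvature A c' x).
Proof.
move=> cx c'x; apply: (@trace_conjugate _ _ _ _ (trans c c' x) (adjoint (trans c c' x))).
  exact: trans_adjoint.
apply: curvature_cases => [k l kl|S S2]; first exact: curvature_conjugate.
apply: etrans (hom cx S2) _; have h := hom c'x S2.
by rewrite [curvature A c' x S]h mulmx0 mul0mx.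
Qed.

Lemma curvature_adjoint c x (S : {set 'I_8}) : dom c x ->
  adjoint (curvature A c x S) = - curvature A c x S.
Proof.
move=> cx; move: S; apply: curvature_cases => [k l kl|S S2]; first exact: curvature_skew.
have h := hom cx S2; rewrite [curvature A c x S]h; apply/matrixP => a b.
by rewrite !mxE oppr0 (rmorph0 (@conjc R)).
Qed.

Lemma curvature_translate c x (l : 'rV[R]_8) : lattice B l -> dom c x ->
  curvature A c (x + l) = curvature A c x.
Proof.
move=> Bl cx; apply/ffunP; apply: curvature_cases => [k m km|S S2].
  exact: curvature_periodic.
by apply: etrans (esym (hom cx S2)); apply: hom S2; exact: dom_periodic.
Qed.

Lemma chart_atP x : dom (chart_at E x) x.
Proof. by rewrite /chart_at; case: cid. Qed.

Notation F x := (curvature A (chart_at E x) x).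

(** The chosen chart does not vary continuously, but at a point y near x it gives the same traces as
    the chart chosen at x. *)
Lemma chart_curvature_pairing_continuous L : continuous (fun x => square_pairing (trace_square (F x)) L).
Proof.
move=> x; have cx := chart_atP x.
apply: (@continuous_near _ (fun y => square_pairing (trace_square (curvature A (chart_at E x) y)) L)).
  apply: filterS (near_dom cx) => y cy.
  exact: (congr1 (square_pairing^~ L) (curvature_trace_change cy (chart_atP y)).2).
by apply: square_pairing_continuous => S a b; exact: curvature_continuous.
Qed.

Lemma chart_curvature_pairing_periodic L :
  periodic_on B [set: 'rV[R]_8]%classic (fun x => square_pairing (trace_square (F x)) L).
Proof.
move=> x l Bl _; have cx := chart_atP x.
have cxl : dom (chart_at E x) (x + l) by exact: dom_periodic.
have e := (curvature_trace_change (chart_atP (x + l)) cxl).2.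
apply: etrans (congr1 (square_pairing^~ L) e) _.
exact: (congr1 (fun G => square_pairing (trace_square G) L) (curvature_translate Bl cx)).
Qed.

End CurvatureContinuity.

(** * Exact forms on the torus *)

Section ExactForms.
Context {R : realType} (B : 'M[R]_8) (B_unit : B \in unitmx).

(** The integrands to which the divergence theorem on the torus is applied. *)
Record periodicC1 (f : 'rV[R]_8 -> R) : Prop := PeriodicC1 {
  pC1_continuous : continuous f;
  pC1_derivable : forall j x, derivable f x (delta_mx 0 j);
  pC1_partial : forall j, continuous (partial j f);
  pC1_periodic : periodic_on B [set: 'rV[R]_8]%classic f }.

Lemma torus_integral_divergence (I : Type) (s : seq I) (a : I -> R) (d : I -> 'I_8)
    (f : I -> 'rV[R]_8 -> R) : (forall i, periodicC1 (f i)) ->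
  torus_integral B (fun x => \sum_(i <- s) a i * partial (d i) (f i) x) = 0.
Proof.
move=> fC1.
have c i : continuous (partial (d i) (f i)) by exact: pC1_partial.
elim: s => [|i s IH].
  rewrite (_ : (fun x => _) = fun=> 0) ?torus_integral_cst ?mulr0//.
  by apply/funext => x; rewrite big_nil.
rewrite (_ : (fun x => _) = fun x => a i * partial (d i) (f i) x
   + \sum_(j <- s) a j * partial (d j) (f j) x); last first.
  by apply/funext => x; rewrite big_cons.
rewrite torus_integral_linear// => [|x]; last first.
  by apply: row_continuous_sum => j _; apply: row_continuousM; [exact: row_continuous_cst|exact: c].
rewrite IH addr0; have [f1 f2 f3 f4] := fC1 i.
by rewrite torus_integral_partial// mulr0.
Qed.

Variables (eta : 'rV[R]_8 -> form R) (eta1 : forall x, homogeneous 1 (eta x)).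
Hypothesis eta_smooth : forall S, smooth [set: 'rV[R]_8]%classic (fun x => eta x S).
Hypothesis eta_periodic : periodic_on B [set: 'rV[R]_8]%classic eta.

Let e (j : 'I_8) : 'rV[R]_8 -> R := fun x => eta x [set j].
Notation D := (fun i j x => partial i (e j) x).

Lemma smooth_periodicC1 f : smooth [set: 'rV[R]_8]%classic f ->
  periodic_on B [set: 'rV[R]_8]%classic f -> periodicC1 f.
Proof.
move=> sf pf; split => // [x|j x|j x].
- exact: smooth_continuous sf I.
- exact: smooth_derivable sf I.
- exact: smooth_continuous (smooth_partial j sf) I.
Qed.

Lemma component_smooth j : smooth [set: 'rV[R]_8]%classic (e j).
Proof. exact: eta_smooth. Qed.

Lemma eta_component_periodic j : periodic_on B [set: 'rV[R]_8]%classic (e j).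
Proof. by move=> x l Bl _; rewrite /e eta_periodic. Qed.

Lemma partial_periodic f k : periodic_on B [set: 'rV[R]_8]%classic f ->
  periodic_on B [set: 'rV[R]_8]%classic (partial k f).
Proof.
move=> pf x l Bl _; apply: derive_translate.
exact: (@filterE _ (nbhs x) _ _ (fun y => pf y l Bl I)).
Qed.

Lemma periodicC1M f g : periodicC1 f -> periodicC1 g -> periodicC1 (fun x => f x * g x).
Proof.
move=> [f1 f2 f3 f4] [g1 g2 g3 g4].
have h j x : is_derive x (delta_mx 0 j) (fun x => f x * g x)
    (partial j f x * g x + f x * partial j g x).
  exact: (derivativeM (derivableP (f2 j x)) (derivableP (g2 j x))).
split=> [x|j x|j x|x l Bl xT].
- by apply: row_continuousM; [exact: f1|exact: g1].
- by have [] := h j x.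
- rewrite (_ : partial j _ = fun x => partial j f x * g x + f x * partial j g x).
    by apply: row_continuousD; apply: row_continuousM; [exact: f3|exact: g1|exact: f1|exact: g3].
  by apply/funext => y; have [_] := h j y.
- by rewrite f4// g4.
Qed.

Lemma exact_coef i j x : coef2 (ext_d (@partial R) eta x) i j = D i j x - D j i x.
Proof.
rewrite mxE; case: ltngtP => [ij|ji|/ord_inj ->].
- by rewrite ext_d_pair.
- by rewrite finset.setUC ext_d_pair// opprB.
- by rewrite subrr.
Qed.

Lemma exact_homogeneous x : homogeneous 2 (ext_d (@partial R) eta x).
Proof.
move=> S S2; rewrite ffunE big1// => i iS.
have -> : (fun y => eta y (S :\ i)) = fun=> 0.
  by apply/funext => y; apply: eta1; move: S2; rewrite (cardsD1 i S) iS; lia.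
by have [_ E0] := derivative_cst (0 : R) x (delta_mx 0 i); rewrite /partial E0 mulr0.
Qed.

(** The contraction of an exact 2-form with a constant one is a divergence, so its integral is 0. *)
Lemma exact_contraction_eq0 (J : 'M[R]_8) (g : R) : (forall i j, J j i = - J i j) ->
  (forall x, \sum_S kahler J S * ext_d (@partial R) eta x S = g) -> g = 0.
Proof.
move=> sk hg; set w := fun x => ext_d (@partial R) eta x.
have gE x : g = \sum_(p : 'I_8 * 'I_8) J p.1 p.2 * partial p.1 (e p.2) x.
  have two0 : 2 != 0 :> R by rewrite pnatr_eq0.
  apply: (mulfI two0); rewrite -(hg x) sum_pairs => [|U U2]; last first.
    by rewrite kahler_homogeneous// mul0r.
  transitivity (\sum_i \sum_j J i j * coef2 (w x) i j).
    rewrite -(sum_upper (F := fun i j => J i j * coef2 (w x) i j)).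
    - congr (_ * _); apply: eq_bigr => i _; apply: eq_bigr => j ij.
      by rewrite coef2_lt// -[kahler J _]coef2_lt// coef2_kahler.
    - by move=> i j; rewrite coef2_skew sk mulrNN.
    - by move=> i; rewrite [coef2 _ i i]mxE ltnn mulr0.
  rewrite -(pair_bigA _ (fun i j => J i j * D i j x)) /= mulr_natl mulr2n.
  rewrite [X in _ = _ + X]exchange_big -big_split; apply: eq_bigr => i _ /=.
  by rewrite -big_split; apply: eq_bigr => j _; rewrite exact_coef (sk i j) /=; ring.
have := torus_integral_divergence (index_enum ('I_8 * 'I_8)%type)
   (fun p => J p.1 p.2) (fun p => p.1)
   (fun p => smooth_periodicC1 (component_smooth p.2) (eta_component_periodic p.2)).
rewrite (_ : (fun x => _) = fun=> g).
  by rewrite torus_integral_cst => /eqP; rewrite mulf_eq0 gt_eqF ?det_gt0//= => /eqP.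
by apply/funext => x; rewrite (gE x).
Qed.

Lemma square_pairing_scale (t : form R[i]) (w : form R) (c : R[i]) (s : R) (L : 'M[R]_8) :
  (forall i j, L j i = - L i j) -> homogeneous 2 w ->
  (forall S, t S = c * (w S)%:C) -> c * c = s%:C ->
  2 * square_pairing (wedge t t) L
  = s * \sum_i \sum_j \sum_k \sum_l coef2 w i j * coef2 w k l * half_square L i j k l.
Proof.
move=> sk hw tw cc.
have ht : homogeneous 2 t by move=> S S2; rewrite tw hw// mulr0.
have tc i j : coef2 t i j = c * (coef2 w i j)%:C.
  rewrite !mxE tw; case: ltngtP => _ //; rewrite ?rmorphN ?mulrN// mulr0 //.
rewrite -complex_ReZ rmorph_nat -/(kahler_square_pairing t t L) kahler_square_pairing_full//.
transitivity (complex.Re (s%:C * (\sum_i \sum_j \sum_k \sum_l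
    coef2 w i j * coef2 w k l * half_square L i j k l)%:C)); last by rewrite complex_ReZ.
congr complex.Re; rewrite rmorph_sum mulr_sumr; apply: eq_bigr => i _.
do 3! (rewrite rmorph_sum mulr_sumr; apply: eq_bigr => ? _).
by rewrite !tc !rmorphM -cc /=; ring.
Qed.

Lemma sum_antisym (V : lmodType R) (G : 'I_8 -> 'I_8 -> V) :
  (forall i k, G k i = - G i k) -> \sum_i \sum_k G i k = 0.
Proof.
move=> Ga; have two0 : 2 != 0 :> R by rewrite pnatr_eq0.
have E : \sum_i \sum_k G i k = - \sum_i \sum_k G i k.
  rewrite {1}exchange_big -sumrN; apply: eq_bigr => i _ /=.
  by rewrite -sumrN; apply: eq_bigr => k _.
apply: (scalerI two0); rewrite scaler0 scaler_nat mulr2n {1}E addNr //.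
Qed.

(** For w = d eta, the form w /\ w /\ omega_L^2 is the differential of eta /\ w /\ omega_L^2.  In the
    product rule the terms with second derivatives of eta cancel, because they are symmetric
    in i and k while [half_square] is antisymmetric. *)
Lemma exact_square_divergence (L : 'M[R]_8) x : (forall i j, L j i = - L i j) ->
  let N := coef2 (ext_d (@partial R) eta x) in
  \sum_i \sum_j \sum_k \sum_l N i j * N k l * half_square L i j k l
  = 4 * \sum_i \sum_j \sum_k \sum_l half_square L i j k l
      * partial i (fun y => e j y * D k l y) x.
Proof.
move=> sk N.
pose h i j k l := half_square L i j k l.
have h13 i j k l : h k j i l = - h i j k l.
  by rewrite /h /half_square (sk k j) (sk i j) (sk i k); ring.
have dM i j k l : partial i (fun y => e j y * D k l y) x
    = D i j x * D k l x + e j x * partial i (partial k (e l)) x.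
  have h1 := derivableP (@smooth_derivable R _ _ x i (component_smooth j) I).
  have h2 := derivableP (@smooth_derivable R _ _ x i (smooth_partial k (component_smooth l)) I).
  by have [_] := derivativeM h1 h2.
have second : \sum_i \sum_j \sum_k \sum_l h i j k l * (e j x * partial i (partial k (e l)) x) = 0.
  rewrite exchange_big; apply: big1 => j _ /=; apply: (@sum_antisym R^o) => i k.
  rewrite -sumrN; apply: eq_bigr => l _.
  have c : partial k (partial i (e l)) x = partial i (partial k (e l)) x.
    exact: partial_commute openT (component_smooth l) I.
  by rewrite h13 c mulNr.
have swap12 (X Y : 'I_8 -> 'I_8 -> R) : \sum_i \sum_j \sum_k \sum_l X j i * Y k l * h i j k l
    = - \sum_i \sum_j \sum_k \sum_l X i j * Y k l * h i j k l.
  rewrite exchange_big -sumrN; apply: eq_bigr => i _ /=; rewrite -sumrN; apply: eq_bigr => j _ /=.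
  do 2! (rewrite -sumrN; apply: eq_bigr => ? _ /=).
  by rewrite /h half_square12// mulrN.
have swap34 (X Y : 'I_8 -> 'I_8 -> R) : \sum_i \sum_j \sum_k \sum_l X i j * Y l k * h i j k l
    = - \sum_i \sum_j \sum_k \sum_l X i j * Y k l * h i j k l.
  rewrite -sumrN; apply: eq_bigr => i _ /=; rewrite -sumrN; apply: eq_bigr => j _ /=.
  rewrite exchange_big.
  do 2! (rewrite -sumrN; apply: eq_bigr => ? _ /=).
  by rewrite /h half_square34// mulrN.
pose T X Y := \sum_i \sum_j \sum_k \sum_l (X i j : R) * Y k l * h i j k l.
pose d i j := D i j x.
have split4 : \sum_i \sum_j \sum_k \sum_l N i j * N k l * h i j k l
    = T d d - T (fun i j => d j i) d - T d (fun i j => d j i) + T (fun i j => d j i) (fun i j => d j i).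
  rewrite /T -!sumrB -!big_split; apply: eq_bigr => i _ /=.
  do 3! (rewrite -!sumrB -!big_split; apply: eq_bigr => ? _ /=).
  by rewrite !exact_coef /d; ring.
have -> : \sum_i \sum_j \sum_k \sum_l half_square L i j k l
      * partial i (fun y => e j y * D k l y) x = T d d.
  rewrite -[RHS]addr0 -[X in _ + X]second /T -!big_split; apply: eq_bigr => i _ /=.
  do 3! (rewrite -!big_split; apply: eq_bigr => ? _ /=).
  by rewrite dM /d /h; ring.
have e1 : T (fun i j => d j i) d = - T d d by exact: swap12.
have e2 : T d (fun i j => d j i) = - T d d by exact: swap34.
have e3 : T (fun i j => d j i) (fun i j => d j i) = - T d (fun i j => d j i) by exact: swap12.
by rewrite [LHS]split4 e3 e1 e2; ring.
Qed.

Lemma exact_square_pairing_integral (t : 'rV[R]_8 -> form R[i]) (c : R[i]) (s : R) (L : 'M[R]_8) :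
  (forall i j, L j i = - L i j) ->
  (forall x S, t x S = c * (ext_d (@partial R) eta x S)%:C) -> c * c = s%:C ->
  let G := fun x => square_pairing (wedge (t x) (t x)) L in
  continuous G /\ torus_integral B G = 0.
Proof.
move=> sk tE cc G.
pose I4 := ('I_8 * 'I_8 * 'I_8 * 'I_8)%type.
pose f (p : I4) := fun y => e p.1.1.2 y * D p.1.2 p.2 y.
have fC1 p : periodicC1 (f p).
  apply: periodicC1M; apply: smooth_periodicC1.
  - exact: component_smooth.
  - exact: eta_component_periodic.
  - exact: smooth_partial (component_smooth _).
  - exact: partial_periodic (eta_component_periodic _).
pose a (p : I4) := 2 * s * half_square L p.1.1.1 p.1.1.2 p.1.2 p.2.
have GE : G = fun x => \sum_p a p * partial p.1.1.1 (f p) x.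
  apply/funext => x; have two0 : 2 != 0 :> R by rewrite pnatr_eq0.
  apply: (mulfI two0).
  rewrite (square_pairing_scale sk (@exact_homogeneous x) (tE x) cc) exact_square_divergence//.
  rewrite -(pair_bigA _ (fun q l => a (q, l) * partial q.1.1 (f (q, l)) x)) /=.
  rewrite -(pair_bigA _ (fun q k => \sum_l a (q, k, l) * partial q.1 (f (q, k, l)) x)) /=.
  rewrite -(pair_bigA _ (fun i j => \sum_k \sum_l a (i, j, k, l) * partial i (f (i, j, k, l)) x)) /=.
  rewrite mulrA !mulr_sumr; apply: eq_bigr => i _.
  do 3! (rewrite !mulr_sumr; apply: eq_bigr => ? _).
  by rewrite /a /f /=; ring.
rewrite GE; split; last exact: torus_integral_divergence.
move=> x; apply: row_continuous_sum => p _; apply: row_continuousM; first exact: row_continuous_cst.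
exact: pC1_partial (fC1 p) _ x.
Qed.

End ExactForms.

(** * Hermitian-Yang-Mills connections with vanishing first Chern class *)

Section HYMInstanton.
Context {R : realType} {B : 'M[R]_8} (B_unit : B \in unitmx).
Context {r : nat} {E : hermitian_bundle B r}.
Variable A : hermitian_connection E.
Variables (I : 'M[R]_8) (UI : U' I) (A_HYM : HYM A I) (c1E : c1_zero A).
Implicit Types (L : 'M[R]_8) (c : chart E) (x : 'rV[R]_8) (S : {set 'I_8}).

Notation cx := (map_mx (real_complex R)).
Notation F x := (curvature A (chart_at E x) x).
Notation coefs c x m n := (coef2 (entry_form (curvature A c x) m n)).

Lemma HYM_homogeneous c x S : dom c x -> #|S| != 2%N -> curvature A c x S = 0.
Proof.
move=> dx S2; apply/matrixP => a b; rewrite [RHS]mxE.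
by have [h _ _] := A_HYM.1 c x dx a b; have := h S S2; rewrite ffunE.
Qed.

Lemma entry_homogeneous c x m n : dom c x -> homogeneous 2 (entry_form (curvature A c x) m n).
Proof.
move=> dx S S2; have h := HYM_homogeneous dx S2.
by rewrite ffunE [curvature A c x S]h mxE.
Qed.

(** The trace of a skew-hermitian matrix is imaginary, so the real form c_1 determines tr F. *)
Lemma trace_exact : exists (eta : 'rV[R]_8 -> form R) (k : R[i]) (s : R),
  [/\ [/\ forall x, homogeneous 1 (eta x),
        forall S, smooth [set: 'rV[R]_8]%classic (fun x => eta x S)
      & periodic_on B [set: 'rV[R]_8]%classic eta],
      k != 0, k * k = s%:C
    & forall x S, trace_form (F x) S = k * (ext_d (@partial R) eta x S)%:C].
Proof.
have [eta [eta1 eta_smooth eta_per etaE]] := c1E.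
have pi0 : (2 * pi : R) != 0 by rewrite mulf_neq0 ?pnatr_eq0 ?gt_eqF ?pi_gt0.
have i2 : 'i * 'i = -1 :> R[i] by rewrite -expr2 sqrCi.
(* c_1 = 'i / (2 pi) tr F = d eta, that is, tr F = - 2 pi 'i d eta *)
exists eta, ((- (2 * pi))%:C * 'i), (- (2 * pi) ^+ 2); split => //.
- by rewrite mulf_neq0 ?neq0Ci// (inj_eq (@complexI R)) oppr_eq0.
- by rewrite mulrACA i2 -rmorphM mulrNN -expr2 mulrN1 rmorphN.
move=> x S; have dx : dom (chart_at E x) x by exact: chart_atP.
have := etaE x => /ffunP/(_ S); rewrite ffunE => <-.
have : conjc (trace_form (F x) S) = - trace_form (F x) S.
  have h := curvature_adjoint HYM_homogeneous S dx.
  have trE : trace_form (F x) S = \tr (F x S) by rewrite /trace_form ffunE.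
  rewrite trE -[RHS](raddfN mxtrace); apply: etrans (congr1 mxtrace h).
  by rewrite /mxtrace rmorph_sum; apply: eq_bigr => m _; rewrite !mxE.
case: (trace_form (F x) S) => u v /eqP; rewrite eq_complex /= => /andP[/eqP uu _].
have u0 : u = 0 by lra.
apply/eqP; rewrite eq_complex u0 /=; apply/andP; split; apply/eqP; first by ring.
have : (pi : R) != 0 by rewrite gt_eqF ?pi_gt0.
by move: (pi : R) => p p0; field.
Qed.

(** The trace of the HYM condition makes the contraction of the exact form tr F with omega_I
    constant; a constant with integral 0 is 0. *)
Lemma Lambda_curvature_eq0 c x : dom c x -> Lambda_contract I (curvature A c x) = 0.
Proof.
move=> dx; have [lambda lam] := A_HYM.2.
have [eta [k [s [[eta1 eta_smooth eta_per] k0 _ trE]]]] := trace_exact.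
pose g y := \sum_S kahler I S * ext_d (@partial R) eta y S.
have gE y : k * (g y)%:C = lambda *+ r.
  have dy : dom (chart_at E y) y by exact: chart_atP.
  rewrite -mxtrace_scalar -(lam _ _ dy) /g rmorph_sum mulr_sumr raddf_sum.
  apply: eq_bigr => S _ /=; rewrite mxtraceZ.
  have trS : trace_form (F y) S = \tr (F y S) by rewrite /trace_form ffunE.
  by rewrite -[mxtrace _]trS trE rmorphM; ring.
have g_cst y : g y = g 0.
  by apply: (@complexI R); apply: (mulfI k0); rewrite !gE.
have g0 : g 0 = 0.
  exact: (exact_contraction_eq0 B_unit eta_smooth eta_per (U'_skew UI) g_cst).
have := gE 0; rewrite g0 mulr0 (lam _ _ dx) => /esym/eqP; rewrite mulrn_eq0.
case/orP => [/eqP r0|/eqP ->]; last by rewrite raddf0.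
by apply/matrixP => m n; have := ltn_ord m; rewrite {2}r0.
Qed.

(** The term with tr F /\ tr F integrates to 0. *)
Lemma c2_cup_kahler2_pairing L : U' L ->
  c2_cup_kahler2 A L = (8 * pi ^+ 2)^-1 *
    torus_integral B (fun x => square_pairing (trace_square (F x)) L).
Proof.
move=> UL; have [eta [k [s [[eta1 eta_smooth eta_per] k0 kk trE]]]] := trace_exact.
have [cq q0] := exact_square_pairing_integral B_unit eta1 eta_smooth eta_per (U'_skew UL) trE kk.
set kap := (8 * pi ^+ 2)^-1.
have cp := @chart_curvature_pairing_continuous _ _ _ _ A HYM_homogeneous L.
pose q x := square_pairing (wedge (trace_form (F x)) (trace_form (F x))) L.
pose p x := square_pairing (trace_square (F x)) L.
have -> : c2_cup_kahler2 A L = torus_integral B (fun x => kap * p x + (- kap * q x + 0)).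
  congr torus_integral; apply/funext => x.
  have h := c2_pairing kap UL (fun m n => @entry_homogeneous _ _ m n (chart_atP x)).
  by apply: etrans h _; rewrite mulrBr mulNr addr0.
have c0 : continuous (fun _ : 'rV[R]_8 => 0 : R) by exact: row_continuous_cst.
have cq0 : continuous (fun x => - kap * q x + 0).
  by move=> x; apply: row_continuousD; [apply: row_continuousM; [exact: row_continuous_cst|exact: cq]|exact: c0].
rewrite (torus_integral_linear B kap cp cq0).
rewrite (torus_integral_linear B (- kap) cq c0) q0 mulr0 add0r torus_integral_cst.
by rewrite mulr0 addr0.
Qed.

(** The squared norm of the 2-form F - F(L., L.): the full array counts each coefficient twice. *)
Definition type_defect L c x : R := (\sum_m \sum_n sqnorm (coefs c x m n
  - cx L *m coefs c x m n *m (cx L)^T)) / 2.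

Lemma type_defect_ge0 L c x : 0 <= type_defect L c x.
Proof.
apply: divr_ge0 => //; apply: sumr_ge0 => m _; apply: sumr_ge0 => n _; exact: sqnorm_ge0.
Qed.

Lemma type_defect_pairing L c x : U' L -> dom c x -> type_defect L c x =
  square_pairing (trace_square (F x)) I - square_pairing (trace_square (F x)) L.
Proof.
move=> UL dx.
have e := (curvature_trace_change HYM_homogeneous (chart_atP x) dx).2.
symmetry; apply: etrans (congr1 (fun a => square_pairing a I - square_pairing a L) e) _.
apply: (square_pairing_difference (F := curvature A c x) UI UL).
- by move=> m n; exact: entry_homogeneous.
- by move=> S; apply: curvature_adjoint dx; exact: HYM_homogeneous.
- by move=> m n; exact: A_HYM.1.
- exact: Lambda_curvature_eq0.
Qed.

(** The second half of the HYM condition for L comes for free, by [U'_primitive]. *)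
Lemma type_defect_eq0 L : U' L ->
  (forall c x, dom c x -> type_defect L c x = 0) <-> HYM A L.
Proof.
move=> UL; have [LL _] := U'_hermitian UL; split=> [d0|[tL _] c x dx]; last first.
  rewrite /type_defect big1 ?mul0r// => m _; rewrite big1// => n _.
  have [_ ->] := (has_type11P _ LL).1 (tL c x dx m n); rewrite subrr /sqnorm.
  by rewrite big1// => i _; rewrite big1// => j _; rewrite mxE /= expr0n addr0.
split=> [c x dx m n|].
  apply/(has_type11P _ LL); split; first exact: entry_homogeneous.
  have /eqP := d0 c x dx; rewrite mulf_eq0 invr_eq0 pnatr_eq0 orbF.
  rewrite psumr_eq0 => [/allP/(_ m (mem_index_enum m))|m' _]; last first.
    by apply: sumr_ge0 => n' _; exact: sqnorm_ge0.
  rewrite /= psumr_eq0 => [/allP/(_ n (mem_index_enum n))|n' _]; last exact: sqnorm_ge0.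
  by move=> /= /eqP/sqnorm_eq0/eqP; rewrite subr_eq0 => /eqP/esym.
exists 0 => c x dx; rewrite raddf0; apply/matrixP => m n; rewrite [RHS]mxE.
have two0 : 2 != 0 :> R[i] by rewrite pnatr_eq0.
have hF m' n' := @entry_homogeneous c x m' n' dx.
have [II _] := U'_hermitian UI.
apply: (mulfI two0); rewrite mulr0 (Lambda_contract_entry (U'_skew UL) (hF m n)).
apply: (U'_primitive UL UI); first by have [] := (has_type11P _ II).1 (A_HYM.1 c x dx m n).
rewrite -(Lambda_contract_entry (U'_skew UI) (hF m n)) Lambda_curvature_eq0//.
by rewrite mxE mulr0.
Qed.

Lemma c2_cup_kahler2_defect L : U' L ->
  c2_cup_kahler2 A I - c2_cup_kahler2 A L =
  (8 * pi ^+ 2)^-1 * torus_integral B (fun x => type_defect L (chart_at E x) x).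
Proof.
move=> UL; rewrite !c2_cup_kahler2_pairing// -mulrBr; congr (_ * _).
have cI := @chart_curvature_pairing_continuous _ _ _ _ A HYM_homogeneous I.
have cL := @chart_curvature_pairing_continuous _ _ _ _ A HYM_homogeneous L.
rewrite (_ : (fun x => type_defect _ _ _) = fun x =>
   -1 * square_pairing (trace_square (F x)) L + square_pairing (trace_square (F x)) I).
  by rewrite (torus_integral_linear B _ cL cI) mulN1r addrC.
apply/funext => x; rewrite type_defect_pairing//; last exact: chart_atP.
by rewrite mulN1r addrC.
Qed.

Lemma type_defect_regular L : U' L ->
  let D x := type_defect L (chart_at E x) x in
  continuous D /\ periodic_on B [set: 'rV[R]_8]%classic D.
Proof.
move=> UL D.
have DE : D = fun x => square_pairing (trace_square (F x)) I - square_pairing (trace_square (F x)) L.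
  by apply/funext => x; apply: type_defect_pairing => //; exact: chart_atP.
rewrite DE; split=> [x|x l Bl xT].
  by apply: row_continuousB; exact: (@chart_curvature_pairing_continuous _ _ _ _ A HYM_homogeneous).
have e K := @chart_curvature_pairing_periodic _ _ _ _ A HYM_homogeneous K x l Bl xT.
exact: (congr2 (fun u v : R => u - v) (e I) (e L)).
Qed.

End HYMInstanton.

Theorem theorem7 (R : realType)
    (B : 'M[R]_8) (B_basis : B \in unitmx)
    (I : 'M[R]_8) (I_compatible : U' I) (I_algebraic : algebraic_torus B I)
    (r : nat) (E : hermitian_bundle B r) (A : hermitian_connection E)
    (A_HYM : HYM A I) (c1E : c1_zero A)
    (L : 'M[R]_8) (L_compatible : U' L) :
  c2_cup_kahler2 A L <= c2_cup_kahler2 A I /\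
  (c2_cup_kahler2 A L = c2_cup_kahler2 A I <-> HYM A L).
Proof.
have k0 : 0 < (8 * pi ^+ 2)^-1 :> R.
  by rewrite invr_gt0 mulr_gt0// exprn_gt0// pi_gt0.
have defect := c2_cup_kahler2_defect B_basis I_compatible A_HYM c1E L_compatible.
have [cD pD] := type_defect_regular B_basis I_compatible A_HYM c1E L_compatible.
have D0 x : 0 <= type_defect A L (chart_at E x) x by exact: type_defect_ge0.
split.
  rewrite -subr_ge0 defect mulr_ge0 ?(ltW k0)//.
  exact: torus_integral_ge0.
rewrite -(type_defect_eq0 B_basis I_compatible A_HYM c1E L_compatible); split=> [eqc c x cx|d0].
  have int0 : torus_integral B (fun x => type_defect A L (chart_at E x) x) = 0.
    apply: (mulfI (lt0r_neq0 k0)); rewrite mulr0 -defect eqc subrr //.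
  have Dx := torus_integral_eq0 B_basis cD D0 pD int0 x.
  have dp := type_defect_pairing B_basis I_compatible A_HYM c1E L_compatible.
  exact: etrans (dp _ _ cx) (etrans (esym (dp _ _ (chart_atP x))) Dx).
apply/eqP; rewrite eq_sym -subr_eq0 defect.
rewrite (_ : (fun x => _) = fun=> 0) ?torus_integral_cst ?mulr0//.
by apply/funext => x; apply: d0; exact: chart_atP.
Qed.
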